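(* Let $\lambda>0$, let $(\nu_\xi)_{\xi\in\mathbb{R}^N}$ be a family of Lévy measures on $\mathbb{R}^N$ satisfying (M1), (M2), (M3) and (M4) below, with associated nonlocal operators $\mathcal I_\xi$, and let $H:\mathbb{R}^N\times\mathbb{R}^N\to\mathbb{R}$ satisfy (H0), (H1) and (H2) below. Then there exists a bounded continuous viscosity solution $u\in C(\mathbb{R}^N)\cap L^\infty(\mathbb{R}^N)$ of $$\lambda u-\mathcal I_x u(x)+H(x,Du)=0\quad\text{in }\mathbb{R}^N.$$ (M1) There is $C_\nu>0$ with $\sup_{\xi\in\mathbb{R}^N}\int_{\mathbb{R}^N}\min(1,|z|^2)\,\nu_\xi(dz)\le C_\nu$. (M2) $\sup_{\xi\in\mathbb{R}^N}\nu_\xi(\mathbb{R}^N\setminus B_R)\to0$ as $R\to\infty$. (M3) For all $0<r<R$ there is a modulus of continuity $\omega_{R,r}$ such that $|\nu_x-\nu_y|(B_R\setminus B_r)\le\omega_{R,r}(|x-y|)$ for all $x,y\in\mathbb{R}^N$. (M4) There are $r_0\in(0,1)$ and a function $o:(0,r_0)\to[0,\infty)$ with $o(r)\to0$ as $r\to0$ such that $W_2(\nu_x,\nu_y)(B_r)\le o(r)\,|x-y|^{1/2}$ for all $0<r<r_0$ and all $x,y\in\mathbb{R}^N$. (H0) $H\in C(\mathbb{R}^N\times\mathbb{R}^N)$ and $\sup_{x\in\mathbb{R}^N}|H(x,0)|<+\infty$. (H1) There are $m>1$ and moduli of continuity $\omega_H^1,\omega_H^2$ such that for all $x,y,p,q\in\mathbb{R}^N$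 with $|q|\le1$, $H(y,p+q)-H(x,p)\le\omega_H^1(|x-y|)(1+|p|^m)+\omega_H^2(|q|)(1+|p|^{m-1})$. (H2) With the same $m>1$, there are constants $b_m,b_0>0$, $\rho_0>0$ and $\mu_0\in(0,1)$ such that for all $\mu\in[\mu_0,1]$ and $x,p\in\mathbb{R}^N$ with $|p|\ge\rho_0$, $\mu H(x,\mu^{-1}p)-H(x,p)\ge(1-\mu)(b_m|p|^m-b_0)$.
   Context: $B_r(x)$ is the open ball of radius $r$ centered at $x$ in $\mathbb{R}^N$, $B_r=B_r(0)$, $B=B_1$. $USC$/$LSC$ denote upper/lower semicontinuous functions. A modulus of continuity is a function $\omega:[0,\infty)\to[0,\infty)$ with $\omega(s)\to0$ as $s\to0$. A Lévy measure on $A\subset\mathbb{R}^N$ is a positive Borel measure $\nu$ on $A$ with $\nu(\{0\})=0$ and $\int_{A\setminus\{0\}}\min(1,|z|^2)\nu(dz)<\infty$. Nonlocal operators: $\mathcal I_\xi u(x)=\int_{\mathbb{R}^N}\big(u(x+z)-u(x)-\mathbf 1_B(z)Du(x)\cdot z\big)\nu_\xi(dz)$. For $A\subset\mathbb{R}^N$ measurable, $\mathcal I[A](x,p,\phi)=\int_A\big(\phi(x+z)-\phi(x)-\mathbf 1_B(z)\,p\cdot z\big)\nu_x(dz)$, and $\mathcal I[A](x,\phi)=\mathcal I[A](x,D\phi(x),\phi)$ when $\phi$ is $C^2$ near $x$. Viscosity solutions: $u\in USC(\mathbb{R}^N)\cap L^\infty(\mathbb{R}^N)$ is a viscosity subsolution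 if, for every $\bar x\in\mathbb{R}^N$, $\delta>0$ and $\phi\in C^2(B_1(\bar x))\cap L^\infty(\mathbb{R}^N)$ such that $\bar x$ is a maximum point of $u-\phi$ in $B_\delta(\bar x)$, $$\lambda u(\bar x)-\mathcal I[B_\delta](\bar x,\phi)-\mathcal I[B_\delta^c](\bar x,D\phi(\bar x),u)+H(\bar x,D\phi(\bar x))\le0.$$ A function in $LSC(\mathbb{R}^N)\cap L^\infty(\mathbb{R}^N)$ is a viscosity supersolution if the same holds with ''minimum'' in place of ''maximum'' and $\ge0$ in place of $\le0$. A function in $C(\mathbb{R}^N)\cap L^\infty(\mathbb{R}^N)$ is a viscosity solution if it is both a viscosity subsolution and a viscosity supersolution. Total variation: $|\nu_1-\nu_2|=(\nu_1-\nu_2)^++(\nu_1-\nu_2)^-$ is the total variation (Jordan decomposition) of the signed measure $\nu_1-\nu_2$ on $\mathbb{R}^N\setminus\{0\}$ (Lévy measures are finite on sets bounded away from $0$). Wasserstein distance: for $0\in A\subset B$ and Lévy measures $\nu_1,\nu_2$ on $A$, $\mathrm{Adm}_A(\nu_1,\nu_2)$ is the set of positive measures $\gamma$ on $A\times A$ with $\gamma(\{(0,0)\})=0$ and $(\pi^i_\#\gamma)|_{A\setminus\{0\}}=\nu_i$, $i=1,2$, where $\pi^i(z_1,z_2)=z_i$ (the mass of the marginals at the origin is unconstrained). For $p\in[1,2]$, $W_p(\nu_1,\nu_2)(B_r)=\Big(\inf_{\gamma\in\mathrm{Adm}_{B_r}(\nu_1|_{B_r},\nu_2|_{B_r})}\int_{B_r\times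 B_r}|z_1-z_2|^p\,d\gamma(z_1,z_2)\Big)^{1/p}$. *)

(* Defs.v *)
From HB Require Import structures.
From mathcomp Require Import all_boot all_order all_algebra.
From mathcomp Require Import all_classical all_reals all_analysis.
From mathcomp Require Import measurable_realfun.

Set Implicit Arguments.
Unset Strict Implicit.
Unset Printing Implicit Defensive.

Import Order.TTheory GRing.Theory Num.Theory.
Import numFieldNormedType.Exports.

Local Open Scope classical_set_scope.
Local Open Scope ring_scope.

(* R^N with its Borel sigma-algebra.  As a type this is 'rV[R]_N. *)
Notation borelV R N := (g_sigma_algebraType (@open 'rV[R]_N)).

Section euclidean.
Variables (R : realType) (N : nat).
Implicit Types (x y : 'rV[R]_N) (r s : R).

(* The library norm `|x| on row vectors is the sup norm; it induces the same
   topology as the Euclidean norm but not the same balls. *)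
Definition dotv x y : R := \sum_(i < N) x 0 i * y 0 i.

Definition enorm x : R := Num.sqrt (dotv x x).

Definition eball x r : set 'rV[R]_N := [set y | enorm (y - x) < r].

Definition annulus r s : set 'rV[R]_N := eball 0 s `\` eball 0 r.

Lemma dotv_continuous : continuous (fun x => dotv x x).
Proof.
apply: continuous_big => [|i _ x]; first exact: add_continuous.
have ci : {for x, continuous (fun y : 'rV[R]_N => y 0 i)}.
  exact: coord_continuous.
exact: (continuousM ci ci).
Qed.

Lemma enorm_continuous : continuous enorm.
Proof.
move=> x; apply: continuous_comp; first exact: dotv_continuous.
exact: sqrt_continuous.
Qed.

Lemma enorm_ge0 x : 0 <= enorm x. Proof. exact: sqrtr_ge0. Qed.

Lemma enorm0 : enorm 0 = 0.
Proof. by rewrite /enorm /dotv big1 ?sqrtr0// => i _; rewrite mxE mulr0. Qed.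

Lemma open_eball0 r : open (eball 0 r).
Proof.
have -> : eball 0 r = enorm @^-1` [set t | t < r].
  by apply/seteqP; split => y; rewrite /eball /= subr0.
by apply: open_comp => [y _|]; [exact: enorm_continuous|exact: open_lt].
Qed.

Lemma measurable_open (A : set (borelV R N)) :
  @open 'rV[R]_N A -> measurable A.
Proof. by move=> oA; apply: sub_sigma_algebra. Qed.
Arguments measurable_open : clear implicits.

Lemma measurable_eball0 r : measurable (eball 0 r : set (borelV R N)).
Proof. exact: (measurable_open _ (@open_eball0 r)). Qed.

Lemma measurable_annulus r s :
  measurable (annulus r s : set (borelV R N)).
Proof. by apply: measurableD; exact: measurable_eball0. Qed.

Lemma measurable_enorm : measurable_fun setT (enorm : borelV R N -> R).
Proof.
apply: (measurability _ (RGenOInfty.measurableE R)) => _ [_ [a ->] <-].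
rewrite setTI; apply: measurable_open; apply: open_comp => [y _|].
  exact: enorm_continuous.
exact: interval_open.
Qed.

End euclidean.

Section levy.
Variables (R : realType) (N : nat).
Local Open Scope ereal_scope.

Record levyMeasure := LevyMeasure {
  levy_meas :> {measure set (borelV R N) -> \bar R} ;
  levy_at0 : levy_meas [set 0%R] = 0 ;
  levy_int : \int[levy_meas]_(z in ~` [set 0%R])
               (Num.min 1 (enorm z ^+ 2))%:E < +oo }.

Lemma levy_annulus_lty (nu : levyMeasure) (r s : R) :
  (0 < r)%R -> nu (annulus r s) < +oo.
Proof.
move=> r0; pose c := Num.min 1%R (r ^+ 2)%R.
have c0 : (0 < c)%R by rewrite lt_min ltr01 exprn_gt0.
have mD := @measurable_annulus R N r s.
have mmin : measurable_fun setT
    (fun z : borelV R N => (Num.min 1 (enorm z ^+ 2))%:E).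
  apply/measurable_EFinP; apply: measurable_minr => //.
  by apply: measurable_funX; exact: measurable_enorm.
have m0 : measurable (~` [set 0%R] : set (borelV R N)).
  apply: measurable_open; apply: closed_openC.
  exact: accessible_closed_set1 (hausdorff_accessible (@norm_hausdorff _ _)) _.
suff : c%:E * nu (annulus r s) < +oo.
  apply: contraTT; rewrite -!leNgt !leye_eq => /eqP ->.
  by rewrite gt0_muley// lte_fin.
rewrite -integral_cst//; apply: le_lt_trans (levy_int nu).
apply: (@le_trans _ _ (\int[nu]_(z in annulus r s)
    (Num.min 1 (enorm z ^+ 2))%:E)).
  apply: ge0_le_integral => //.
  - by move=> z _; rewrite lee_fin ltW.
  - exact: measurable_funTS.
  - move=> z [_ /=]; rewrite /eball/= subr0 => /negP; rewrite -leNgt => rz.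
    rewrite lee_fin /c le_min ge_min lexx/= ge_min.
    by rewrite lerXn2r ?orbT// ?nnegrE ?enorm_ge0// ltW.
apply: ge0_subset_integral => //.
- exact: measurable_funTS.
- by move=> z _; rewrite lee_fin le_min ler01 exprn_ge0// enorm_ge0.
- move=> z [_ /=]; rewrite /eball/= => + z0.
  by rewrite z0 subr0 enorm0.
Qed.

End levy.

Section charge_tv_def.
Context d (T : measurableType d) (R : realType).
Local Open Scope ereal_scope.

Definition hahn_pair (rho : {charge set T -> \bar R}) :
  {PN : set T * set T | hahn_decomposition rho PN.1 PN.2}.
Proof.
apply: cid; have [P [Q PQ]] := Hahn_decomposition rho.
by exists (P, Q).
Qed.

(* The Hahn decomposition is unique up to null sets, so that this does not
   depend on the choice made in hahn_pair. *)
Definition charge_tv (rho : {charge set T -> \bar R}) : set T -> \bar R :=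
  charge_variation (svalP (hahn_pair rho)).

Definition mdiff (mu1 mu2 : {finite_measure set T -> \bar R}) :
    {charge set T -> \bar R} :=
  cadd (charge_of_finite_measure mu1) (copp (charge_of_finite_measure mu2)).

End charge_tv_def.

Section hypotheses.
Variables (R : realType) (N : nat).
Local Notation V := 'rV[R]_N.
Implicit Types (nu : V -> levyMeasure R N) (H : V -> V -> R).

(* |nu1 - nu2|(B_s \ B_r).  The difference of two Levy measures is a (finite)
   signed measure only away from the origin, whence the restriction. *)
Definition annulus_tv (nu1 nu2 : levyMeasure R N) (r s : R) (r0 : 0 < r) :
    \bar R :=
  charge_tv
    (mdiff (mfrestr (@measurable_annulus R N r s) (levy_annulus_lty nu1 s r0))
           (mfrestr (@measurable_annulus R N r s) (levy_annulus_lty nu2 s r0)))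
    (annulus r s).

(* A measure on A x A is encoded as a measure on R^N x R^N that does not
   charge the complement of A x A. *)
Definition adm (A : set (borelV R N))
    (nu1 nu2 : {measure set (borelV R N) -> \bar R}) :
    set {measure set (borelV R N * borelV R N) -> \bar R} :=
  [set gamma | [/\ gamma (~` (A `*` A)) = 0%E,
    gamma [set (0, 0)] = 0%E,
    forall E, measurable E -> E `<=` A `\ 0 ->
      pushforward gamma fst E = nu1 E &
    forall E, measurable E -> E `<=` A `\ 0 ->
      pushforward gamma snd E = nu2 E]].

(* adm only evaluates nu1 and nu2 on subsets of B_r, so that no explicit
   restriction to B_r is needed. *)
Definition wasserstein (p : R) (nu1 nu2 : levyMeasure R N) (r : R) : \bar R :=
  ((ereal_inf [set \int[gamma]_z ((enorm (z.1 - z.2) : R) `^ p)%:E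
               | gamma in adm (eball 0 r) nu1 nu2]) `^ p^-1)%E.

(* The limit at 0 is punctured: w 0 = 0 is not required. *)
Definition modulus (w : R -> R) : Prop :=
  (forall s, 0 <= s -> 0 <= w s) /\ w s @[s --> 0^'+] --> 0.

Definition hypM1 nu : Prop := exists2 Cnu : R, 0 < Cnu &
  (ereal_sup (range (fun xi => \int[nu xi]_z (Num.min 1 (enorm z ^+ 2))%:E))
    <= Cnu%:E)%E.

Definition hypM2 nu : Prop :=
  ereal_sup (range (fun xi => nu xi (~` eball 0 r))) @[r --> +oo] --> 0%E.

Definition hypM3 nu : Prop := forall (r s : R) (r0 : 0 < r), r < s ->
  exists2 w, modulus w &
    forall x y, (annulus_tv (nu x) (nu y) s r0 <= (w (enorm (x - y)))%:E)%E.

Definition hypM4 nu : Prop := exists (r0 : R) (o : R -> R),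
  [/\ 0 < r0 < 1,
      forall r, 0 < r < r0 -> 0 <= o r,
      o r @[r --> 0^'+] --> 0 &
      forall r x y, 0 < r < r0 ->
        (wasserstein 2 (nu x) (nu y) r <= (o r * Num.sqrt (enorm (x - y)))%:E)%E].

Definition hypH0 H : Prop :=
  continuous (fun xp : V * V => H xp.1 xp.2) /\
  has_ubound (range (fun x => `|H x 0|)).

Definition hypH1 (m : R) H : Prop := exists w1 w2 : R -> R,
  [/\ modulus w1, modulus w2 &
    forall x y p q : V, enorm q <= 1 ->
      H y (p + q) - H x p <= w1 (enorm (x - y)) * (1 + enorm p `^ m)
                           + w2 (enorm q) * (1 + enorm p `^ (m - 1))].

Definition hypH2 (m : R) H : Prop := exists bm b0 rho0 mu0 : R,
  [/\ 0 < bm, 0 < b0, 0 < rho0, 0 < mu0 < 1 &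
    forall (mu : R) (x p : V), mu0 <= mu <= 1 -> rho0 <= enorm p ->
      mu * H x (mu^-1 *: p) - H x p >= (1 - mu) * (bm * enorm p `^ m - b0)].

End hypotheses.

Section viscosity.
Variables (R : realType) (N : nat).
Local Notation V := 'rV[R]_N.
Implicit Types (f u phi : V -> R) (A : set V).

Definition usc u : Prop := lower_semicontinuous (fun x => (- u x)%:E).
Definition lsc u : Prop := lower_semicontinuous (fun x => (u x)%:E).

(* Functions in L^oo are evaluated pointwise and integrated against arbitrary
   Borel measures: they are Borel and bounded everywhere, not classes modulo
   Lebesgue-null sets. *)
Definition Linfty f : Prop :=
  measurable_fun setT (f : borelV R N -> R) /\ bounded_fun f.

(* Frechet C^1; since V is finite-dimensional, continuity of the differential
   is continuity of x |-> 'D_v f x for each direction v. *)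
Definition C1_on A f : Prop :=
  (forall x, A x -> differentiable f x) /\
  (forall v x, A x -> {for x, continuous ('D_v f)}).

Definition C2_on A f : Prop := C1_on A f /\ forall v, C1_on A ('D_v f).

Definition grad f x : V := \row_i 'D_(delta_mx 0 i) f x.

Definition nonlocal_op (nu : V -> levyMeasure R N) A x (p : V) f : R :=
  (\int[nu x]_(z in A)
     (f (x + z) - f x - \1_(eball 0 1) z * dotv p z))%R.

Definition visc_op (lambda : R) (nu : V -> levyMeasure R N) (H : V -> V -> R)
    u phi (delta : R) x : R :=
  lambda * u x
  - nonlocal_op nu (eball 0 delta) x (grad phi x) phi
  - nonlocal_op nu (~` eball 0 delta) x (grad phi x) u
  + H x (grad phi x).

Definition visc_subsol (lambda : R) (nu : V -> levyMeasure R N)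
    (H : V -> V -> R) u : Prop :=
  [/\ usc u, Linfty u &
    forall x (delta : R) phi, 0 < delta ->
      C2_on (eball x 1) phi -> Linfty phi ->
      (forall y, eball x delta y -> u y - phi y <= u x - phi x) ->
      visc_op lambda nu H u phi delta x <= 0].

Definition visc_supersol (lambda : R) (nu : V -> levyMeasure R N)
    (H : V -> V -> R) u : Prop :=
  [/\ lsc u, Linfty u &
    forall x (delta : R) phi, 0 < delta ->
      C2_on (eball x 1) phi -> Linfty phi ->
      (forall y, eball x delta y -> u x - phi x <= u y - phi y) ->
      0 <= visc_op lambda nu H u phi delta x].

Definition visc_sol (lambda : R) (nu : V -> levyMeasure R N)
    (H : V -> V -> R) u : Prop :=
  [/\ continuous u, Linfty u, visc_subsol lambda nu H u &
      visc_supersol lambda nu H u].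

End viscosity.

(* Main.v *)
Require Import Defs.
From HB Require Import structures.
From mathcomp Require Import all_boot all_order all_algebra.
From mathcomp Require Import all_classical all_reals all_analysis.
From mathcomp Require Import measurable_realfun.
From mathcomp Require Import ring lra.

(* Call u a subsolution in the paraboloid sense if, wherever u is touched from
   above by a paraboloid u x + p.z + C|z|^2, the equation holds at x with slope p
   and with u itself in the whole nonlocal term; the integrand is then bounded
   above by a multiple of min(1, |z|^2), so the integral makes sense in
   [-oo, +oo[ and its finiteness is part of the conclusion.  Comparison and
   Perron's method are carried out for this notion, and Taylor's formula for C^2
   test functions turns it into the usual one at the very end.

   Comparison: for mu < 1 close to 1, maximize
   mu u(x) - v(y) - L|x - y|^2 - psi(x) with psi a bounded penalization at
   infinity, and let p = 2L(x - y).  Near the origin an almost optimal coupling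
   bounds the difference of the nonlocal terms by L W_2^2, which by (M4) is a
   small multiple of |p|; on an annulus it is controlled by (M3) and again grows at
   most linearly in |p|, and (M2) takes care of the tails.  Since m >= 1, all of
   these, as well as the errors in (H1), are absorbed by the coercive term
   (1 - mu) b_m |p|^m which (H2) provides.  The order of choices is mu, then the
   radii of the annulus, then L, then psi.

   Existence: the upper envelope of the supremum of all subsolutions bounded by
   sup|H(., 0)|/lambda is a subsolution, the bump construction makes its lower
   envelope a supersolution, and comparison makes the two envelopes agree.  Both
   passages to the limit rest on a Fatou lemma along nu_{x_n}, x_n -> x: (M3)
   replaces nu_{x_n} by nu_x on annuli, while (M2) and (M4) make
   min(1, |z|^2) nu_{x_n} uniformly small near infinity and near the origin. *)

Set Implicit Arguments.
Unset Strict Implicit.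
Unset Printing Implicit Defensive.

Import Order.TTheory GRing.Theory Num.Theory.
Import numFieldNormedType.Exports.

Local Open Scope classical_set_scope.
Local Open Scope ring_scope.

(** * Euclidean norm on row vectors *)

Section euclid.
Variables (R : realType) (N : nat).
Local Notation V := 'rV[R]_N.
Implicit Types (x y z p q : V) (r s a t : R).

Lemma dotvC x y : dotv x y = dotv y x.
Proof. by apply: eq_bigr => i _; rewrite mulrC. Qed.

Lemma dotvDl x y z : dotv (x + y) z = dotv x z + dotv y z.
Proof. by rewrite -big_split; apply: eq_bigr => i _; rewrite mxE mulrDl. Qed.

Lemma dotvDr x y z : dotv x (y + z) = dotv x y + dotv x z.
Proof. by rewrite dotvC dotvDl !(dotvC x). Qed.

Lemma dotvZl a x z : dotv (a *: x) z = a * dotv x z.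
Proof. by rewrite mulr_sumr; apply: eq_bigr => i _; rewrite mxE mulrA. Qed.

Lemma dotvZr a x z : dotv x (a *: z) = a * dotv x z.
Proof. by rewrite dotvC dotvZl dotvC. Qed.

Lemma dotvNl x z : dotv (- x) z = - dotv x z.
Proof. by rewrite -scaleN1r dotvZl mulN1r. Qed.

Lemma dotvNr x z : dotv x (- z) = - dotv x z.
Proof. by rewrite dotvC dotvNl dotvC. Qed.

Lemma dotv0l z : dotv 0 z = 0 :> R.
Proof. by rewrite -(scale0r z) dotvZl mul0r. Qed.

Lemma dotv0r z : dotv z 0 = 0 :> R.
Proof. by rewrite dotvC dotv0l. Qed.

Definition dotvE := (dotvDl, dotvDr, dotvZl, dotvZr, dotvNl, dotvNr).

Lemma dotv_ge0 x : 0 <= dotv x x.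
Proof. by apply: sumr_ge0 => i _; rewrite -expr2 sqr_ge0. Qed.

Lemma enorm_sqr x : enorm x ^+ 2 = dotv x x.
Proof. by rewrite sqr_sqrtr ?dotv_ge0. Qed.

Lemma dotv_eq0 x : dotv x x = 0 -> x = 0.
Proof.
move=> /eqP; rewrite psumr_eq0 => [/allP h|i _]; last by rewrite -expr2 sqr_ge0.
apply/rowP => i; rewrite mxE; apply/eqP.
by have := h i (mem_index_enum _); rewrite /= mulf_eq0 orbb.
Qed.

Lemma enorm_eq0 x : enorm x = 0 -> x = 0.
Proof. by move=> h; apply: dotv_eq0; rewrite -enorm_sqr h expr0n. Qed.

Lemma dotv_le x y : dotv x y <= enorm x * enorm y.
Proof.
have [->|x0] := eqVneq x 0; first by rewrite dotv0l enorm0 mul0r.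
have [->|y0] := eqVneq y 0; first by rewrite dotv0r enorm0 mulr0.
have px : 0 < enorm x.
  by rewrite lt_neqAle enorm_ge0 andbT eq_sym; apply: contra_neq x0 => /enorm_eq0.
have py : 0 < enorm y.
  by rewrite lt_neqAle enorm_ge0 andbT eq_sym; apply: contra_neq y0 => /enorm_eq0.
have := dotv_ge0 (enorm y *: x - enorm x *: y).
rewrite !dotvE (dotvC y x) -!enorm_sqr => h.
have pxy : 0 < enorm x * enorm y by rewrite mulr_gt0.
nra.
Qed.

Lemma norm_dotv_le x y : `|dotv x y| <= enorm x * enorm y.
Proof.
rewrite ler_norml dotv_le andbT lerNl -dotvNl (le_trans (dotv_le _ _))//.
by rewrite /enorm dotvNl dotvNr opprK.
Qed.

Lemma enormN x : enorm (- x) = enorm x.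
Proof. by rewrite /enorm dotvNl dotvNr opprK. Qed.

Lemma enormB x y : enorm (x - y) = enorm (y - x).
Proof. by rewrite -enormN opprB. Qed.

Lemma enormD x y : enorm (x + y) <= enorm x + enorm y.
Proof.
rewrite -[leRHS]ger0_norm ?addr_ge0 ?enorm_ge0// -sqrtr_sqr ler_wsqrtr//.
rewrite !dotvE (dotvC y x) sqrrD !enorm_sqr.
by have := dotv_le x y; lra.
Qed.

Lemma enormZ a x : enorm (a *: x) = `|a| * enorm x.
Proof. by rewrite /enorm dotvZl dotvZr mulrA -expr2 sqrtrM ?sqr_ge0// sqrtr_sqr. Qed.

Lemma enorm_triangle y x z : enorm (x - z) <= enorm (x - y) + enorm (y - z).
Proof. by apply: le_trans (enormD _ _); rewrite addrA subrK. Qed.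

Lemma enorm_lt_sqr x r : 0 <= r -> (enorm x < r) = (dotv x x < r ^+ 2).
Proof. by move=> r0; rewrite -enorm_sqr ltr_sqr ?nnegrE ?enorm_ge0. Qed.

Lemma enorm_le_sqr x r : 0 <= r -> (enorm x <= r) = (dotv x x <= r ^+ 2).
Proof. by move=> r0; rewrite -enorm_sqr ler_sqr ?nnegrE ?enorm_ge0. Qed.

Lemma coord_le_enorm x i : `|x 0 i| <= enorm x.
Proof.
rewrite -sqrtr_sqr ler_wsqrtr// /dotv (bigD1 i)//= expr2 lerDl.
by apply: sumr_ge0 => j _; rewrite -expr2 sqr_ge0.
Qed.

Lemma norm_le_enorm x : `|x| <= enorm x.
Proof.
have [->|x0] := eqVneq x 0; first by rewrite normr0 enorm_ge0.
have nx : mx_norm x != 0 by rewrite -[mx_norm x]/`|x| normr_eq0.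
have [i e] := mx_norm_neq0 nx.
rewrite -[`|x|]/(mx_norm x) e (ord1 i.1); exact: coord_le_enorm.
Qed.

(** The ambient topology comes from the sup norm; [enorm] dominates that norm and is continuous, so
    Euclidean balls form a base of the same neighbourhoods. *)
Lemma nbhs_eball x (A : set V) :
  nbhs x A <-> exists2 d, 0 < d & forall y, enorm (y - x) < d -> A y.
Proof.
split.
  move=> /nbhs_ballP[d /= d0 h]; exists d => // y yx; apply: h.
  by rewrite -ball_normE /= distrC (le_lt_trans (norm_le_enorm _)).
move=> [d d0 h].
have : \forall y \near x, enorm (y - x) < d.
  have c : {for x, continuous (fun y => enorm (y - x))}.
    apply: continuous_comp; last exact: enorm_continuous.
    by apply: (@cvgB _ V V (nbhs x) _ id (cst x) x x); [exact: cvg_id|exact: cvg_cst].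
  apply: (cvgr_lt (enorm (x - x)) c d).
  by rewrite subrr enorm0.
exact: (@filterS _ (nbhs x)  (nbhs_filter x) _ _ h).
Qed.

Lemma continuous_eball (f : V -> R) :
  (forall x e, 0 < e -> exists2 d, 0 < d &
     forall y, enorm (y - x) < d -> `|f y - f x| <= e) -> continuous f.
Proof.
move=> h x; apply/(@cvgrPdist_le _ _ _ _ (nbhs_filter x)) => e e0; apply/nbhs_eball.
by have [d d0 hd] := h x e e0; exists d => // y /hd; rewrite distrC.
Qed.

Lemma bounded_eball_compact r : compact [set x : V | enorm x <= r].
Proof.
apply: bounded_closed_compact.
  exists r; split; first by rewrite num_real.
  move=> M rM x /= xr; apply: le_trans (norm_le_enorm _) _.
  exact: le_trans xr (ltW rM).
have -> : [set x : V | enorm x <= r] = (fun x => enorm x) @^-1` [set t | t <= r] by [].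
by apply: closed_comp => [y _|]; [exact: enorm_continuous|exact: closed_le].
Qed.

End euclid.

(** Without a maximum, every point of [K] has a neighbourhood on which [f] stays below a value
    attained on [K]. The near-covering form of compactness, along the filter generated by the
    superlevel sets, then yields one attained value strictly above all values on [K], itself
    included. *)
Lemma usc_max (T : topologicalType) (R : realType) (K : set T) (f : T -> R) :
  compact K -> K !=set0 ->
  (forall x, K x -> forall a, f x < a -> \forall y \near x, f y < a) ->
  exists2 x, K x & forall y, K y -> f y <= f x.
Proof.
move=> /compact_near_coveringP cK [x0 Kx0] uf.
apply: contrapT => nomax.
have lt x : K x -> exists2 y, K y & f x < f y.
  move=> Kx; apply: contrapT => h; apply: nomax; exists x => // y Ky.
  by rewrite leNgt; apply/negP => xy; apply: h; exists y.
have FF : Filter (filter_from K (fun y => [set z | K z /\ f y <= f z])).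
  apply: filter_from_filter; first by exists x0.
  move=> i j Ki Kj; have [ij|ji] := leP (f i) (f j).
    by exists j => // z [Kz jz]; split; split => //; exact: le_trans jz.
  by exists i => // z [Kz jz]; split; split => //; exact: le_trans (ltW ji) jz.
have [|y Ky hy] := cK T _ (fun y z => f z < f y) FF.
  move=> x Kx; have [y Ky xy] := lt x Kx.
  exists ([set z | f z < f y], [set z | K z /\ f y <= f z]).
    by split; [exact: uf|exists y].
  by move=> [a b] /= [fa [_ fb]]; exact: lt_le_trans fa fb.
by have := hy y (conj Ky (lexx _)) _ Ky; rewrite ltxx.
Qed.

(** * Semicontinuity and envelopes *)

Section semicontinuity.
Variables (R : realType) (N : nat).
Local Notation V := 'rV[R]_N.
Implicit Types (u v f : V -> R) (x y z p q : V) (r s a t M : R).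

(** Epsilon-delta form of [usc] in Euclidean balls, used throughout; [uscd_usc] and [lscd_lsc]
    translate it when viscosity solutions come in. *)
Definition uscd u := forall x e, 0 < e ->
  exists2 d, 0 < d & forall y, enorm (y - x) < d -> u y < u x + e.

Definition lscd u := uscd (fun x => - u x).

Lemma lscdP u : lscd u <-> forall x e, 0 < e ->
  exists2 d, 0 < d & forall y, enorm (y - x) < d -> u x - e < u y.
Proof.
by split=> h x e e0; have [d d0 hd] := h x e e0; exists d => // y /hd; lra.
Qed.

Lemma lscd_lsc u : lscd u -> lsc u.
Proof.
move=> /lscdP h x a; rewrite lte_fin => ax.
have [d d0 hd] := h x (u x - a) ltac:(lra).
exists [set y | enorm (y - x) < d].
  by apply/nbhs_eball; exists d.
by move=> y /= /hd; rewrite lte_fin; lra.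
Qed.

Lemma uscd_usc u : uscd u -> usc u.
Proof.
move=> h; apply: lscd_lsc => x e e0.
by have [d d0 hd] := h x e e0; exists d => // y /hd; lra.
Qed.

Lemma uscd_near u x a : uscd u -> u x < a -> \forall y \near x, u y < a.
Proof.
move=> h ua; have [d d0 hd] := h x (a - u x) ltac:(lra).
by apply/nbhs_eball; exists d => // y /hd; lra.
Qed.

Lemma uscd_measurable u : uscd u -> measurable_fun setT (u : borelV R N -> R).
Proof.
move=> h; apply: (measurability _ (RGenInftyO.measurableE R)) => _ [_ [a ->] <-].
rewrite setTI; apply: measurable_open.
rewrite openE => x /=; rewrite /interior in_itv/= => xa.
have := uscd_near h xa.
by apply: (@filterS _ (nbhs x) (nbhs_filter x)) => y /=; rewrite in_itv.
Qed.

Lemma lscd_measurable u : lscd u -> measurable_fun setT (u : borelV R N -> R).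
Proof.
move=> /uscd_measurable /measurable_funN.
by apply: eq_measurable_fun => x _ /=; rewrite opprK.
Qed.

Lemma uscdD u v : uscd u -> uscd v -> uscd (fun x => u x + v x).
Proof.
move=> hu hv x e e0.
have [d d0 hd] := hu x (e / 2) ltac:(lra).
have [d' d'0 hd'] := hv x (e / 2) ltac:(lra).
exists (Num.min d d'); first by rewrite lt_min d0.
by move=> y; rewrite lt_min => /andP[/hd + /hd']; lra.
Qed.

Lemma uscdZ a u : 0 < a -> uscd u -> uscd (fun x => a * u x).
Proof.
move=> a0 hu x e e0.
have [d d0 hd] := hu x (e / a) ltac:(by rewrite divr_gt0).
by exists d => // y /hd; rewrite -(ltr_pM2l a0) mulrDr mulrCA divff ?mulr1// gt_eqF.
Qed.

Lemma uscd_max u v : uscd u -> uscd v -> uscd (fun x => Num.max (u x) (v x)).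
Proof.
move=> hu hv x e e0.
have [d d0 hd] := hu x e e0.
have [d' d'0 hd'] := hv x e e0.
exists (Num.min d d'); first by rewrite lt_min d0.
move=> y; rewrite lt_min => /andP[/hd h /hd' h']; rewrite gt_max; apply/andP; split.
  by apply: lt_le_trans h _; rewrite lerD2r le_max lexx.
by apply: lt_le_trans h' _; rewrite lerD2r le_max lexx orbT.
Qed.

Lemma continuous_uscd u : continuous u -> uscd u.
Proof.
move=> cu x e e0.
have := (@cvgr_lt _ _ (nbhs x) (nbhs_filter x) _ (u x) (cu x) (u x + e)).
by move=> /(_ ltac:(lra)) /nbhs_eball.
Qed.

Lemma continuous_lscd u : continuous u -> lscd u.
Proof.
move=> cu x e e0.
have := (@cvgr_gt _ _ (nbhs x) (nbhs_filter x) _ (u x) (cu x) (u x - e)).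
move=> /(_ ltac:(lra)) /nbhs_eball[d d0 hd].
by exists d => // y /hd; lra.
Qed.

Lemma uscd_lscd_continuous u : uscd u -> lscd u -> continuous u.
Proof.
move=> us /lscdP ls; apply: continuous_eball => x e e0.
have [d d0 hd] := us x e e0.
have [d' d'0 hd'] := ls x e e0.
exists (Num.min d d'); first by rewrite lt_min d0.
move=> y; rewrite lt_min => /andP[/hd h /hd' h'].
by rewrite ler_norml; apply/andP; split; lra.
Qed.

Lemma continuous_dotv p : continuous (fun z : V => dotv p z).
Proof.
apply: continuous_eball => x e e0; exists (e / (enorm p + 1)).
  by rewrite divr_gt0// ltr_pwDr// enorm_ge0.
move=> y yx; rewrite -dotvNr -dotvDr (le_trans (norm_dotv_le _ _))//.
have p1 : 0 < enorm p + 1 by rewrite ltr_pwDr// enorm_ge0.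
move: yx; rewrite ltr_pdivlMr// mulrDr mulr1 => yx.
by rewrite mulrC; have := enorm_ge0 (y - x); lra.
Qed.

Definition parab x0 a p C : V -> R :=
  fun x => a + dotv p (x - x0) + C * dotv (x - x0) (x - x0).

(** Recentring a paraboloid keeps its opening [C] and changes only its slope; contact near [x0] can
    thus be expressed at the new contact point. *)
Lemma parab_shift x0 a p C x z : parab x0 a p C (x + z) =
  parab x0 a p C x + dotv (p + (2 * C) *: (x - x0)) z + C * dotv z z.
Proof.
rewrite /parab (_ : x + z - x0 = x - x0 + z); last by rewrite addrAC.
by move: (x - x0) => y; rewrite !dotvE (dotvC z y); ring.
Qed.

Lemma continuous_parab x0 a p C : continuous (parab x0 a p C).
Proof.
have cs : continuous (fun x : V => x - x0).
  by move=> x; apply: (@cvgB _ V V (nbhs x) _ id (cst x0) x x0);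
     [exact: cvg_id|exact: cvg_cst].
move=> x; apply: (@continuousD _ R V (fun y => a + dotv p (y - x0))
  (fun y => C * dotv (y - x0) (y - x0))).
  apply: (@continuousD _ R V (cst a) (fun y => dotv p (y - x0))).
    exact: cst_continuous.
  by apply: (@continuous_comp _ _ _ (fun y => y - x0) (dotv p));
    [exact: cs|exact: continuous_dotv].
apply: (@continuousM _ V (cst C) (fun y => dotv (y - x0) (y - x0))).
  exact: cst_continuous.
by apply: (@continuous_comp _ _ _ (fun y => y - x0) (fun z => dotv z z));
    [exact: cs|exact: dotv_continuous].
Qed.

(** The upper semicontinuous envelope, as the infimum of local upper bounds. The balls contain their
    centre, hence [u <= usce u]. *)
Definition usce u x := inf [set c : R | exists2 d, 0 < d &
  forall y, enorm (y - x) < d -> u y <= c].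

Section envelope.
Variables (u : V -> R) (M : R).
Hypothesis uM : forall x, `|u x| <= M.

Let A x := [set c : R | exists2 d, 0 < d & forall y, enorm (y - x) < d -> u y <= c].

Let AM x : A x M.
Proof. by exists 1 => // y _; have := uM y; rewrite ler_norml => /andP[]. Qed.

Let Alb x c : A x c -> u x <= c.
Proof. by move=> [d d0]; apply; rewrite subrr enorm0. Qed.

Let hinf x : has_inf (A x).
Proof. by split; [exists M; exact: AM|exists (u x) => c; exact: Alb]. Qed.

Lemma le_usce x : u x <= usce u x.
Proof. by apply: lb_le_inf; [exists M; exact: AM|move=> c; exact: Alb]. Qed.

Lemma usce_uscd : uscd (usce u).
Proof.
move=> x e e0; have [c [d d0 hd] ce] := inf_adherent e0 (hinf x).
exists (d / 2); first by rewrite divr_gt0.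
move=> y yx; apply: le_lt_trans ce; apply: inf_lbound; first by case: (hinf y).
exists (d / 2); first by rewrite divr_gt0.
move=> z zy; apply: hd; apply: le_lt_trans (enorm_triangle y _ _) _; lra.
Qed.

Lemma usce_approx x e d : 0 < e -> 0 < d ->
  exists2 y, enorm (y - x) < d & usce u x - e < u y.
Proof.
move=> e0 d0; apply: contrapT => h.
suff : usce u x <= usce u x - e by lra.
apply: inf_lbound; first by case: (hinf x).
exists d => // y yd; rewrite leNgt; apply/negP => hy; apply: h.
by exists y.
Qed.

Lemma usce_le f : uscd f -> (forall x, u x <= f x) -> forall x, usce u x <= f x.
Proof.
move=> uf uf_le x; apply/ler_addgt0Pr => e e0.
have [d d0 hd] := uf x e e0.
apply: inf_lbound; first by case: (hinf x).
by exists d => // y /hd /ltW; apply: le_trans.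
Qed.

Lemma usce_bound x : `|usce u x| <= M.
Proof.
rewrite ler_norml; apply/andP; split.
  by apply: le_trans (le_usce x); have := uM x; rewrite ler_norml => /andP[].
by apply: inf_lbound; [case: (hinf x)|exact: AM].
Qed.

End envelope.

Lemma measurable_fun_borel_continuous f : continuous f ->
  measurable_fun setT (f : borelV R N -> R).
Proof. by move/continuous_uscd/uscd_measurable. Qed.

Lemma measurable_shift x :
  measurable_fun setT ((fun z => x + z) : borelV R N -> borelV R N).
Proof.
apply: (@measurability _ _ (borelV R N) (borelV R N) setT _ (@open 'rV[R]_N) erefl) => _ [B oB <-].
rewrite setTI; apply: measurable_open; apply: open_comp oB => y _.
by apply: (@cvgD _ V V (nbhs y) _ (cst x) id x y); [exact: cvg_cst|exact: cvg_id].
Qed.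

Lemma measurable_comp_shift f x : measurable_fun setT (f : borelV R N -> R) ->
  measurable_fun setT ((fun z => f (x + z)) : borelV R N -> R).
Proof. by move=> mf; apply: (measurableT_comp mf (measurable_shift x)). Qed.

(** The compensated integrand of the nonlocal operator; the slope [p] is a parameter because [f]
    need not be differentiable. *)
Definition incr f x p : V -> R :=
  fun z => f (x + z) - f x - \1_(eball 0 1) z * dotv p z.

Lemma measurable_incr f x p : measurable_fun setT (f : borelV R N -> R) ->
  measurable_fun setT (incr f x p : borelV R N -> R).
Proof.
move=> mf; apply: (@measurable_funB _ (borelV R N) R).
  apply: (@measurable_funB _ (borelV R N) R) => //.
  exact: measurable_comp_shift.
apply: (@measurable_funM _ (borelV R N) R).
  by apply: measurable_indic; exact: measurable_eball0.
by apply: measurable_fun_borel_continuous; exact: continuous_dotv.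
Qed.

Definition w2 : V -> R := fun z => Num.min 1 (enorm z ^+ 2).

Lemma w2_ge0 z : 0 <= w2 z.
Proof. by rewrite le_min ler01 exprn_ge0// enorm_ge0. Qed.

Lemma w2_0 : w2 0 = 0.
Proof. by rewrite /w2 enorm0 expr0n/= min_r. Qed.

Lemma w2_in z : enorm z <= 1 -> w2 z = dotv z z.
Proof. by move=> h; rewrite /w2 enorm_sqr min_r// -enorm_sqr exprn_ile1// enorm_ge0. Qed.

Lemma w2_out z : 1 <= enorm z -> w2 z = 1.
Proof. by move=> h; rewrite /w2 min_l// exprn_ege1. Qed.

Lemma w2_le1 z : w2 z <= 1.
Proof. by rewrite ge_min lexx. Qed.

Lemma w2_le_dotv z : w2 z <= dotv z z.
Proof. by rewrite -enorm_sqr ge_min lexx orbT. Qed.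

Lemma measurable_w2 : measurable_fun setT (w2 : borelV R N -> R).
Proof.
apply: measurable_minr => //.
by apply: measurable_funX; exact: measurable_enorm.
Qed.

Lemma eball0E r z : eball 0 r z = (enorm z < r) :> Prop.
Proof. by rewrite /eball/= subr0. Qed.

Lemma indic_eball r z : \1_(eball 0 r) z = (if enorm z < r then 1 else 0) :> R.
Proof.
rewrite indicE; case: ifPn => h; first by rewrite mem_set// eball0E.
by rewrite memNset// eball0E; exact/negP.
Qed.

Lemma incr_in f x p z : enorm z < 1 -> incr f x p z = f (x + z) - f x - dotv p z.
Proof. by move=> h; rewrite /incr indic_eball h mul1r. Qed.

Lemma incr_out f x p z : 1 <= enorm z -> incr f x p z = f (x + z) - f x.
Proof. by move=> h; rewrite /incr indic_eball ltNge h mul0r subr0. Qed.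

Lemma incr0 f x p : incr f x p 0 = 0.
Proof. by rewrite /incr addr0 subrr dotv0r mulr0 subr0. Qed.

Lemma incrN f x p z : incr (fun y => - f y) x (- p) z = - incr f x p z.
Proof. by rewrite /incr dotvNl; lra. Qed.

(** Inside the unit ball the compensator cancels the linear part of the paraboloid; outside it is
    absent and [f] varies by at most [2 * M]. *)
Lemma incr_le_w2 f x p C M : (forall y, `|f y| <= M) ->
  (forall z, enorm z < 1 -> f (x + z) <= f x + dotv p z + C * dotv z z) ->
  forall z, incr f x p z <= (Num.max C (2 * M)) * w2 z.
Proof.
move=> fM fC z; have [z1|z1] := ltP (enorm z) 1.
  rewrite incr_in// w2_in ?(ltW z1)//.
  apply: (@le_trans _ _ (C * dotv z z)); first by have := fC z z1; lra.
  by rewrite ler_wpM2r ?dotv_ge0// le_max lexx.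
rewrite incr_out// w2_out// mulr1 le_max; apply/orP; right.
have := fM x; have := fM (x + z); rewrite !ler_norml => /andP[_ ?] /andP[? _].
by lra.
Qed.

End semicontinuity.

(** * Consequences of (M1)-(M4) *)

Section transport.
Variables (R : realType) (N : nat).
Local Notation V := 'rV[R]_N.
Implicit Types (nu : V -> levyMeasure R N) (x y z : V) (r s e : R).
Local Open Scope ereal_scope.

Lemma hypM1P nu : hypM1 nu -> exists2 C : R, (0 < C)%R &
  forall x, \int[nu x]_z (w2 z)%:E <= C%:E.
Proof.
move=> [C C0 h]; exists C => // x; apply: le_trans h.
by apply: ereal_sup_ubound; exists x.
Qed.

Lemma hypM2P nu e : hypM2 nu -> (0 < e)%R -> exists2 r, (1 < r)%R &
  forall x, nu x (~` eball 0 r) <= e%:E.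
Proof.
move=> h e0.
have : nbhs (0 : \bar R) [set t | t < e%:E].
  by apply: open_nbhs_nbhs; split; [exact: open_ereal_lt_ereal|rewrite /= lte_fin].
move=> /h [A [_ hA]].
exists (Num.max A 1 + 1)%R; first by rewrite ltr_pwDr// le_max lexx orbT.
have Ar : (A < Num.max A 1 + 1)%R by rewrite ltr_pwDr// le_max lexx.
move=> x; apply: le_trans (ltW (hA _ Ar)).
by apply: ereal_sup_ubound; exists x.
Qed.

Lemma modulusP (w : R -> R) e : modulus w -> (0 < e)%R ->
  exists2 d, (0 < d)%R & forall s, (0 < s < d)%R -> (w s < e)%R.
Proof.
move=> [_ h] e0.
have [d /= d0 hd] := @cvgr_lt _ _ _ (at_right_proper_filter 0) _ 0%R h e e0.
exists d => // s /andP[s0 sd]; apply: hd => //=.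
by rewrite sub0r normrN gtr0_norm.
Qed.

(* With rho = rho^+ - rho^- the Jordan decomposition of nu1 - nu2 on the annulus,
   nu1 + rho^- = nu2 + rho^+ is an identity between measures. *)
Lemma annulus_tv_le (nu1 nu2 : levyMeasure R N) r s (r0 : (0 < r)%R)
    (f : borelV R N -> \bar R) : measurable_fun setT f ->
  (forall z, 0 <= f z <= 1) ->
  \int[nu1]_(z in annulus r s) f z <=
  \int[nu2]_(z in annulus r s) f z + annulus_tv nu1 nu2 s r0.
Proof.
move=> mf f01; rewrite /annulus_tv /charge_tv.
set D : set (borelV R N) := annulus r s.
set rho := mdiff _ _; set h := svalP _.
pose mA : measurable D := @measurable_annulus R N r s.
have f0 z : D z -> 0 <= f z by move=> _; case/andP: (f01 z).
have mfA : measurable_fun D f by exact: measurable_funTS.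
set m1 := mfrestr mA (levy_annulus_lty nu1 s r0).
set m2 := mfrestr mA (levy_annulus_lty nu2 s r0).
have -> : \int[nu1]_(z in D) f z = \int[m1]_(z in D) f z.
  by apply: eq_measure_integral => E mE EA; rewrite /m1 /= /mfrestr /mrestr setIidl.
have -> : \int[nu2]_(z in D) f z = \int[m2]_(z in D) f z.
  by apply: eq_measure_integral => E mE EA; rewrite /m2 /= /mfrestr /mrestr setIidl.
have key : \int[m1]_(z in D) f z
           + \int[jordan_neg h]_(z in D) f z =
    \int[m2]_(z in D) f z + \int[jordan_pos h]_(z in D) f z.
  rewrite -!ge0_integral_measure_add//; apply: eq_measure_integral => E mE EA.
  transitivity (m1 E + jordan_neg h E); first exact: measure_addE.
  transitivity (m2 E + jordan_pos h E); last by apply/esym; exact: measure_addE.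
  have f1 : m1 E \is a fin_num by exact: fin_num_measure.
  have f2 : m2 E \is a fin_num by exact: fin_num_measure.
  have f3 : jordan_pos h E \is a fin_num by exact: fin_num_measure.
  have f4 : jordan_neg h E \is a fin_num by exact: fin_num_measure.
  have : m1 E - m2 E = jordan_pos h E - jordan_neg h E.
    by have := jordan_decomp h mE; rewrite /cadd/= cscaleN1.
  rewrite -(fineK f1) -(fineK f2) -(fineK f3) -(fineK f4).
  by move=> [] e; rewrite -!EFinD; congr EFin; lra.
have le_pos : \int[jordan_pos h]_(z in D) f z <= jordan_pos h D.
  apply: (@le_trans _ _ (\int[jordan_pos h]_(z in D) (cst 1 z))).
    by apply: ge0_le_integral => // z _; case/andP: (f01 z).
  by rewrite integral_cst// mul1e.
apply: (@le_trans _ _ (\int[m1]_(z in D) f z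
           + \int[jordan_neg h]_(z in D) f z)).
  by apply: leeDl; exact: integral_ge0.
rewrite key; apply: leeD => //; apply: le_trans le_pos _.
by rewrite /charge_variation /=; exact: leeDl.
Qed.

Lemma hypM3P nu r s e : hypM3 nu -> (0 < r < s)%R -> (0 < e)%R ->
  exists2 d, (0 < d)%R & forall x y, (enorm (x - y) < d)%R ->
  forall f : borelV R N -> \bar R, measurable_fun setT f ->
  (forall z, 0 <= f z <= 1) ->
  \int[nu x]_(z in annulus r s) f z <= \int[nu y]_(z in annulus r s) f z + e%:E.
Proof.
move=> h /andP[r0 rs] e0; have [w mw hw] := h r s r0 rs.
have [d d0 hd] := modulusP mw e0.
exists d => // x y xyd f mf f01.
(* The modulus is controlled at positive arguments only, so [x = y] is settled apart. *)
have [xy|xy] := eqVneq (enorm (x - y)) 0%R.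
  have -> : x = y by apply/subr0_eq/enorm_eq0.
  by rewrite leeDl// lee_fin ltW.
apply: le_trans (annulus_tv_le _ _ _ r0 mf f01) _; apply: leeD => //.
apply: le_trans (hw x y) _; rewrite lee_fin ltW// hd//.
by rewrite xyd andbT lt_neqAle eq_sym xy enorm_ge0.
Qed.

(** Taking [r] with [w r] below the square root of [e] and squaring turns (M4) into a bound by
    [e * enorm (x - y)], with [r] independent of [x] and [y]. The infimum over couplings need not be
    attained, hence the slack [e']. *)
Lemma hypM4P nu e r1 : hypM4 nu -> (0 < e)%R -> (0 < r1)%R ->
  exists2 r, (0 < r < r1)%R & forall x y e', (0 < e')%R ->
  exists2 g, adm (eball 0 r) (nu x) (nu y) g &
    \int[g]_z (dotv (z.1 - z.2) (z.1 - z.2))%:E <= (e * enorm (x - y) + e')%:E.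
Proof.
move=> [r0 [w [h0 o0 oo ow]]] e0 r10; have /andP[r00 _] := h0.
have se0 : (0 < Num.sqrt e)%R by rewrite sqrtr_gt0.
have [d /= d0 hd] := @cvgr_lt _ _ _ (at_right_proper_filter 0) _ 0%R oo _ se0.
pose r : R := (Num.min (Num.min r0 r1) d / 2)%R.
have [m1 m2 m3] : [/\ r < r0, r < r1 & r < d]%R.
  have : (Num.min (Num.min r0 r1) d <= r0)%R by rewrite !ge_min lexx.
  have : (Num.min (Num.min r0 r1) d <= r1)%R by rewrite !ge_min lexx orbT.
  have : (Num.min (Num.min r0 r1) d <= d)%R by rewrite !ge_min lexx orbT.
  by rewrite /r; split; lra.
have rpos : (0 < r)%R by rewrite divr_gt0// !lt_min r00 r10.
exists r; first by rewrite rpos.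
have or_lt : (w r < Num.sqrt e)%R.
  by apply: hd => //=; rewrite sub0r normrN gtr0_norm.
move=> x y e' e'0.
have /ow : (0 < r < r0)%R by rewrite rpos.
move=> /(_ x y); rewrite /wasserstein.
set S := [set _ | _ in _]; move=> hw.
have S0 : 0 <= ereal_inf S.
  by apply: le_ereal_inf_tmp => _ [g _ <-]; apply: integral_ge0 => z _; rewrite lee_fin powR_ge0.
have ub : ereal_inf S <= (e * enorm (x - y))%:E.
  move: hw; rewrite poweR12_sqrt//; case: (ereal_inf S) S0 => [a| |]//=.
    rewrite !lee_fin => a0 h.
    rewrite -(sqr_sqrtr a0); apply: (@le_trans _ _ ((w r * Num.sqrt (enorm (x - y))) ^+ 2)%R).
      by rewrite lerXn2r// nnegrE ?sqrtr_ge0// mulr_ge0 ?sqrtr_ge0// o0// rpos.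
    rewrite exprMn sqr_sqrtr ?enorm_ge0// ler_wpM2r ?enorm_ge0//.
    rewrite -[leRHS]sqr_sqrtr ?(ltW e0)// lerXn2r ?nnegrE ?sqrtr_ge0 ?(ltW or_lt)//.
    by rewrite o0// rpos.
have /ereal_inf_lt[_ [g ag <-] hg] : ereal_inf S < (e * enorm (x - y) + e')%:E.
  by apply: le_lt_trans ub _; rewrite lte_fin ltrDl.
exists g => //; apply: le_trans (ltW hg).
rewrite le_eqVlt; apply/orP; left; apply/eqP; apply: eq_integral => z _.
by congr EFin; rewrite powR_mulrn ?enorm_ge0// enorm_sqr.
Qed.

Lemma measurable_fst_comp (f : borelV R N -> R) : measurable_fun setT f ->
  measurable_fun setT (fun z : borelV R N * borelV R N => f z.1).
Proof. by move=> mf; apply: (measurableT_comp mf measurable_fst). Qed.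

Lemma measurable_snd_comp (f : borelV R N -> R) : measurable_fun setT f ->
  measurable_fun setT (fun z : borelV R N * borelV R N => f z.2).
Proof. by move=> mf; apply: (measurableT_comp mf measurable_snd). Qed.

Lemma measurable_dotvB : measurable_fun setT
  (fun z : borelV R N * borelV R N => dotv (z.1 - z.2) (z.1 - z.2) : R).
Proof.
apply: measurable_sum => i.
have mi : measurable_fun setT (fun z : borelV R N => (z : V) 0%R i).
  by apply: measurable_fun_borel_continuous; exact: coord_continuous.
have mB : measurable_fun setT
    (fun z : borelV R N * borelV R N => ((z.1 - z.2)%R : V) 0%R i).
  apply: (eq_measurable_fun (fun z : borelV R N * borelV R N => (z.1 : V) 0%R i - (z.2 : V) 0%R i)%R).
    by move=> z _; rewrite !mxE.
  by apply: measurable_funB; [exact: (measurable_fst_comp mi)|exact: (measurable_snd_comp mi)].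
exact: measurable_funM.
Qed.

(** Serves both projections. The marginals of a coupling are prescribed only off the origin and may
    put any mass on it; [f 0 = 0] hides this mass from the integral. *)
Lemma adm_proj (nu : levyMeasure R N) (A : set (borelV R N))
    (g : {measure set (borelV R N * borelV R N) -> \bar R})
    (pi : borelV R N * borelV R N -> borelV R N) (f : borelV R N -> \bar R) :
  measurable_fun setT pi -> (forall u, ~ A (pi u) -> ~ (A `*` A) u) ->
  measurable A -> g (~` (A `*` A)) = 0 ->
  (forall E, measurable E -> E `<=` A `\ 0%R -> pushforward g pi E = nu E) ->
  measurable_fun setT f -> (forall z, 0 <= f z) -> f 0%R = 0 ->
  \int[g]_z f (pi z) = \int[nu]_(z in A) f z.
Proof.
move=> mpi piA mA gA g1 mf f0 f00.
have m0 : measurable ([set 0%R] : set (borelV R N)).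
  rewrite -[X in measurable X]setCK; apply: measurableC.
  apply: measurable_open; apply: closed_openC.
  exact: accessible_closed_set1 (hausdorff_accessible (@norm_hausdorff _ _)) _.
have mA0 : measurable (A `\ 0%R) by exact: measurableD.
(* A domain may be shrunk when the part removed is null up to the origin, where [f] vanishes. *)
have drop (mu : {measure set (borelV R N) -> \bar R}) (B C : set (borelV R N)) :
    measurable B -> measurable C -> C `<=` B -> mu (B `\` C `\ 0%R) = 0 ->
    \int[mu]_(z in B) f z = \int[mu]_(z in C) f z.
  move=> mB mC CB muB.
  rewrite -[in LHS](setDUK CB) ge0_integral_setU//; last 3 first.
  - exact: measurableD.
  - exact: measurable_funTS.
  - by apply/disj_setPS => z [Cz [_ /(_ Cz)]].
  rewrite [X in _ + X](_ : _ = 0) ?adde0//.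
  have -> : \int[mu]_(z in B `\` C) f z =
      \int[mu]_(z in B `\` C `\ 0%R) f z + \int[mu]_(z in (B `\` C) `&` [set 0%R]) f z.
    rewrite -ge0_integral_setU//; last 4 first.
    - by apply: measurableD => //; exact: measurableD.
    - by apply: measurableI => //; exact: measurableD.
    - exact: measurable_funTS.
    - by apply/disj_setPS => z [[_ z0] [_ /z0]].
    by rewrite setUC setUIDK.
  rewrite [X in _ + X](_ : _ = 0) ?adde0; last first.
    rewrite integral0_eq// => z [_ /= ->]; exact: f00.
  rewrite (ge0_negligible_integral (N := B `\` C `\ 0%R))//.
  - by rewrite setDv integral_set0.
  - by apply: measurableD => //; exact: measurableD.
  - by apply: measurableD => //; exact: measurableD.
  - exact: measurable_funTS.
have -> : \int[nu]_(z in A) f z = \int[nu]_(z in A `\ 0%R) f z.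
  apply: drop => //.
  rewrite [X in nu X](_ : _ = set0) ?measure0//.
  by apply/seteqP; split => // z [[Az nz] z0]; apply: nz.
pose p1 : {measure set (borelV R N) -> \bar R} := pushforward g pi.
have -> : \int[nu]_(z in A `\ 0%R) f z = \int[p1 mpi]_(z in A `\ 0%R) f z.
  by apply: eq_measure_integral => E mE EA; rewrite -g1.
rewrite -(drop (p1 mpi) setT) //.
  apply/esym; exact: (@ge0_integral_pushforward _ _ _ _ R pi mpi g setT f).
rewrite /p1 /pushforward; apply: (@subset_measure0 _ _ _ g _ (~` (A `*` A))) => //.
- rewrite -[X in measurable X]setTI; apply: mpi => //.
    by apply: measurableD => //; exact: measurableD.
- by apply: measurableC; exact: measurableX.
- by move=> z [[_ nz] z0]; apply: piA => Az; exact: nz (conj Az z0).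
Qed.

Lemma adm_fst (nu1 nu2 : levyMeasure R N) (A : set (borelV R N)) g (f : borelV R N -> \bar R) :
  measurable A -> adm A nu1 nu2 g -> measurable_fun setT f -> (forall z, 0 <= f z) ->
  f 0%R = 0 -> \int[g]_z f z.1 = \int[nu1]_(z in A) f z.
Proof.
move=> mA [gA _ g1 _]; apply: (adm_proj (pi := fst)) => //.
by move=> z nz [].
Qed.

Lemma adm_snd (nu1 nu2 : levyMeasure R N) (A : set (borelV R N)) g (f : borelV R N -> \bar R) :
  measurable A -> adm A nu1 nu2 g -> measurable_fun setT f -> (forall z, 0 <= f z) ->
  f 0%R = 0 -> \int[g]_z f z.2 = \int[nu2]_(z in A) f z.
Proof.
move=> mA [gA _ _ g2]; apply: (adm_proj (pi := snd)) => //.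
by move=> z nz [].
Qed.

End transport.

(** * Fatou's lemma along a family of Levy measures *)

Lemma limn_einfE (R : realType) (u : (\bar R)^nat) :
  limn_einf u = ereal_sup (range (einfs u)).
Proof. by rewrite limn_einf_lim; apply/cvg_lim => //; exact: cvg_einfs_sup. Qed.

Lemma limn_einf_le (R : realType) (u : (\bar R)^nat) (b : \bar R) n0 :
  (forall n, (n0 <= n)%N -> u n <= b)%E -> (limn_einf u <= b)%E.
Proof.
move=> h; rewrite limn_einfE; apply: ge_ereal_sup => _ [n _ <-].
apply: le_trans (h (maxn n n0) (leq_maxr _ _)).
by apply: ereal_inf_lbound; exists (maxn n n0) => //=; exact: leq_maxl.
Qed.

Lemma limn_einf_ge (R : realType) (u : (\bar R)^nat) (b : \bar R) n0 :
  (forall n, (n0 <= n)%N -> b <= u n)%E -> (b <= limn_einf u)%E.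
Proof.
move=> h; rewrite limn_einfE; apply: ereal_sup_ge.
exists (einfs u n0); first by exists n0.
by apply: le_ereal_inf_tmp => _ [n /= nn0 <-]; exact: h.
Qed.

Section fatou_levy.
Variables (R : realType) (N : nat).
Local Notation V := 'rV[R]_N.
Local Notation T := (borelV R N).
Implicit Types (nu : V -> levyMeasure R N) (m : levyMeasure R N).
Implicit Types (x y z : V) (r s e : R) (f g : V -> R).
Local Open Scope ereal_scope.

Lemma measurableEFinS (f : T -> R) (D : set T) : measurable_fun setT f ->
  measurable_fun D (fun z => (f z)%:E).
Proof. by move=> mf; apply/measurable_EFinP; exact: measurable_funTS. Qed.

Lemma measurable_set0 : measurable ([set 0%R] : set T).
Proof.
rewrite -[X in measurable X]setCK; apply: measurableC.
apply: measurable_open; apply: closed_openC.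
exact: accessible_closed_set1 (hausdorff_accessible (@norm_hausdorff _ _)) _.
Qed.

Lemma measurable_eball0T r : measurable (eball 0 r : set T).
Proof. exact: measurable_eball0. Qed.

Lemma measurable_eball0C r : measurable (~` eball 0 r : set T).
Proof. by apply: measurableC; exact: measurable_eball0. Qed.

Lemma annulusE r s z : annulus r s z <-> (r <= enorm z < s)%R.
Proof.
rewrite /annulus /= !eball0E; split=> [[zs zr]|/andP[rz zs]].
  by rewrite zs andbT leNgt; exact/negP.
by split => //; apply/negP; rewrite -leNgt.
Qed.

Lemma ge0_integral_split m r s (f : T -> \bar R) : (r <= s)%R ->
  measurable_fun setT f -> (forall z, 0 <= f z) ->
  \int[m]_z f z = \int[m]_(z in eball 0 r) f z +
    \int[m]_(z in annulus r s) f z + \int[m]_(z in ~` eball 0 s) f z.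
Proof.
move=> rs mf f0.
have mA := @measurable_annulus R N r s.
have mr := measurable_eball0T r.
have ms := measurable_eball0T s.
have sub : (eball 0 r : set T) `<=` eball 0 s.
  by move=> z; rewrite !eball0E => /lt_le_trans; exact.
have -> : \int[m]_(z in eball 0 r) f z + \int[m]_(z in annulus r s) f z =
   \int[m]_(z in eball 0 s) f z.
  rewrite -(ge0_integral_setU m mr mA) //.
  - by congr (integral _ _ _); rewrite /annulus setDUK.
  - exact: measurable_funTS.
  - by apply/disj_setPS => z [zr [_ /(_ zr)]].
rewrite -(ge0_integral_setU m ms (measurable_eball0C s)) ?setUv//.
by apply/disj_setPS => z [zs /(_ zs)].
Qed.

(** Monotone convergence along the annuli of radii 1/(n+2) and n+2, which exhaust the complement of
    the origin, the origin itself being a null set. *)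
Lemma annulus_exhaust m (f : T -> \bar R) b :
  measurable_fun setT f -> (forall z, 0 <= f z) ->
  (forall r s, (0 < r < 1)%R -> (1 < s)%R -> \int[m]_(z in annulus r s) f z <= b) ->
  \int[m]_z f z <= b.
Proof.
move=> mf f0 h.
pose F (n : nat) : set T := annulus n.+2%:R^-1 n.+2%:R.
have mF n : measurable (F n) by exact: measurable_annulus.
have ndF : nondecreasing_seq F.
  apply/nondecreasing_seqP => n; rewrite subsetEset => z /annulusE/andP[a c].
  apply/annulusE/andP; split.
    by apply: le_trans a; rewrite lef_pV2 ?posrE ?ltr0n// ler_nat.
  by apply: lt_le_trans c _; rewrite ler_nat.
have UF : \bigcup_n F n = ~` [set 0%R].
  apply/seteqP; split => z /=.
    move=> [n _ /annulusE/andP[a _]] z0; move: a.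
    by rewrite z0 enorm0 leNgt invr_gt0 ltr0n.
  move=> z0; have zp : (0 < enorm z)%R.
    by rewrite lt_neqAle enorm_ge0 andbT eq_sym; apply/eqP => /enorm_eq0.
  pose n1 := Num.truncn (enorm z); pose n2 := Num.truncn (enorm z)^-1.
  have h1 : (enorm z < n1.+1%:R)%R by exact: truncnS_gt.
  have h2 : ((enorm z)^-1 < n2.+1%:R)%R by exact: truncnS_gt.
  exists (maxn n1 n2) => //; apply/annulusE/andP; split.
    rewrite -[leRHS]invrK lef_pV2 ?posrE ?invr_gt0 ?ltr0n//.
    by apply: le_trans (ltW h2) _; rewrite ler_nat ltnS leqW// leq_maxr.
  by apply: lt_le_trans h1 _; rewrite ler_nat ltnS leqW// leq_maxl.
have m0 := measurable_set0.
have -> : \int[m]_z f z = \int[m]_(z in ~` [set 0%R]) f z.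
  by rewrite (ge0_negligible_integral (N := ([set 0%R] : set T)))// ?setTD//; exact: levy_at0.
rewrite -UF.
have /cvg_lim <- // := ge0_nondecreasing_set_cvg_integral (mu := m) ndF mF
   (fun i => measurable_funTS mf) (fun i x _ => f0 x).
apply: lime_le.
  apply: ereal_nondecreasing_is_cvgn.
  by apply: ge0_nondecreasing_set_nondecreasing_integral => // i; exact: measurable_funTS.
apply: nearW => n; apply: h.
  by rewrite invr_gt0 ltr0n/= invf_lt1 ?ltr0n// ltr1n.
by rewrite ltr1n.
Qed.

Lemma levy_w2_fin m : \int[m]_z (w2 z)%:E \is a fin_num.
Proof.
rewrite ge0_fin_numE; last by apply: integral_ge0 => z _; rewrite lee_fin w2_ge0.
rewrite (ge0_negligible_integral (N := ([set 0%R] : set T)))//.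
- by rewrite setTD; exact: levy_int.
- exact: measurable_set0.
- exact: (@measurableEFinS _ setT (@measurable_w2 R N)).
- by move=> z _; rewrite lee_fin w2_ge0.
- exact: levy_at0.
Qed.

(** If all small balls carried mass above [e], every annulus would carry at most the total minus
    [e], and exhaustion would bound the finite total by itself minus [e]. *)
Lemma w2_small_ball m e : (0 < e)%R ->
  exists2 r, (0 < r < 1)%R & \int[m]_(z in eball 0 r) (w2 z)%:E <= e%:E.
Proof.
move=> e0; apply: contrapT => hn.
have mw := @measurableEFinS _ setT (@measurable_w2 R N).
have w0 z : 0 <= (w2 z)%:E :> \bar R by rewrite lee_fin w2_ge0.
suff : \int[m]_z (w2 z)%:E <= \int[m]_z (w2 z)%:E - e%:E.
  have := levy_w2_fin m; case: (\int[m]_z _) => // a _.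
  by rewrite -EFinB lee_fin; lra.
apply: annulus_exhaust => // r s r01 s1.
have rs : (r <= s)%R by move: r01 => /andP[_]; lra.
rewrite leeBrDr// (ge0_integral_split _ rs mw w0) [X in X <= _]addeC.
apply: le_trans (leeDl _ (integral_ge0 _ _)) => //.
apply: leeD => //; rewrite leNgt; apply/negP => /ltW he; apply: hn.
by exists r.
Qed.

Lemma w2_transport z1 z2 : (w2 z1 <= 2 * w2 z2 + 2 * dotv (z1 - z2) (z1 - z2))%R.
Proof.
have d0 := dotv_ge0 (z1 - z2).
have [h|h] := leP 1%R (enorm z2).
  by rewrite (w2_out h); have := w2_le1 z1; lra.
rewrite (w2_in (ltW h)); apply: le_trans (w2_le_dotv _) _.
(* Expanding the square of z1 - 2 z2 gives |z1|^2 <= 2 |z2|^2 + 2 |z1 - z2|^2. *)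
have := dotv_ge0 (z1 - z2 *+ 2); rewrite mulr2n !dotvE (dotvC z2 z1); lra.
Qed.

Lemma hypM3_scale nu r s e : hypM3 nu -> (0 < r < s)%R -> (0 < e)%R ->
  exists2 d, (0 < d)%R & forall x y, (enorm (x - y) < d)%R ->
  forall K (f : T -> R), (0 < K)%R -> measurable_fun setT f ->
  (forall z, 0 <= f z <= K)%R ->
  \int[nu x]_(z in annulus r s) (f z)%:E <=
  \int[nu y]_(z in annulus r s) (f z)%:E + (K * e)%:E.
Proof.
move=> h3 rs e0.
have [d d0 hd] := hypM3P h3 rs e0.
exists d => // x y xy K f K0 mf fK.
have mA := @measurable_annulus R N r s.
have mKf : measurable_fun setT (fun z : T => (K^-1 * f z)%R).
  by apply: measurable_funM.
have Kf (mu : {measure set T -> \bar R}) : \int[mu]_(z in annulus r s) (f z)%:E =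
    K%:E * \int[mu]_(z in annulus r s) (K^-1 * f z)%:E.
  rewrite -ge0_integralZl//.
  - apply: eq_integral => z _; rewrite -EFinM mulrA divff ?mul1r//.
    by rewrite gt_eqF.
  - exact: measurableEFinS.
  - move=> z _; rewrite lee_fin mulr_ge0 ?invr_ge0 ?(ltW K0)//.
    by case/andP: (fK z).
  - by rewrite lee_fin ltW.
rewrite !Kf EFinM -ge0_muleDr; last 2 first.
- apply: integral_ge0 => z _; rewrite lee_fin mulr_ge0 ?invr_ge0 ?(ltW K0)//.
  by case/andP: (fK z).
- by rewrite lee_fin ltW.
apply: lee_wpmul2l; first by rewrite lee_fin ltW.
apply: hd => //; first exact: measurableEFinS.
move=> z; rewrite !lee_fin; have /andP[a b] := fK z; apply/andP; split.
  by rewrite mulr_ge0 ?invr_ge0 ?(ltW K0).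
by rewrite mulrC ler_pdivrMr// mul1r.
Qed.

(** A coupling with [nu x0] controls the small ball, (M3) the annulus, and (M2) the tail, where
    [w2 <= 1]. *)
Lemma w2_usc nu x0 e : hypM2 nu -> hypM3 nu -> hypM4 nu -> (0 < e)%R ->
  exists2 d, (0 < d)%R & forall x, (enorm (x - x0) < d)%R ->
    \int[nu x]_z (w2 z)%:E <= \int[nu x0]_z (w2 z)%:E + e%:E.
Proof.
move=> h2 h3 h4 e0.
have mw := @measurableEFinS _ setT (@measurable_w2 R N).
have w0 z : 0 <= (w2 z)%:E :> \bar R by rewrite lee_fin w2_ge0.
have e8 : (0 < e / 8)%R by rewrite divr_gt0.
have e16 : (0 < e / 16)%R by rewrite divr_gt0.
have e4 : (0 < e / 4)%R by rewrite divr_gt0.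
(* The ball is first shrunk until [nu x0] has little mass there; the coupling radius is then taken
   below [r1]. *)
have [r1 /andP[r10 r11] hr1] := w2_small_ball (nu x0) e8.
have [r /andP[r0 rr1] hr] := hypM4P h4 (@ltr01 R) r10.
have [s s1 hs] := hypM2P h2 e4.
have rs : (0 < r < s)%R by rewrite r0 /=; lra.
have [d d0 hd] := hypM3_scale h3 rs e4.
exists (Num.min d (e / 16))%R; first by rewrite lt_min d0.
move=> x; rewrite lt_min => /andP[xd xe].
have rs' : (r <= s)%R by case/andP: rs => _ /ltW.
rewrite (ge0_integral_split _ rs' mw w0) (ge0_integral_split (nu x0) rs' mw w0).
have p1 : \int[nu x]_(z in eball 0 r) (w2 z)%:E <= (e / 2)%:E.
  have [g ag hg] := hr x x0 _ e16.
  rewrite -(adm_fst (measurable_eball0T r) ag mw w0) ?w2_0//.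
  apply: (@le_trans _ _ (\int[g]_z
      ((2 * w2 z.2)%:E + (2 * dotv (z.1 - z.2) (z.1 - z.2))%:E))).
    apply: ge0_le_integral => //.
    - apply: (measurableT_comp mw measurable_fst).
    - apply: emeasurable_funD; apply/measurable_EFinP; apply: measurable_funM => //.
        exact: (measurable_snd_comp (@measurable_w2 R N)).
      exact: measurable_dotvB.
    - by move=> z _; rewrite -EFinD lee_fin w2_transport.
  rewrite ge0_integralD//; last 4 first.
  - by move=> z _; rewrite lee_fin mulr_ge0// w2_ge0.
  - apply/measurable_EFinP; apply: measurable_funM => //.
    exact: (measurable_snd_comp (@measurable_w2 R N)).
  - by move=> z _; rewrite lee_fin mulr_ge0// dotv_ge0.
  - by apply/measurable_EFinP; apply: measurable_funM => //; exact: measurable_dotvB.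
  have -> : \int[g]_z (2 * w2 z.2)%:E = 2%:E * \int[nu x0]_(z in eball 0 r) (w2 z)%:E.
    rewrite -(adm_snd (measurable_eball0T r) ag mw w0) ?w2_0//.
    rewrite -ge0_integralZl//.
    apply: (measurableT_comp mw measurable_snd).
  have -> : \int[g]_z (2 * dotv (z.1 - z.2) (z.1 - z.2))%:E =
      2%:E * \int[g]_z (dotv (z.1 - z.2) (z.1 - z.2))%:E.
    rewrite -ge0_integralZl//; first by apply/measurable_EFinP; exact: measurable_dotvB.
    by move=> z _; rewrite lee_fin dotv_ge0.
  apply: (@le_trans _ _ (2%:E * (e / 8)%:E + 2%:E * (1 * enorm (x - x0) + e / 16)%:E)).
    apply: leeD; apply: lee_wpmul2l => //.
    apply: le_trans hr1; apply: ge0_subset_integral => //.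
    - exact: measurable_eball0T.
    - exact: measurable_eball0T.
    - exact: measurable_funTS.
    - by move=> z; rewrite !eball0E => /lt_trans; exact.
  by rewrite -!EFinM -EFinD lee_fin; lra.
have p2 : \int[nu x]_(z in annulus r s) (w2 z)%:E <=
   \int[nu x0]_(z in annulus r s) (w2 z)%:E + (e / 4)%:E.
  rewrite -[X in (X / 4)%R]mul1r -[(_ / 4)%R]mulrA.
  apply: hd => //; first exact: measurable_w2.
  by move=> z; rewrite w2_ge0 w2_le1.
have p3 : \int[nu x]_(z in ~` eball 0 s) (w2 z)%:E <= (e / 4)%:E.
  apply: le_trans (hs x).
  apply: (@le_trans _ _ (\int[nu x]_(z in ~` eball 0 s) (cst 1 z))).
    apply: ge0_le_integral => //.
    - exact: measurable_eball0C.
    - exact: measurable_funTS.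
    - by move=> z _; rewrite lee_fin w2_le1.
  by rewrite integral_cst ?mul1e//; exact: measurable_eball0C.
apply: le_trans (leeD (leeD p1 p2) p3) _.
have -> : e%:E = (e / 2)%:E + (e / 4)%:E + (e / 4)%:E.
  by rewrite -!EFinD; congr EFin; lra.
set A := \int[nu x0]_(z in eball 0 r) _; set B := \int[nu x0]_(z in annulus r s) _.
set C := \int[nu x0]_(z in ~` _) _.
have A0 : 0 <= A by exact: integral_ge0.
have C0 : 0 <= C by exact: integral_ge0.
have B0 : 0 <= B by exact: integral_ge0.
move: A0 B0 C0; case: A => [a| |]//; case: B => [b| |]//; case: C => [c| |]// a0 b0 c0;
  rewrite -?EFinD ?leey// lee_fin; move: a0 b0 c0; rewrite !lee_fin; lra.
Qed.

(** Since [f <= K * w2], the integral of [f] is below +oo but may be -oo. A lower bound on it is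
    traded for an upper bound on the integral of a nonnegative function, to which monotone
    convergence and Fatou's lemma apply. *)
Lemma integral_le_w2 m f K a : measurable_fun setT (f : T -> R) ->
  (0 <= K)%R -> (forall z, f z <= K * w2 z)%R ->
  (a%:E <= \int[m]_z (f z)%:E) <->
  (\int[m]_z (K * w2 z - f z)%:E <= K%:E * \int[m]_z (w2 z)%:E - a%:E).
Proof.
move=> mf K0 fK.
have mw := @measurable_w2 R N.
have mE : measurable_fun setT (fun z : T => (f z)%:E) by exact: measurableEFinS.
(* Integrated form of f^+ + (K w2 - f) = K w2 + f^-, in which all four terms are nonnegative. *)
have key : \int[m]_z ((fun z => (f z)%:E)^\+ z) + \int[m]_z (K * w2 z - f z)%:E =
  K%:E * \int[m]_z (w2 z)%:E + \int[m]_z ((fun z => (f z)%:E)^\- z).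
  rewrite -ge0_integralZl//; last 2 first.
  - exact: measurableEFinS.
  - by move=> z _; rewrite lee_fin w2_ge0.
  rewrite -ge0_integralD//; last 3 first.
  - exact: measurable_funepos.
  - by move=> z _; rewrite lee_fin subr_ge0.
  - by apply: measurableEFinS; apply: measurable_funB => //; exact: measurable_funM.
  rewrite -ge0_integralD//; last 3 first.
  - by move=> z _; rewrite mule_ge0 ?lee_fin// w2_ge0.
  - by apply: measurable_funeM; exact: measurableEFinS.
  - exact: measurable_funeneg.
  apply: eq_integral => z _; rewrite funeposE funenegE -EFinM -EFinN -!EFin_max -!EFinD.
  congr EFin; rewrite !maxEle; case: ifPn; case: ifPn; rewrite -?ltNge; lra.
have pos : \int[m]_z ((fun z => (f z)%:E)^\+ z) <= K%:E * \int[m]_z (w2 z)%:E.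
  rewrite -ge0_integralZl//; last 2 first.
  - exact: measurableEFinS.
  - by move=> z _; rewrite lee_fin w2_ge0.
  apply: ge0_le_integral => //.
  - exact: measurable_funepos.
  - by apply: measurable_funeM; exact: measurableEFinS.
  - move=> z _; rewrite funeposE -EFinM -EFin_max lee_fin ge_max fK/=.
    by rewrite mulr_ge0// w2_ge0.
have p0 : 0 <= \int[m]_z ((fun z => (f z)%:E)^\+ z) by exact: integral_ge0.
have n0 : 0 <= \int[m]_z ((fun z => (f z)%:E)^\- z) by exact: integral_ge0.
have g0 : 0 <= \int[m]_z (K * w2 z - f z)%:E.
  by apply: integral_ge0 => z _; rewrite lee_fin subr_ge0.
rewrite [X in a%:E <= X]integralE.
move: pos key p0 n0 g0; have := levy_w2_fin m.
case: (\int[m]_z (w2 z)%:E) => // I _.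
case: (\int[m]_z ((fun z => (f z)%:E)^\+ z)) => [p| |]; rewrite -?EFinM//.
rewrite lee_fin => pI.
case: (\int[m]_z ((fun z => (f z)%:E)^\- z)) => [n| |]//;
  case: (\int[m]_z (K * w2 z - f z)%:E) => [g| |]//.
by rewrite -!EFinD => -[] e _ _ _; rewrite !lee_fin; split; lra.
Qed.

(** Fatou's lemma is applied to the nonnegative functions [K * w2 z - fn n z] on a fixed annulus and
    for the fixed measure [nu x0]. The bound [B] makes the passage from [nu x0] to [nu (X n)]
    uniform, and [w2_usc] controls the added term [K * w2]. *)
Lemma fatou_levy nu x0 (X : nat -> V) (f : V -> R) (fn : nat -> V -> R) K B
    (an : nat -> R) a :
  hypM2 nu -> hypM3 nu -> hypM4 nu -> (0 <= K)%R ->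
  (forall d, (0 < d)%R -> exists n0, forall n, (n0 <= n)%N -> (enorm (X n - x0) < d)%R) ->
  measurable_fun setT (f : T -> R) ->
  (forall n, measurable_fun setT (fn n : T -> R)) ->
  (forall n z, fn n z <= K * w2 z)%R -> (forall n z, `|fn n z| <= B)%R ->
  (forall z e, (0 < e)%R -> exists n0, forall n, (n0 <= n)%N -> (fn n z <= f z + e)%R) ->
  (forall z, f z <= K * w2 z)%R ->
  (forall n, (an n)%:E <= \int[nu (X n)]_z (fn n z)%:E) ->
  (forall e, (0 < e)%R -> exists n0, forall n, (n0 <= n)%N -> (a - e <= an n)%R) ->
  a%:E <= \int[nu x0]_z (f z)%:E.
Proof.
move=> h2 h3 h4 K0 hX mf mfn fnK fnB limf fK han ha.
apply/(integral_le_w2 (nu x0) a mf K0 fK).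
have mw := @measurable_w2 R N.
have mg (h : T -> R) : measurable_fun setT h -> measurable_fun setT (fun z : T => (K * w2 z - h z)%R).
  by move=> mh; apply: measurable_funB => //; exact: measurable_funM.
apply: annulus_exhaust.
- by apply: measurableEFinS; exact: mg.
- by move=> z; rewrite lee_fin subr_ge0.
move=> r s /andP[r0 r1] s1; have rs : (0 < r < s)%R by rewrite r0/=; lra.
have B0 : (0 <= B)%R := le_trans (normr_ge0 _) (fnB 0%N 0%R).
have Ifin := levy_w2_fin (nu x0).
apply/lee_addgt0Pr => e e0.
have e4 : (0 < e / 4)%R by rewrite divr_gt0.
have KB : (0 < K + B + 1)%R by lra.
(* The integrands lie between 0 and [K + B + 1], so this tolerance costs [e / 4] in the exchange of
   measures. *)
have [d d0 hd] := hypM3_scale h3 rs (divr_gt0 e4 KB).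
have eK : (0 < e / 4 / (K + 1))%R by rewrite divr_gt0//; lra.
have [d' d'0 hd'] := w2_usc x0 h2 h3 h4 eK.
have [n1 hn1] := hX _ d0.
have [n2 hn2] := hX _ d'0.
have [n3 hn3] := ha _ e4.
have mA := @measurable_annulus R N r s.
apply: (@le_trans _ _ (\int[nu x0]_(z in annulus r s)
   limn_einf (fun n => (K * w2 z - fn n z)%:E))).
  apply: ge0_le_integral => //.
  - by move=> z _; rewrite lee_fin subr_ge0.
  - by apply: measurableEFinS; exact: mg.
  - apply: measurableT_comp => //; apply: measurable_fun_limn_esup => n.
    by apply: measurableT_comp => //; apply: measurableEFinS; exact: mg.
  move=> z _; apply/lee_addgt0Pr => e' e'0.
  rewrite -leeBlDr//; have [n0 hn0] := limf z e' e'0.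
  apply: (@limn_einf_ge _ _ _ n0) => n nn0; rewrite -EFinB lee_fin.
  by have := hn0 n nn0; lra.
apply: (@le_trans _ _ (limn_einf (fun n => \int[nu x0]_(z in annulus r s)
   (K * w2 z - fn n z)%:E))).
  apply: fatou => //.
  - by move=> n; apply: measurableEFinS; exact: mg.
  - by move=> n z _; rewrite lee_fin subr_ge0.
apply: (@limn_einf_le _ _ _ (maxn n1 (maxn n2 n3))) => n.
rewrite !geq_max => /andP[/hn1 l1 /andP[/hn2 l2 /hn3 l3]].
(* Now [n] is fixed: [nu x0] gives way to [nu (X n)] on the annulus, then the integral is enlarged
   to the whole space, where the hypothesis on [an n] applies. *)
apply: le_trans (hd x0 (X n) _ _ _ KB (mg _ (mfn n)) _) _.
- by rewrite enormB.
- move=> z; rewrite subr_ge0 fnK/=; have := fnB n z; rewrite ler_norml => /andP[lb _].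
  have : (K * w2 z <= K * 1)%R by rewrite ler_wpM2l// w2_le1.
  by lra.
rewrite mulrC divfK ?lt0r_neq0//.
apply: (@le_trans _ _ (\int[nu (X n)]_z (K * w2 z - fn n z)%:E + (e / 4)%:E)).
  apply: leeD => //; apply: ge0_subset_integral => //.
  - by apply: measurableEFinS; exact: mg.
  - by move=> z _; rewrite lee_fin subr_ge0.
have := (integral_le_w2 (nu (X n)) (an n) (mfn n) K0 (fnK n)).1 (han n).
move=> /(leeD (lexx (e / 4)%:E)); rewrite addeC => /le_trans; apply.
have := hd' _ l2; have := levy_w2_fin (nu (X n)).
case: (\int[nu x0]_z (w2 z)%:E) Ifin => // I0 _.
case: (\int[nu (X n)]_z (w2 z)%:E) => // In _.
rewrite -!EFinM -!EFinD !lee_fin => hI.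
have : (K * In <= K * I0 + e / 4)%R.
  apply: (@le_trans _ _ (K * (I0 + e / 4 / (K + 1))))%R; first by rewrite ler_wpM2l.
  rewrite mulrDr lerD2l mulrA ler_pdivrMr; last by lra.
  by nra.
by lra.
Qed.

End fatou_levy.

(** * Perron's method *)

Section perron.
Variables (R : realType) (N : nat).
Local Notation V := 'rV[R]_N.
Local Notation T := (borelV R N).
Variables (lambda : R) (nu : V -> levyMeasure R N).
Implicit Types (G H : V -> V -> R) (u v w g W : V -> R) (x y z p q : V) (C K M : R).

Definition touched u x p C :=
  forall z, u (x + z) <= u x + dotv p z + C * dotv z z.

Definition esub H u := forall x p C, 0 <= C -> touched u x p C ->
  ((lambda * u x + H x p)%:E <= \int[nu x]_z (incr u x p z)%:E)%E.

(* If v solves the equation for H then - v solves it for Hneg H. *)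
Definition Hneg H x p := - H x (- p).

Definition esuper H v := esub (Hneg H) (fun x => - v x).

Definition Hcont H := forall x p e, 0 < e -> exists2 d, 0 < d &
  forall y q, enorm (y - x) < d -> enorm (q - p) < d -> `|H y q - H x p| <= e.

Lemma Hcont_neg H : Hcont H -> Hcont (Hneg H).
Proof.
move=> h x p e e0; have [d d0 hd] := h x (- p) e e0.
exists d => // y q yx qp; rewrite /Hneg opprK addrC distrC.
rewrite -normrN opprB distrC hd//.
by rewrite -enormN opprB opprK addrC.
Qed.

(** Tested on a short multiple [t *: p], the linear side is of order t and the quadratic side of
    order t^2. *)
Lemma dotv_le_sqr_eq0 p C : (forall z, dotv p z <= C * dotv z z) -> p = 0.
Proof.
move=> h; apply: dotv_eq0; apply/eqP; rewrite eq_le dotv_ge0 andbT.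
rewrite leNgt; apply/negP => p0.
pose t := (`|C| + 1)^-1.
have c0 : 0 < `|C| + 1 by rewrite ltr_pwDr.
have t0 : 0 < t by rewrite invr_gt0.
have := h (t *: p); rewrite !dotvE => ht.
have : t * dotv p p <= t * (C * t * dotv p p) by move: ht; rewrite !mulrA (mulrC C t).
rewrite ler_pM2l// => {}ht.
have : 1 * dotv p p <= C * t * dotv p p by rewrite mul1r.
rewrite ler_pM2r// /t ler_pdivlMr// mul1r; have := ler_norm C; lra.
Qed.

(** Monotonicity without assuming integrability: the comparison is made on the nonnegative functions
    [K * w2 z - f z] and [K * w2 z - g z]. *)
Lemma le_integral_w2 (m : levyMeasure R N) (f g : V -> R) K a :
  measurable_fun setT (f : T -> R) -> measurable_fun setT (g : T -> R) ->
  0 <= K -> (forall z, g z <= K * w2 z) -> (forall z, f z <= g z) ->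
  (a%:E <= \int[m]_z (f z)%:E -> a%:E <= \int[m]_z (g z)%:E)%E.
Proof.
move=> mf mg K0 gK fg.
have fK z : f z <= K * w2 z by exact: le_trans (gK z).
move=> /(integral_le_w2 m a mf K0 fK) h.
apply/(integral_le_w2 m a mg K0 gK); apply: le_trans h.
apply: ge0_le_integral => //.
- by move=> z _; rewrite lee_fin subr_ge0.
- apply: measurableEFinS; apply: measurable_funB => //; apply: measurable_funM => //.
  exact: measurable_w2.
- apply: measurableEFinS; apply: measurable_funB => //; apply: measurable_funM => //.
  exact: measurable_w2.
- by move=> z _; rewrite lee_fin lerD2l lerN2.
Qed.

Lemma integral_oppr_w2 (m : levyMeasure R N) (f : V -> R) K :
  measurable_fun setT (f : T -> R) -> 0 <= K -> (forall z, - f z <= K * w2 z) ->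
  (\int[m]_z (- f z)%:E = - \int[m]_z (f z)%:E)%E.
Proof.
move=> mf K0 fK; apply: (@integralN _ T R m setT (fun z => (f z)%:E)).
apply: fin_num_adde_defl.
rewrite fin_numN ge0_fin_numE ?integral_ge0//.
apply: (@le_lt_trans _ _ (K%:E * \int[m]_z (w2 z)%:E)%E); last first.
  by have := levy_w2_fin m; case: (\int[m]_z _)%E => // I _; rewrite -EFinM ltry.
have mw := @measurableEFinS R N _ setT (@measurable_w2 R N).
rewrite -ge0_integralZl//; last by move=> z _; rewrite lee_fin w2_ge0.
apply: ge0_le_integral => //.
- by apply: measurable_funeneg; exact: measurableEFinS.
- exact: measurable_funeM.
- move=> z _; rewrite funenegE -EFinM -EFinN -EFin_max lee_fin ge_max fK/=.
  by rewrite mulr_ge0// w2_ge0.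
Qed.

(** The stability result behind both halves of Perron's method. The competitors [g] may change with
    the scale [r]. Their common opening [C] and bound [M] give domination by [w2]; [g <= W], the
    almost contact at [x] and the semicontinuity of [W] give the pointwise upper limit required by
    [fatou_levy]. *)
Lemma touch_limit G W x0 p C c M :
  hypM2 nu -> hypM3 nu -> hypM4 nu -> 0 <= lambda -> 0 <= C -> 0 <= c ->
  Hcont G -> uscd W -> (forall x, `|W x| <= M) -> touched W x0 p C ->
  (forall r, 0 < r <= 1 -> exists g x q,
    [/\ measurable_fun setT (g : T -> R), (forall y, `|g y| <= M),
        (forall y, g y <= W y) & touched g x q C] /\
    [/\ enorm (x - x0) <= r, enorm (q - p) <= c * r, W x0 - c * r <= g x &
       ((lambda * g x + G x q)%:E <= \int[nu x]_z (incr g x q z)%:E)%E]) ->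
  ((lambda * W x0 + G x0 p)%:E <= \int[nu x0]_z (incr W x0 p z)%:E)%E.
Proof.
move=> h2 h3 h4 l0 C0 c0 Gc uW WM tW happ.
pose r (n : nat) : R := n.+1%:R^-1.
have r01 n : 0 < r n <= 1 by rewrite invr_gt0 ltr0n/= invf_le1 ?ltr0n// ler1n.
have rlim e : 0 < e -> exists n0, forall n, (n0 <= n)%N -> r n < e.
  move=> e0; exists (Num.truncn e^-1) => n hn.
  rewrite /r -[ltRHS]invrK ltf_pV2 ?posrE ?invr_gt0 ?ltr0n//.
  by apply: lt_le_trans (truncnS_gt _) _; rewrite ler_nat ltnS.
have crlim k e : 0 <= k -> 0 < e -> exists n0, forall n, (n0 <= n)%N -> k * r n < e.
  move=> k0 e0; have k1 : 0 < k + 1 by lra.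
  have [n0 hn] := rlim _ (divr_gt0 e0 k1).
  exists n0 => n /hn; rewrite ltr_pdivlMr// => h.
  by have /andP[] := r01 n; nra.
have /choice [gn /choice[xn /choice [qn hn]]] : forall n, exists g x q,
    [/\ measurable_fun setT (g : T -> R), (forall y, `|g y| <= M),
        (forall y, g y <= W y) & touched g x q C] /\
    [/\ enorm (x - x0) <= r n, enorm (q - p) <= c * r n, W x0 - c * r n <= g x &
       ((lambda * g x + G x q)%:E <= \int[nu x]_z (incr g x q z)%:E)%E].
  by move=> n; apply: happ.
have M0 : 0 <= M := le_trans (normr_ge0 _) (WM 0).
pose K := Num.max C (2 * M).
have K0 : 0 <= K by rewrite le_max C0.
apply: (@fatou_levy R N nu x0 xn _ (fun n => incr (gn n) (xn n) (qn n)) K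
  (2 * M + (enorm p + c)) (fun n => lambda * gn n (xn n) + G (xn n) (qn n))) => //.
- move=> d d0; have [n0 hn0] := rlim d d0; exists n0 => n nn0.
  by have [_ [xx _ _ _]] := hn n; exact: le_lt_trans xx (hn0 n nn0).
- by apply: measurable_incr; exact: uscd_measurable.
- by move=> n; have [[mg _ _ _] _] := hn n; exact: measurable_incr.
- move=> n z; have [[_ gM _ gt] _] := hn n.
  by apply: incr_le_w2 => // z' _; exact: gt.
- move=> n z; have [[_ gM _ gt] [_ qq _ _]] := hn n.
  have a1 : `|gn n (xn n + z) - gn n (xn n)| <= 2 * M.
    by apply: le_trans (ler_normB _ _) _; have := gM (xn n + z); have := gM (xn n); lra.
  have [z1|z1] := ltP (enorm z) 1.
    rewrite incr_in//; apply: le_trans (ler_normB _ _) _; apply: lerD => //.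
    apply: le_trans (norm_dotv_le _ _) _.
    apply: (@le_trans _ _ (enorm (qn n) * 1)); first by rewrite ler_wpM2l ?enorm_ge0// ltW.
    rewrite mulr1; apply: (@le_trans _ _ (enorm p + enorm (qn n - p))).
      by apply: le_trans (enormD _ _); rewrite addrC subrK.
    rewrite lerD2l (le_trans qq)//; have /andP[_ ?] := r01 n.
    by rewrite ler_piMr.
  by rewrite incr_out//; apply: le_trans a1 _; rewrite lerDl addr_ge0 ?enorm_ge0.
(* One third each for the value at [x0 + z], the slope and the base value. *)
- move=> z e e0; have e3 : 0 < e / 3 by lra.
  have [d d0 hd] := uW (x0 + z) _ e3.
  have [n1 hn1] := rlim d d0.
  have [n2 hn2] := crlim _ _ c0 e3.
  have cz : 0 <= c * enorm z by rewrite mulr_ge0// enorm_ge0.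
  have [n3 hn3] := crlim _ _ cz e3.
  exists (maxn n1 (maxn n2 n3)) => n.
  rewrite !geq_max => /andP[/hn1 l1 /andP[/hn2 l2 /hn3 l3]].
  have [[_ _ gW _] [xx qq gx _]] := hn n.
  have a1 : gn n (xn n + z) <= W (x0 + z) + e / 3.
    apply: le_trans (gW _) _; apply/ltW/hd.
    by rewrite opprD addrACA subrr addr0 (le_lt_trans xx).
  have a2 : - dotv (qn n) z <= - dotv p z + e / 3.
    suff : `|dotv (qn n - p) z| <= e / 3.
      by rewrite dotvDl dotvNl ler_norml => /andP[]; lra.
    apply: le_trans (norm_dotv_le _ _) _; apply: ltW; apply: le_lt_trans l3.
    by rewrite mulrAC ler_wpM2r// enorm_ge0.
  have [z1|z1] := ltP (enorm z) 1; first by rewrite !incr_in//; lra.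
  by rewrite !incr_out//; lra.
- by move=> z; apply: incr_le_w2 => // z' _; exact: tW.
- by move=> n; have [_ []] := hn n.
move=> e e0; have e2 : 0 < e / 2 by lra.
have [d d0 hd] := Gc x0 p _ e2.
have [n1 hn1] := rlim d d0.
have [n2 hn2] := crlim _ _ c0 d0.
have [n3 hn3] := crlim _ _ (mulr_ge0 l0 c0) e2.
exists (maxn n1 (maxn n2 n3)) => n.
rewrite !geq_max => /andP[/hn1 l1 /andP[/hn2 l2 /hn3 l3]].
have [_ [xx qq gx _]] := hn n.
have := hd _ _ (le_lt_trans xx l1) (le_lt_trans qq l2).
rewrite ler_norml => /andP[G1 _].
have : lambda * (W x0 - c * r n) <= lambda * gn n (xn n) by rewrite ler_wpM2l.
by rewrite mulrBr mulrA; lra.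
Qed.

Lemma touched_slope u x p q C D : touched u x p C ->
  (forall z, u x + dotv q z - D * dotv z z <= u (x + z)) -> q = p.
Proof.
move=> tu lu; apply/subr0_eq/(@dotv_le_sqr_eq0 _ (C + D)) => z.
by have := tu z; have := lu z; rewrite dotvDl dotvNl; lra.
Qed.

Lemma esub_cst H c : (forall x, lambda * c + H x 0 <= 0) -> esub H (fun=> c).
Proof.
move=> hc x p C C0 t; have p0 : - p = 0.
  by apply: (@dotv_le_sqr_eq0 _ C) => z; have := t z; rewrite !dotvE; lra.
rewrite -[p]opprK p0 oppr0 integral0_eq ?lee_fin//.
by move=> z _; rewrite /incr subrr dotv0l mulr0 subr0.
Qed.

(** Opening the paraboloid to [C + 1] makes the contact strict: [w] minus the paraboloid is at most
    W x0 - |x - x0|^2. Every point doing at least as well as [y] is then within [r] of [x0], and a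
    maximum over a ball is global. *)
Lemma touch_sup w W x0 p C r y : 0 <= C -> uscd w -> (forall x, w x <= W x) ->
  touched W x0 p C -> 0 < r ->
  W x0 - r ^+ 2 <= w y - parab x0 0 p (C + 1) y ->
  exists x,
    [/\ enorm (x - x0) <= r, W x0 - r ^+ 2 - enorm p * r <= w x &
        touched w x (p + (2 * (C + 1)) *: (x - x0)) (C + 1)].
Proof.
move=> C0 uw wW tW r0 hy.
pose P := parab x0 0 p (C + 1).
pose f x := w x - P x.
have fle x : f x <= W x0 - dotv (x - x0) (x - x0).
  rewrite /f /P /parab; have := tW (x - x0); rewrite addrCA subrr addr0.
  by have := wW x; lra.
have uf : uscd f.
  by apply: uscdD => //; exact: continuous_lscd (@continuous_parab _ _ x0 0 p (C + 1)).
have near0 x : f y <= f x -> enorm (x - x0) <= r.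
  move=> yx; rewrite enorm_le_sqr ?(ltW r0)//.
  by have := fle x; move: hy yx; rewrite /f /P; lra.
have in_K x : f y <= f x -> enorm x <= enorm x0 + r.
  move=> /near0 h; rewrite addrC -[x in enorm x](subrK x0).
  by apply: le_trans (enormD _ _) _; rewrite lerD2r.
have [||z _ a|x Kx hx] := @usc_max _ R [set x | enorm x <= enorm x0 + r] f.
- exact: bounded_eball_compact.
- by exists y; exact: in_K.
- exact: uscd_near.
have max z : f z <= f x.
  have [fyz|] := leP (f y) (f z); first by apply: hx; exact: in_K.
  by move=> /ltW /le_trans; apply; apply: hx; exact: in_K.
have xr := near0 x (max y).
exists x; split => //; last first.
  by move=> z; have := max (x + z); rewrite /f /P parab_shift; lra.
have px : - (enorm p * r) <= dotv p (x - x0).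
  rewrite lerNl -dotvNr; apply: le_trans (dotv_le _ _) _.
  by rewrite enormN ler_wpM2l// enorm_ge0.
have : 0 <= (C + 1) * dotv (x - x0) (x - x0).
  by rewrite mulr_ge0 ?dotv_ge0//; lra.
by have := max y; move: hy; rewrite /f /P /parab; lra.
Qed.

Definition perron_class H M := [set w | [/\ uscd w, (forall x, `|w x| <= M) & esub H w]].

Definition perron_sup H M x := sup [set w x | w in perron_class H M].

(** * Perron's supremum and its two envelopes *)

Section perron_sup.
Variables (H : V -> V -> R) (M : R).
Hypotheses (h2 : hypM2 nu) (h3 : hypM3 nu) (h4 : hypM4 nu) (l0 : 0 < lambda).
Hypotheses (Hc : Hcont H) (M0 : 0 <= M) (HM : forall x, `|H x 0| <= lambda * M).

Local Notation S := (perron_class H M).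
Local Notation U0 := (perron_sup H M).
Local Notation U := (usce U0).

Let Scst : S (fun=> - M).
Proof.
split; first by move=> x e e0; exists 1 => // y _; lra.
- by move=> x; rewrite normrN ger0_norm.
by apply: esub_cst => x; have := HM x; rewrite ler_norml => /andP[]; lra.
Qed.

Let hs x : has_sup [set w x | w in S].
Proof.
split; first by exists (- M); exists (fun=> - M).
by exists M => _ [w [_ wM _] <-]; have := wM x; rewrite ler_norml => /andP[].
Qed.

Lemma le_perron_sup w x : S w -> w x <= U0 x.
Proof. by move=> Sw; apply: sup_upper_bound; [exact: hs|exists w]. Qed.

Lemma perron_sup_bound x : `|U0 x| <= M.
Proof.
rewrite ler_norml; apply/andP; split.
  exact: le_trans (le_perron_sup x Scst).
apply: ge_sup; first by case: (hs x).
by move=> _ [w [_ wM _] <-]; have := wM x; rewrite ler_norml => /andP[].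
Qed.

Lemma perron_env_bound x : `|U x| <= M.
Proof. exact: (usce_bound perron_sup_bound). Qed.

(** Near [x0] some member [w] of the class almost reaches [U x0]. [touch_sup] moves the contact from
    [U] to [w] at a nearby point, where the inequality for [w] is available, and [touch_limit] lets
    the scale tend to 0. *)
Lemma perron_env_esub : esub H U.
Proof.
move=> x0 p C C0 tU.
pose c := Num.max (2 * (C + 1)) (1 + enorm p).
have C1 : 0 <= C + 1 by lra.
have c0 : 0 <= c by rewrite le_max mulr_ge0.
have tU1 : touched U x0 p (C + 1).
  by move=> z; have := tU z; have := dotv_ge0 z; lra.
apply: (touch_limit (c := c) (M := M) h2 h3 h4 (ltW l0) C1 c0 Hc _ _ tU1).
- exact: usce_uscd perron_sup_bound.
- exact: perron_env_bound.
move=> r /andP[r0 r1].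
(* At distance at most [d <= 1] the paraboloid varies by at most [k * d], which costs [r ^+ 2 / 2];
   the envelope and the supremum cost [r ^+ 2 / 4] each. *)
pose k := enorm p + (C + 1) + 1.
have p0 := enorm_ge0 p.
have k0 : 0 < k by rewrite /k; lra.
have r2 : 0 < r ^+ 2 by rewrite exprn_gt0.
pose d := Num.min 1 (r ^+ 2 / 2 / k).
have d0 : 0 < d by rewrite lt_min ltr01 !divr_gt0.
have r4 : 0 < r ^+ 2 / 4 by lra.
have [y yd Uy] := usce_approx perron_sup_bound x0 r4 d0.
have [_ [w Sw <-] wy] := sup_adherent r4 (hs y).
have [uw wM ew] := Sw.
have {}wy : U0 y - r ^+ 2 / 4 < w y := wy.
have dk : k * d <= r ^+ 2 / 2.
  by rewrite mulrC -ler_pdivlMr// ge_min lexx orbT.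
have wU x : w x <= U x := le_trans (le_perron_sup x Sw) (le_usce perron_sup_bound x).
have [|x [xr wx tw]] := @touch_sup w U x0 p C r y C0 uw wU tU r0.
  rewrite /parab.
  have e1 : dotv p (y - x0) <= enorm p * d.
    apply: le_trans (dotv_le _ _) _; rewrite ler_wpM2l//; exact: ltW.
  have e2 : (C + 1) * dotv (y - x0) (y - x0) <= (C + 1) * d.
    rewrite ler_wpM2l// -enorm_sqr expr2 -[leRHS]mulr1 ler_pM ?enorm_ge0// ?(ltW yd)//.
    by apply: le_trans (ltW yd) _; rewrite ge_min lexx.
  by move: wy Uy dk; rewrite /k; lra.
exists w, x, (p + (2 * (C + 1)) *: (x - x0)); split; split => //.
- exact: uscd_measurable.
- rewrite addrAC subrr add0r enormZ ger0_norm ?mulr_ge0//.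
  apply: ler_pM => //; first by rewrite mulr_ge0.
    exact: enorm_ge0.
  by rewrite le_max lexx.
- apply: le_trans wx; rewrite -addrA lerD2l -opprD lerN2.
  apply: (@le_trans _ _ ((1 + enorm p) * r)).
    by rewrite mulrDl mul1r lerD2r expr2 ler_piMr// ltW.
  by rewrite ler_wpM2r ?(ltW r0)// le_max lexx orbT.
- exact: (ew _ _ _ C1 tw).
Qed.

Lemma perron_env_class : S U.
Proof.
split; first exact: usce_uscd perron_sup_bound.
- exact: perron_env_bound.
- exact: perron_env_esub.
Qed.

(* W is minus the lower semicontinuous envelope of U. *)
Local Notation W := (usce (fun x => - U x)).

Let NU_bound x : `|- U x| <= M.
Proof. by rewrite normrN perron_env_bound. Qed.

(** The bump [w] rises above the supremum of the class, so it fails to be a subsolution at some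
    point. Read for [- w], this failure is the approximate inequality that [touch_limit] carries to
    [x0]. *)
Lemma perron_env_esuper : esuper H (fun x => - W x).
Proof.
rewrite /esuper (_ : (fun x => - - W x) = W); last first.
  by apply/funext => x; rewrite opprK.
move=> x0 p C C0 tW.
have uW : uscd W := usce_uscd NU_bound.
have WM := usce_bound NU_bound.
have NUW x : - U x <= W x := le_usce NU_bound x.
(* If the lower envelope already reaches [M] at [x0] there is no room for a bump; but then [x0]
   minimizes [W], the slope vanishes and [HM] gives the inequality. *)
have [WeM|WgtM] := leP (W x0) (- M).
  have p0 : - p = 0.
    apply: (@dotv_le_sqr_eq0 _ C) => z; rewrite dotvNl.
    by have := tW z; have := WM (x0 + z); rewrite ler_norml => /andP[]; lra.
  have {}p0 : p = 0 by rewrite -[p]opprK p0 oppr0.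
  apply: (@le_trans _ _ 0%E).
    rewrite lee_fin p0 /Hneg oppr0; have := HM x0; rewrite ler_norml => /andP[? _].
    have : lambda * W x0 <= lambda * - M by rewrite ler_pM2l.
    by lra.
  apply: integral_ge0 => z _; rewrite lee_fin /incr p0 dotv0l mulr0 subr0.
  by have := WM (x0 + z); rewrite ler_norml => /andP[]; lra.
have C1 : 0 <= C + 1 by lra.
have tW1 : touched W x0 p (C + 1).
  by move=> z; have := tW z; have := dotv_ge0 z; lra.
have p0 := enorm_ge0 p.
(* The factor [k] keeps the bump below [M], since (1 + |p|) r is at most [W x0 + M]. *)
pose k := Num.min 1 ((W x0 + M) / (1 + enorm p)).
have k0 : 0 < k by rewrite lt_min ltr01 divr_gt0//; lra.
have k1 : k <= 1 by rewrite ge_min lexx.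
have kM : (1 + enorm p) * k <= W x0 + M.
  by rewrite mulrC -ler_pdivlMr ?ge_min ?lexx ?orbT//; lra.
pose c := 2 * (C + 1) + enorm p + C + 2.
have c0 : 0 <= c by rewrite /c; lra.
apply: (touch_limit (c := c) (M := M) h2 h3 h4 (ltW l0) C1 c0 (Hcont_neg Hc) uW WM tW1).
move=> r' /andP[r'0 r'1].
pose r := r' * k.
have r0 : 0 < r by rewrite mulr_gt0.
have rr' : r <= r' by rewrite ler_piMr// ltW.
have rk : r <= k by rewrite ler_piMl// ltW.
have r1 : r <= 1 by apply: le_trans k1.
have r2 : 0 < r ^+ 2 by rewrite exprn_gt0.
have r2r : r ^+ 2 <= r by rewrite expr2 ler_piMr// ltW.
pose phi := parab x0 (- W x0 + r ^+ 2 / 2) (- p) (- (C + 1)).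
pose w x := Num.max (U x) (phi x).
have cphi : continuous phi by exact: continuous_parab.
(* The extra 1 in the opening confines the set where [phi] exceeds [U] to distance [r] from [x0]. *)
have phi_ge x : dotv (x - x0) (x - x0) <= r ^+ 2 / 2 - W x - phi x.
  rewrite /phi /parab dotvNl; have := tW (x - x0); rewrite addrCA subrr addr0.
  by lra.
have uw : uscd w.
  by apply: uscd_max; [exact: usce_uscd perron_sup_bound|exact: continuous_uscd].
have phi_out x : U x < phi x -> enorm (x - x0) <= r.
  move=> h; rewrite enorm_le_sqr ?(ltW r0)//.
  by have := phi_ge x; have := NUW x; lra.
have wM x : `|w x| <= M.
  rewrite ler_norml /w le_max; have := perron_env_bound x; rewrite ler_norml => /andP[-> /=].
  move=> UM; rewrite ge_max UM /=; have [h|/phi_out xr] := leP (phi x) (U x); first exact: le_trans h UM.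
  have : - dotv p (x - x0) <= enorm p * r.
    rewrite -dotvNr; apply: le_trans (dotv_le _ _) _.
    by rewrite enormN ler_wpM2l.
  have : (1 + enorm p) * r <= (1 + enorm p) * k by rewrite ler_wpM2l//; lra.
  have : 0 <= (C + 1) * dotv (x - x0) (x - x0) by rewrite mulr_ge0// dotv_ge0.
  by rewrite /phi /parab dotvNl; lra.
(* A subsolution [w] would lie below [U], so that [phi <= U] and W x0 <= - phi x0 = W x0 - r^2 /
   2. *)
have nw : ~ esub H w.
  move=> ew; have Sw : S w by [].
  have phiU x : - U x <= - phi x.
    rewrite lerN2; apply: le_trans (le_usce perron_sup_bound x).
    by apply: le_trans (le_perron_sup x Sw); rewrite /w le_max lexx orbT.
  have := usce_le NU_bound (continuous_lscd cphi) phiU x0.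
  by rewrite /phi /parab subrr !dotv0r; lra.
have [x [q [D [D0 [tw lt]]]]] : exists x q D, 0 <= D /\ touched w x q D /\
    ~ ((lambda * w x + H x q)%:E <= \int[nu x]_z (incr w x q z)%:E)%E.
  apply: contrapT => hn; apply: nw => x q D D0 tw; apply: contrapT => lt.
  by apply: hn; exists x, q, D.
have mw := uscd_measurable uw.
have mU := uscd_measurable (usce_uscd perron_sup_bound).
have Uw y : U y <= w y by rewrite /w le_max lexx.
have phiw y : phi y <= w y by rewrite /w le_max lexx orbT.
(* Where [w] coincides with [U], the inequality for [U] passes to [w], whose increments are larger;
   the failure must occur where [w] is [phi]. *)
have [Uphi|Uphi] := leP (phi x) (U x).
  have wx : w x = U x by rewrite /w max_l.
  exfalso; apply: lt; rewrite wx.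
  have KD : 0 <= Num.max D (2 * M) by rewrite le_max D0.
  apply: (@le_integral_w2 (nu x) (incr U x q) (incr w x q) _ _ _ _ KD).
  - exact: measurable_incr.
  - exact: measurable_incr.
  - by apply: incr_le_w2 => // z _; exact: tw.
  - by move=> z; rewrite /incr wx !lerD2r.
  - apply: (perron_env_esub D0) => z; rewrite -wx; exact: le_trans (Uw _) (tw _).
have wx : w x = phi x by rewrite /w max_r// ltW.
have xr := phi_out x Uphi.
have lphi z : w x + dotv (- p + (2 * - (C + 1)) *: (x - x0)) z - (C + 1) * dotv z z
    <= w (x + z).
  by rewrite wx; apply: le_trans (phiw _); rewrite /phi parab_shift; lra.
(* At [x], [w] is squeezed between the paraboloid of the failed test and [phi], so [q] is the slope
   of [phi] there. *)
have qE := touched_slope tw lphi.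
have tNw : touched (fun y => - w y) x (- q) (C + 1).
  by move=> z; have := lphi z; rewrite qE dotvNl; lra.
have KC : 0 <= Num.max (C + 1) (2 * M) by rewrite le_max C1.
have wMN y : `|- w y| <= M by rewrite normrN.
exists (fun y => - w y), x, (- q); split; split => //.
- exact: measurable_funN.
- by move=> y; apply: le_trans (NUW y); rewrite lerN2.
- exact: le_trans xr rr'.
- rewrite -qE opprD opprK mulrN scaleNr opprK addrAC subrr add0r enormZ.
  rewrite ger0_norm ?mulr_ge0//; apply: ler_pM; rewrite ?enorm_ge0 ?mulr_ge0//.
    by rewrite /c; lra.
  exact: le_trans xr rr'.
- rewrite wx /phi /parab dotvNl.
  have : - dotv p (x - x0) <= enorm p * r.
    rewrite -dotvNr; apply: le_trans (dotv_le _ _) _.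
    by rewrite enormN ler_wpM2l.
  have : 0 <= (C + 1) * dotv (x - x0) (x - x0) by rewrite mulr_ge0// dotv_ge0.
  have : c * r <= c * r' by rewrite ler_wpM2l.
  have : 0 <= (C + 1) * r by rewrite mulr_ge0// ltW.
  by rewrite /c; lra.
under eq_integral do rewrite incrN.
rewrite (@integral_oppr_w2 _ _ (Num.max (C + 1) (2 * M)))//.
- rewrite /Hneg opprK mulrN -opprD EFinN leeN2.
  by case/orP: (le_total (lambda * w x + H x q)%:E%E (\int[nu x]_z (incr w x q z)%:E)%E).
- exact: measurable_incr.
- by move=> z; rewrite -incrN; apply: incr_le_w2 => // z' _; exact: tNw.
Qed.

End perron_sup.
End perron.

(** * Consequences of (H0)-(H2) *)

Section hamiltonian.
Variables (R : realType) (N : nat).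
Local Notation V := 'rV[R]_N.
Implicit Types (H : V -> V -> R) (x y z p q : V) (m r s e : R).

Lemma hypH0_cont H : hypH0 H -> Hcont H.
Proof.
move=> [ch _] x p e e0.
have /(@cvgrPdist_le _ _ _ (nbhs (x, p)) (nbhs_filter _)) /(_ e e0) := ch (x, p).
move=> [[A B] /= [/nbhs_eball[d d0 hd] /nbhs_eball[d' d'0 hd']] h].
exists (Num.min d d'); first by rewrite lt_min d0.
move=> y q; rewrite !lt_min => /andP[yx _] /andP[_ qp].
by rewrite distrC; apply: (h (y, q)); split; [exact: hd|exact: hd'].
Qed.

Lemma powRB1_le s m : 1 <= m -> 0 <= s -> s `^ (m - 1) <= 1 + s `^ m.
Proof.
move=> m1 s0; have [s1|s1] := leP s 1.
  apply: (@le_trans _ _ 1); last by rewrite lerDl powR_ge0.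
  apply: (@le_trans _ _ (1 `^ (m - 1))); last by rewrite powR1.
  by apply: ge0_ler_powR; rewrite ?nnegrE// subr_ge0.
apply: (@le_trans _ _ (s `^ m)); last by rewrite lerDr.
by apply: ler_powR; [exact: ltW|lra].
Qed.

Lemma le_powR1 s m : 1 <= m -> 0 <= s -> s <= 1 + s `^ m.
Proof.
move=> m1 s0; have [s1|s1] := leP s 1.
  by apply: le_trans s1 _; rewrite lerDl powR_ge0.
apply: (@le_trans _ _ (s `^ m)); last by rewrite lerDr.
by rewrite -[leLHS]powRr1//; apply: ler_powR => //; exact: ltW.
Qed.

(** Only [z = 0] has to be moved, along a coordinate axis; this is where [N > 0] enters. *)
Lemma punctured_approx z d e : (0 < N)%N -> enorm z < d -> 0 < e ->
  exists2 z', enorm (z' - z) < e & 0 < enorm z' < d.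
Proof.
move=> N0 zd e0.
have [z0|z0] := eqVneq (enorm z) 0; last first.
  exists z; first by rewrite subrr enorm0.
  by rewrite zd andbT lt_neqAle eq_sym z0 enorm_ge0.
have {z0}z0 : z = 0 := enorm_eq0 z0.
have d0 : 0 < d by apply: le_lt_trans zd; exact: enorm_ge0.
pose i0 := Ordinal N0; pose t := Num.min d e / 2.
have m0 : 0 < Num.min d e by rewrite lt_min d0.
have t0 : 0 < t by rewrite divr_gt0.
have n1 : enorm (delta_mx 0 i0 : V) = 1.
  rewrite /enorm /dotv (bigD1 i0)//= big1 ?addr0; first by rewrite !mxE !eqxx mulr1 sqrtr1.
  by move=> j ji; rewrite mxE (negbTE ji) andbF mul0r.
have tE : enorm (t *: (delta_mx 0 i0 : V)) = t by rewrite enormZ n1 mulr1 gtr0_norm.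
have : Num.min d e <= d by rewrite ge_min lexx.
have : Num.min d e <= e by rewrite ge_min lexx orbT.
move=> me md; exists (t *: delta_mx 0 i0); rewrite ?z0 ?subr0 tE /t; first lra.
by apply/andP; split; lra.
Qed.

(* The moduli in (H1) are unconstrained at 0, so the cases x = y and q = 0 are
   reached by continuity of H. *)
Lemma hypH1P H m : (0 < N)%N -> 1 <= m -> hypH1 m H -> Hcont H -> forall e, 0 < e ->
  exists2 d, 0 < d & forall x y p q, enorm (x - y) < d -> enorm q < d ->
    H y (p + q) - H x p <= e * (1 + enorm p `^ m).
Proof.
move=> N0 m1 [w1 [w2 [mw1 mw2 hw]]] Hc e e0.
(* As 1 + |p|^(m-1) <= 2 (1 + |p|^m), the eighth below counts as a quarter; with [e / 2] left for
   continuity, the total is at most e (1 + |p|^m). *)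
have [d1 d10 hd1] := modulusP mw1 (divr_gt0 e0 (ltr0n _ 4)).
have [d2 d20 hd2] := modulusP mw2 (divr_gt0 e0 (ltr0n _ 8)).
pose d := Num.min (Num.min d1 d2) 1.
exists d; first by rewrite !lt_min d10 d20 ltr01.
move=> x y p q xy qd.
have e2 : 0 < e / 2 by lra.
have [d' d'0 hd'] := Hc y (p + q) _ e2.
have [z zy /andP[z0 zd]] := punctured_approx N0 xy d'0.
have [q' qq /andP[q0 q'd]] := punctured_approx N0 qd d'0.
have dd1 : d <= d1 by rewrite !ge_min lexx.
have dd2 : d <= d2 by rewrite !ge_min lexx orbT.
have dd3 : d <= 1 by rewrite ge_min lexx orbT.
have h1 : enorm (x - z - y) < d'.
  by rewrite enormB (_ : y - (x - z) = z - (x - y))// !opprB addrC addrCA addrC.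
have h2 : enorm (p + q' - (p + q)) < d' by rewrite opprD addrACA subrr add0r.
have := hd' _ _ h1 h2; rewrite ler_norml => /andP[c1 _].
have := hw x (x - z) p q' (le_trans (ltW q'd) dd3).
rewrite opprB addrCA subrr addr0 => c2.
have P0 := powR_ge0 (enorm p) m.
have PB := powRB1_le m1 (enorm_ge0 p).
have PB0 := powR_ge0 (enorm p) (m - 1).
have k1 : w1 (enorm z) * (1 + enorm p `^ m) <= e / 4 * (1 + enorm p `^ m).
  by rewrite ler_wpM2r ?addr_ge0// ltW// hd1// z0 (lt_le_trans zd dd1).
have k2 : w2 (enorm q') * (1 + enorm p `^ (m - 1)) <= e / 8 * (1 + enorm p `^ (m - 1)).
  by rewrite ler_wpM2r ?addr_ge0// ltW// hd2// q0 (lt_le_trans q'd dd2).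
have k3 : e / 8 * (1 + enorm p `^ (m - 1)) <= e / 8 * (2 * (1 + enorm p `^ m)).
  by rewrite ler_wpM2l//; lra.
have k4 : 0 <= e * enorm p `^ m by rewrite mulr_ge0// ltW.
by lra.
Qed.

(** Continuity alone gives no uniformity in [x]. Instead 0 is joined to [p] by steps shorter than
    [d], each raising [H x] by at most [a] thanks to [hypH1P], starting from the bound of (H0) at
    slope 0. *)
Lemma hamiltonian_ub H m r : (0 < N)%N -> 1 <= m -> hypH0 H -> hypH1 m H -> 0 <= r ->
  exists2 C, 0 <= C & forall x p, enorm p <= r -> H x p <= C.
Proof.
move=> N0 m1 h0 h1 r0; have [_ [K hK]] := h0.
have [d d0 hd] := hypH1P N0 m1 h1 (hypH0_cont h0) (@ltr01 R).
have K0 x : `|H x 0| <= K by apply: hK; exists x.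
have K00 : 0 <= K := le_trans (normr_ge0 _) (K0 0).
pose a := 1 + r `^ m.
have a0 : 0 <= a by rewrite addr_ge0// powR_ge0.
have step k x p : enorm p <= r -> enorm p <= k%:R * (d / 2) -> H x p <= K + k%:R * a.
  elim: k p => [|k IH] p pr.
    rewrite mul0r => p0; have -> : p = 0.
      by apply: enorm_eq0; apply/eqP; rewrite eq_le p0 enorm_ge0.
    by rewrite mul0r addr0; apply: le_trans (K0 x); exact: ler_norm.
  move=> pk; pose t : R := k.+1%:R^-1.
  have t0 : 0 <= t by rewrite invr_ge0.
  have t1 : t <= 1 by rewrite invf_le1 ?ltr0n// ler1n.
  have nt : enorm ((1 - t) *: p) = (1 - t) * enorm p.
    by rewrite enormZ ger0_norm// subr_ge0.
  have tk : t * k.+1%:R = 1 by rewrite mulVf.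
  have IHk : H x ((1 - t) *: p) <= K + k%:R * a.
    apply: IH; rewrite nt.
      by apply: le_trans pr; rewrite ler_piMl ?enorm_ge0//; lra.
    apply: (@le_trans _ _ ((1 - t) * (k.+1%:R * (d / 2)))).
      by rewrite ler_wpM2l// subr_ge0.
    rewrite mulrBl mul1r (mulrA t) tk -addn1 natrD; lra.
  have tp : enorm (t *: p) < d.
    rewrite enormZ ger0_norm//; apply: (@le_lt_trans _ _ (t * (k.+1%:R * (d / 2)))).
      by rewrite ler_wpM2l.
    by rewrite (mulrA t) tk; lra.
  have := hd x x ((1 - t) *: p) (t *: p).
  rewrite subrr enorm0 -scalerDl subrK scale1r mul1r => /(_ d0 tp).
  have : enorm ((1 - t) *: p) `^ m <= r `^ m.
    apply: ge0_ler_powR; rewrite ?nnegrE ?enorm_ge0//; first lra.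
    by rewrite nt; apply: le_trans pr; rewrite ler_piMl ?enorm_ge0//; lra.
  by rewrite -(natr1 k); move: IHk; rewrite /a; lra.
pose n := (Num.truncn (r / (d / 2))).+1.
exists (K + n%:R * a); first by rewrite addr_ge0// mulr_ge0.
move=> x p pr; apply: step => //; apply: le_trans pr _.
by rewrite -ler_pdivrMr ?divr_gt0//; exact: ltW (truncnS_gt _).
Qed.

(** Extends (H2) to all slopes at the price of [e]. When |p| is below [rho0], the two slopes stay
    bounded and are close for [mu] near 1, so [hypH1P] and the upper bound on [H] suffice. *)
Lemma hypH2P H m e : (0 < N)%N -> 1 <= m -> hypH0 H -> hypH1 m H -> hypH2 m H -> 0 < e ->
  exists mu c, [/\ 0 < mu < 1, 1 - mu <= e, 0 < c &
    forall x p, c * enorm p `^ m - e <= mu * H x (mu^-1 *: p) - H x p].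
Proof.
move=> N0 m1 h0 h1 [bm [b0 [rho0 [mu0 [bm0 b00 rho00 /andP[mu00 mu01] h]]]]] e0.
pose r := rho0 / mu0.
have r0 : 0 <= r by rewrite divr_ge0// ltW.
have [C C0 hC] := hamiltonian_ub N0 m1 h0 h1 r0.
have rm := powR_ge0 r m.
have e4 : 0 < e / 4 / (1 + r `^ m) by rewrite !divr_gt0// ltr_pwDl.
have [d d0 hd] := hypH1P N0 m1 h1 (hypH0_cont h0) e4.
pose A := 1 + b0 + 4 * C + 2 * bm * rho0 `^ m.
have A1 : 1 <= A.
  have := powR_ge0 rho0 m => ?.
  have : 0 <= bm * rho0 `^ m by rewrite mulr_ge0// ltW.
  by rewrite /A; lra.
have A0 : 0 < A by lra.
(* With [t] in the role of 1 - mu, the three bounds keep [mu] above [mu0], absorb the constants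
   collected in [A], and keep the two slopes closer than [d]. *)
pose t := Num.min (Num.min (1 - mu0) (e / A)) (mu0 * d / rho0 / 2).
have t0 : 0 < t by rewrite !lt_min !divr_gt0 ?mulr_gt0// subr_gt0 mu01.
have tmu : t <= 1 - mu0 by rewrite !ge_min lexx.
have teA : t * A <= e by rewrite -ler_pdivlMr// !ge_min lexx orbT.
have tdm : t * rho0 <= mu0 * d / 2.
  rewrite -ler_pdivlMr//; apply: (@le_trans _ _ (mu0 * d / rho0 / 2)).
    by rewrite ge_min lexx orbT.
  by rewrite mulrAC.
pose rhom := rho0 `^ m.
have rhom0 : 0 <= rhom := powR_ge0 _ _.
have [te tb tC tr] : [/\ t <= e, t * b0 <= e, t * C <= e / 4 & t * bm * rhom <= e / 2].
  have : 0 <= t * b0 by rewrite mulr_ge0// ltW.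
  have : 0 <= t * C by rewrite mulr_ge0// ltW.
  have : 0 <= t * bm * rhom by rewrite !mulr_ge0// ltW.
  move: teA; rewrite /A -/rhom !mulrDr mulr1; split; lra.
pose mu := 1 - t.
have mu_gt0 : 0 < mu by rewrite /mu; lra.
have muV : mu^-1 <= mu0^-1 by rewrite lef_pV2 ?posrE// /mu; lra.
exists mu, (t * bm); split; first by rewrite mu_gt0 /mu; lra.
- by rewrite /mu; lra.
- by rewrite mulr_gt0.
move=> x p; have [pr|pr] := leP rho0 (enorm p).
  have := h mu x p; rewrite (_ : mu0 <= mu <= 1); last by rewrite /mu; apply/andP; split; lra.
  move=> /(_ isT pr); apply: le_trans.
  have -> : 1 - mu = t by rewrite /mu; lra.
  by lra.
have pm : enorm p `^ m <= rhom.
  by apply: ge0_ler_powR; rewrite ?nnegrE ?enorm_ge0// ?ltW//; lra.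
have cp : t * bm * enorm p `^ m <= e / 2.
  by apply: le_trans tr; rewrite ler_wpM2l// mulr_ge0// ltW.
have nq : enorm (mu^-1 *: p) <= r.
  rewrite enormZ gtr0_norm ?invr_gt0// mulrC /r.
  by apply: ler_pM => //; rewrite ?enorm_ge0 ?invr_ge0 ?ltW.
have Hq := hC x _ nq.
have pq : enorm (p - mu^-1 *: p) < d.
  rewrite -[X in enorm (X - _)]scale1r -scalerBl enormZ.
  have -> : 1 - mu^-1 = - (t / mu).
    by rewrite -[X in X - _](divff (lt0r_neq0 mu_gt0)) -mulNr -[X in _ - X]mul1r -mulrBl /mu; congr (_ / _); lra.
  rewrite normrN ger0_norm ?divr_ge0 ?ltW//.
  apply: (@le_lt_trans _ _ (t / mu0 * rho0)).
    apply: ler_pM; [by rewrite divr_ge0// ltW|exact: enorm_ge0| |exact: ltW].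
    by rewrite ler_wpM2l// ltW.
  by rewrite mulrAC ltr_pdivrMr//; nra.
have := hd x x (mu^-1 *: p) (p - mu^-1 *: p).
rewrite subrr enorm0 addrCA subrr addr0 => /(_ d0 pq) Hd.
have : e / 4 / (1 + r `^ m) * (1 + enorm (mu^-1 *: p) `^ m) <= e / 4.
  rewrite mulrAC ler_pdivrMr ?ltr_pwDl// ler_wpM2l//; first lra.
  rewrite lerD2l; apply: ge0_ler_powR; rewrite ?nnegrE ?enorm_ge0//; lra.
have : t * H x (mu^-1 *: p) <= t * C by rewrite ler_wpM2l// ltW.
have -> : mu * H x (mu^-1 *: p) = H x (mu^-1 *: p) - t * H x (mu^-1 *: p).
  by rewrite /mu mulrBl mul1r.
by lra.
Qed.

End hamiltonian.

(** * Difference of nonlocal terms *)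

Section nonlocal_difference.
Variables (R : realType) (N : nat).
Local Notation V := 'rV[R]_N.
Local Notation T := (borelV R N).
Implicit Types (m : levyMeasure R N) (F G : T -> R) (z : V).

Lemma integrable_w2 m : m.-integrable setT (EFin \o (@w2 R N : T -> R)).
Proof.
apply/integrableP; split; first by apply/measurable_EFinP; exact: measurable_w2.
have := levy_w2_fin m; rewrite fin_num_abs => h; apply: le_lt_trans h.
rewrite gee0_abs ?integral_ge0//; last by move=> z _; rewrite lee_fin w2_ge0.
rewrite le_eqVlt; apply/orP; left; apply/eqP; apply: eq_integral => z _ /=.
by rewrite ger0_norm// w2_ge0.
Qed.

(** A finite lower bound on the integral makes the negative part integrable too, so real-valued
    integrals can take over. *)
Lemma integrable_le_w2 m F K a : measurable_fun setT F -> 0 <= K ->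
  (forall z, F z <= K * w2 z) -> (a%:E <= \int[m]_z (F z)%:E)%E ->
  m.-integrable setT (EFin \o F) /\ a <= \int[m]_z F z.
Proof.
move=> mF K0 FK ha.
have iF : m.-integrable setT (EFin \o F).
  have mw := @measurable_w2 R N.
  have iKw : m.-integrable setT (EFin \o (fun z => K * w2 z)).
    exact: (integrableZl measurableT K (integrable_w2 m)).
  have iD : m.-integrable setT (EFin \o (fun z => K * w2 z - F z)).
    apply/integrableP; split.
      by apply: measurableEFinS; apply: measurable_funB => //; exact: measurable_funM.
    have := (integral_le_w2 m a mF K0 FK).1 ha.
    have := levy_w2_fin m; case: (\int[m]_z (w2 z)%:E)%E => // I _.
    rewrite -EFinM -EFinB => h.
    apply: (@le_lt_trans _ _ (K * I - a)%:E); last exact: ltry.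
    apply: le_trans h; rewrite le_eqVlt; apply/orP; left; apply/eqP.
    by apply: eq_integral => z _ /=; rewrite ger0_norm// subr_ge0.
  apply: eq_integrable (integrableB measurableT iKw iD) => // z _ /=.
  by rewrite -EFinB; congr EFin; lra.
split => //; rewrite -lee_fin /Rintegral fineK//.
exact: integrable_fin_num.
Qed.

Lemma Rintegral_levy_split m r s F : r <= s -> m.-integrable setT (EFin \o F) ->
  \int[m]_z F z = \int[m]_(z in eball 0 r) F z + \int[m]_(z in annulus r s) F z +
    \int[m]_(z in ~` eball 0 s) F z.
Proof.
move=> rs iF.
have mA := @measurable_annulus R N r s.
have mr := @measurable_eball0T R N r.
have ms := @measurable_eball0T R N s.
have sub : (eball 0 r : set T) `<=` eball 0 s.
  by move=> z; rewrite !eball0E => /lt_le_trans; exact.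
have -> : \int[m]_(z in eball 0 r) F z + \int[m]_(z in annulus r s) F z =
   \int[m]_(z in eball 0 s) F z.
  have E : (eball 0 s : set T) = eball 0 r `|` annulus r s.
    by rewrite /annulus setDUK.
  rewrite [in RHS]E Rintegral_setU//.
    by rewrite -E; exact: (integrableS measurableT).
  by apply/disj_setPS => z [zr [_ /(_ zr)]].
have E : (setT : set T) = eball 0 s `|` ~` eball 0 s by rewrite setUv.
rewrite [in LHS]E Rintegral_setU ?setUv//; first exact: measurable_eball0C.
by apply/disj_setPS => z [zs /(_ zs)].
Qed.

(** The signed version of [adm_proj], from the positive and negative parts separately. *)
Lemma adm_Rintegral (m : levyMeasure R N) (A : set T)
    (g : {measure set (T * T) -> \bar R}) (pi : T * T -> T) F :
  measurable_fun setT pi -> (forall u, ~ A (pi u) -> ~ (A `*` A) u) ->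
  measurable A -> g (~` (A `*` A)) = 0%E ->
  (forall E, measurable E -> E `<=` A `\ 0 -> pushforward g pi E = m E) ->
  m.-integrable A (EFin \o F) -> measurable_fun setT F -> F 0 = 0 ->
  g.-integrable (A `*` A) (EFin \o (F \o pi)) /\
  \int[g]_(z in A `*` A) F (pi z) = \int[m]_(z in A) F z.
Proof.
move=> mpi piA mA gA gm iF mF F0.
have mAA : measurable (A `*` A) by exact: measurableX.
have mE := @measurableEFinS R N F setT mF.
have base (f : T -> \bar R) : measurable_fun setT f -> (forall z, (0 <= f z)%E) ->
    f 0 = 0%E -> (\int[g]_(z in A `*` A) f (pi z) = \int[m]_(z in A) f z)%E.
  move=> mf f0 f00; rewrite -(adm_proj mpi piA mA gA gm mf f0 f00).
  rewrite [RHS](ge0_negligible_integral (N := ~` (A `*` A)))//.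
  - by rewrite setTD setCK.
  - exact: measurableC.
  - exact: measurableT_comp.
have mFp : measurable_fun (A `*` A) (EFin \o (F \o pi)).
  apply/measurable_EFinP; apply: measurable_funTS.
  exact: measurableT_comp.
split.
  apply/integrableP; split => //.
  rewrite (base (fun z => `|(F z)%:E|%E)) ?F0 ?abse0//.
  - by case/integrableP : iF.
  - exact: measurableT_comp.
congr fine; rewrite [in LHS]integralE [in RHS]integralE; congr (_ - _)%E.
  rewrite -base ?funeposE ?F0 ?maxxx//.
  - by apply: eq_integral => z _; rewrite !funeposE.
  - exact: measurable_funepos.
rewrite -base ?funenegE ?F0 ?oppe0 ?maxxx//.
- by apply: eq_integral => z _; rewrite !funenegE.
- exact: measurable_funeneg.
Qed.

(** Three zones. On the small ball both integrals are written with the coupling [g], giving L c +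
    kappa C. On the annulus [G] is moved from [m2] to [m1], where F + G <= kappa w2. In the tail
    each integrand is at most [M] and each measure at most [t]. *)
Lemma levy_diff m1 m2 (g : {measure set (T * T) -> \bar R}) F G (r s L c kappa eps t M C g0 : R) :
  measurable_fun setT F -> measurable_fun setT G -> F 0 = 0 -> G 0 = 0 ->
  m1.-integrable setT (EFin \o F) -> m2.-integrable setT (EFin \o G) ->
  0 < r < 1 -> 1 < s -> 0 <= L -> 0 <= kappa -> 0 <= M -> 0 < g0 ->
  adm (eball 0 r) m1 m2 g ->
  (\int[g]_z (dotv (z.1 - z.2) (z.1 - z.2))%:E <= c%:E)%E ->
  (forall z1 z2, enorm z1 < 1 -> enorm z2 < 1 ->
     F z1 + G z2 <= L * dotv (z1 - z2) (z1 - z2) + kappa * w2 z1) ->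
  (forall z, enorm z < s -> F z + G z <= kappa * w2 z) ->
  (forall z, `|G z| <= g0) ->
  (forall z, s <= enorm z -> F z <= M) -> (forall z, s <= enorm z -> G z <= M) ->
  (forall f : T -> R, measurable_fun setT f -> (forall z, 0 <= f z <= 2 * g0)%R ->
     \int[m2]_(z in annulus r s) (f z)%:E <=
     \int[m1]_(z in annulus r s) (f z)%:E + eps%:E)%E ->
  (forall f : T -> R, measurable_fun setT f -> (forall z, 0 <= f z <= 2 * g0)%R ->
     \int[m1]_(z in annulus r s) (f z)%:E <=
     \int[m2]_(z in annulus r s) (f z)%:E + eps%:E)%E ->
  (m1 (~` eball 0 s) <= t%:E)%E -> (m2 (~` eball 0 s) <= t%:E)%E ->
  (\int[m1]_z (w2 z)%:E <= C%:E)%E ->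
  \int[m1]_z F z + \int[m2]_z G z <= L * c + 2 * kappa * C + 2 * eps + 2 * M * t.
Proof.
move=> mF mG F0 G0 iF iG /andP[r0 r1] s1 L0 k0 M0 g00 ag cg h1 h2 Gg FM GM tv1 tv2 t1 t2 w2C.
have rs : r <= s by lra.
rewrite (Rintegral_levy_split rs iF) (Rintegral_levy_split rs iG).
pose A : set T := eball 0 r.
pose D : set T := annulus r s.
pose Z : set T := ~` eball 0 s.
have mA : measurable A by exact: measurable_eball0T.
have mD : measurable D by exact: measurable_annulus.
have mZ : measurable Z by exact: measurable_eball0C.
have iS (m : levyMeasure R N) (H : T -> R) (E : set T) : measurable E ->
    m.-integrable setT (EFin \o H) -> m.-integrable E (EFin \o H).
  by move=> mE iH; apply: (integrableS measurableT).
have mw := @measurable_w2 R N.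
have iw m := integrable_w2 m.
have w2A (E : set T) : measurable E -> \int[m1]_(z in E) w2 z <= C.
  move=> mE; rewrite -lee_fin fineK; last exact: (integrable_fin_num mE (iS m1 _ E mE (iw m1))).
  apply: le_trans w2C; apply: ge0_subset_integral => //.
    exact: measurableEFinS.
  by move=> z _; rewrite lee_fin w2_ge0.
have fst_piece : \int[m1]_(z in A) F z + \int[m2]_(z in A) G z <= L * c + kappa * C.
  have [gAA _ g1 g2] := ag.
  have piA1 : forall u : T * T, ~ A u.1 -> ~ (A `*` A) u by move=> u h [].
  have piA2 : forall u : T * T, ~ A u.2 -> ~ (A `*` A) u by move=> u h [].
  have [iF1 <-] := adm_Rintegral measurable_fst piA1 mA gAA g1 (iS _ _ _ mA iF) mF F0.
  have [iG1 <-] := adm_Rintegral measurable_snd piA2 mA gAA g2 (iS _ _ _ mA iG) mG G0.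
  have [iw1 ew1] := adm_Rintegral measurable_fst piA1 mA gAA g1 (iS _ _ _ mA (iw m1)) mw (@w2_0 R N).
  have mAA : measurable (A `*` A) by exact: measurableX.
  have id : g.-integrable (A `*` A) (EFin \o (fun u : T * T => dotv (u.1 - u.2) (u.1 - u.2))).
    apply: (integrableS measurableT) => //.
    apply/integrableP; split; first by apply/measurable_EFinP; exact: measurable_dotvB.
    apply: (@le_lt_trans _ _ c%:E); last exact: ltry.
    apply: le_trans cg; rewrite le_eqVlt; apply/orP; left; apply/eqP.
    by apply: eq_integral => z _ /=; rewrite ger0_norm// dotv_ge0.
  rewrite -RintegralD//.
  apply: (@le_trans _ _ (\int[g]_(z in A `*` A)
     (L * dotv (z.1 - z.2) (z.1 - z.2) + kappa * w2 z.1))).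
    apply: le_Rintegral => //.
    - exact: (integrableD mAA iF1 iG1).
    - exact: (integrableD mAA (integrableZl mAA L id) (integrableZl mAA kappa iw1)).
    - move=> [z1 z2] [/=]; rewrite /A !eball0E => z1r z2r; apply: h1.
        exact: lt_trans z1r r1.
      exact: lt_trans z2r r1.
  rewrite RintegralD//; last 2 first.
  - exact: (integrableZl mAA L id).
  - exact: (integrableZl mAA kappa iw1).
  rewrite !RintegralZl// ew1; apply: lerD; last by rewrite ler_wpM2l// w2A.
  rewrite ler_wpM2l// -lee_fin fineK; last exact: integrable_fin_num.
  apply: le_trans cg; apply: ge0_subset_integral => //.
    by apply/measurable_EFinP; exact: measurable_dotvB.
  by move=> z _; rewrite lee_fin dotv_ge0.
have mlty m : (m D < +oo)%E by exact: levy_annulus_lty.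
have bnd m (f : T -> R) b : measurable_fun setT f -> (forall z, `|f z| <= b) ->
    m.-integrable D (EFin \o f).
  move=> mf fb; apply: measurable_bounded_integrable => //; first exact: measurable_funTS.
  exists b; split; first exact: num_real.
  by move=> b' bb z _ /=; apply: le_trans (fb z) (ltW bb).
have tvR m m' (f : T -> R) : (forall f : T -> R, measurable_fun setT f -> (forall z, 0 <= f z <= 2 * g0)%R ->
     \int[m]_(z in annulus r s) (f z)%:E <=
     \int[m']_(z in annulus r s) (f z)%:E + eps%:E)%E ->
    measurable_fun setT f -> (forall z, 0 <= f z <= 2 * g0)%R ->
    \int[m]_(z in D) f z <= \int[m']_(z in D) f z + eps.
  move=> tv mf f01.
  have if_ m0 : (\int[m0]_(z in D) (f z)%:E)%E \is a fin_num.
    apply: integrable_fin_num => //; apply: (bnd _ _ (2 * g0)) => // z.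
    by have /andP[a b] := f01 z; rewrite ger0_norm.
  by have := tv f mf f01; rewrite /Rintegral -lee_fin EFinD !fineK//; exact.
(* The exchange of measures needs a nonnegative integrand: [G + g0] is moved to [m1] and the
   constant [g0] is moved back, each at the price [eps]. *)
have snd_piece : \int[m1]_(z in D) F z + \int[m2]_(z in D) G z <= kappa * C + 2 * eps.
  have gG z : 0 <= G z + g0 <= 2 * g0.
    move: (Gg z); rewrite ler_norml; clear => /andP[? ?].
    by apply/andP; split; lra.
  have iGg m : m.-integrable D (EFin \o G) by exact: (bnd _ _ g0).
  have ig m : m.-integrable D (EFin \o cst g0).
    by apply: (bnd _ _ g0) => // z; rewrite /= gtr0_norm.
  have a1 := tvR m2 m1 (fun z => G z + g0) tv1 (measurable_funD mG (measurable_cst _)) gG.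
  have a2 : \int[m1]_(z in D) g0 <= \int[m2]_(z in D) g0 + eps.
    apply: (tvR m1 m2 (cst g0) tv2) => // z /=.
    by clear -g00; apply/andP; split; lra.
  rewrite !RintegralD// in a1.
  have h : \int[m1]_(z in D) F z + \int[m1]_(z in D) G z <= kappa * C.
    rewrite -RintegralD//; last exact: iS.
    apply: (@le_trans _ _ (\int[m1]_(z in D) (kappa * w2 z))).
      apply: le_Rintegral => //.
      - exact: (integrableD mD (iS _ _ _ mD iF) (iGg m1)).
      - exact: (integrableZl mD kappa (iS _ _ _ mD (iw m1))).
      - by move=> z /annulusE/andP[_ zs]; exact: h2.
    by rewrite RintegralZl ?ler_wpM2l ?w2A//; exact: iS.
  by clear -a1 a2 h; lra.
have tail m (H : T -> R) : (m Z <= t%:E)%E -> m.-integrable setT (EFin \o H) ->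
    (forall z, s <= enorm z -> H z <= M) -> \int[m]_(z in Z) H z <= M * t.
  move=> mt iH HM.
  have mfin : m Z \is a fin_num.
    by rewrite ge0_fin_numE//; apply: le_lt_trans mt (ltry _).
  apply: (@le_trans _ _ (\int[m]_(z in Z) M)).
    apply: le_Rintegral => //; first exact: iS.
      apply: measurable_bounded_integrable => //; first by rewrite -ge0_fin_numE.
      exists `|M|; split; first exact: num_real.
      by move=> b' bb z _ /=; exact: ltW.
    by move=> z; rewrite /Z /= eball0E => /negP; rewrite -leNgt; exact: HM.
  rewrite Rintegral_cst// ler_wpM2l//.
  by rewrite -lee_fin fineK.
have := tail m1 F t1 iF FM; have := tail m2 G t2 iG GM.
by move: fst_piece snd_piece; rewrite /A /D /Z; clear; lra.
Qed.

End nonlocal_difference.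

(** * Comparison principle *)

Section comparison.
Variables (R : realType) (N : nat).
Local Notation V := 'rV[R]_N.
Local Notation T := (borelV R N).
Implicit Types (x y z p q : V) (u v f : V -> R) (K b e s t : R).

(** The tangent at [s] lies above the concave function s / (1 + s), with gap (t - s)^2 / ((1 + s)^2
    (1 + t)). *)
Lemma concave_ratio s t : 0 <= s -> 0 <= t ->
  t / (1 + t) <= s / (1 + s) + (t - s) / (1 + s) ^+ 2.
Proof.
move=> s0 t0.
have a0 : 0 < 1 + s by lra.
have b0 : 0 < 1 + t by lra.
rewrite -subr_ge0.
have -> : s / (1 + s) + (t - s) / (1 + s) ^+ 2 - t / (1 + t) =
    (t - s) ^+ 2 / ((1 + s) ^+ 2 * (1 + t)).
  by field; rewrite !lt0r_neq0.
by rewrite divr_ge0 ?sqr_ge0// mulr_ge0 ?sqr_ge0// ltW.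
Qed.

(* A bounded penalization at infinity; it only has to be touched from above by
   paraboloids, which is why the concavity of s / (1 + s) is enough. *)
Lemma penalization K b : 0 < K -> 0 < b <= 1 -> exists (psi : V -> R) (q : V -> V),
  [/\ uscd (fun x => - psi x), (forall x, 0 <= psi x <= K * b ^+ 2 * dotv x x) &
      (forall x, psi x < K / 2 -> b * enorm x <= 1)] /\
  [/\ (forall x, enorm (q x) <= 2 * K * b) &
      (forall x z, psi (x + z) <= psi x + dotv (q x) z + K * b ^+ 2 * dotv z z)].
Proof.
move=> K0 /andP[b0 b1].
pose s x := b ^+ 2 * dotv x x.
have s0 x : 0 <= s x by rewrite mulr_ge0 ?sqr_ge0// dotv_ge0.
have a1 x : 1 <= 1 + s x by rewrite lerDl.
have a0 x : 0 < 1 + s x by apply: lt_le_trans (a1 x).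
(* [psi] stays below [K] and equals half of it exactly where b |x| = 1; [q] is its gradient. *)
pose psi x := K * (s x / (1 + s x)).
pose q x := (2 * K * b ^+ 2 / (1 + s x) ^+ 2) *: x.
have qb x : enorm (q x) <= 2 * K * b.
  have c0 : 0 <= 2 * K * b ^+ 2 / (1 + s x) ^+ 2.
    by rewrite divr_ge0 ?sqr_ge0// !mulr_ge0 ?sqr_ge0// ltW.
  rewrite enormZ ger0_norm// mulrAC ler_pdivrMr ?exprn_gt0//.
  have sE : s x = (b * enorm x) ^+ 2 by rewrite exprMn enorm_sqr.
  have -> : 2 * K * b ^+ 2 * enorm x = 2 * K * b * (b * enorm x) by ring.
  rewrite sE; set y := b * enorm x.
  have y0 : 0 <= y by rewrite mulr_ge0 ?enorm_ge0// ltW.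
  have Kb : 0 <= 2 * K * b by rewrite !mulr_ge0// ltW.
  apply: ler_wpM2l => //.
  have : 0 <= y ^+ 2 by rewrite sqr_ge0.
  have : 0 <= (y ^+ 2) ^+ 2 by rewrite sqr_ge0.
  have : 0 <= (y - 1) ^+ 2 by rewrite sqr_ge0.
  by nra.
have psi_up x z : psi (x + z) <= psi x + dotv (q x) z + K * b ^+ 2 * dotv z z.
  have h := concave_ratio (s0 x) (s0 (x + z)).
  have hs : s (x + z) - s x = 2 * b ^+ 2 * dotv x z + b ^+ 2 * dotv z z.
    by rewrite /s !dotvE (dotvC z x); ring.
  apply: (@le_trans _ _ (K * (s x / (1 + s x) + (s (x + z) - s x) / (1 + s x) ^+ 2))).
    by rewrite ler_pM2l.
  rewrite hs /psi /q !dotvE -subr_ge0.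
  have -> : K * (s x / (1 + s x)) + 2 * K * b ^+ 2 / (1 + s x) ^+ 2 * dotv x z +
      K * b ^+ 2 * dotv z z -
      K * (s x / (1 + s x) + (2 * b ^+ 2 * dotv x z + b ^+ 2 * dotv z z) / (1 + s x) ^+ 2) =
      K * b ^+ 2 * dotv z z * (1 - ((1 + s x) ^+ 2)^-1).
    by field; rewrite lt0r_neq0.
  apply: mulr_ge0.
    by apply: mulr_ge0; [apply: mulr_ge0; [exact: ltW|exact: sqr_ge0]|exact: dotv_ge0].
  by rewrite subr_ge0 invf_le1 ?exprn_gt0// exprn_ege1.
exists psi, q; split; split => //.
- move=> x e e0.
  have k0 : 0 < 2 * K * b + K * b ^+ 2 + 1.
    by rewrite ltr_pwDr// addr_ge0// !mulr_ge0 ?sqr_ge0// ltW.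
  exists (Num.min 1 (e / (2 * K * b + K * b ^+ 2 + 1))).
    by rewrite lt_min ltr01 divr_gt0.
  move=> y; rewrite lt_min => /andP[y1]; rewrite ltr_pdivlMr// => ye.
  have := psi_up y (x - y); rewrite addrCA subrr addr0.
  rewrite -enorm_sqr (enormB x y) => h1.
  have h2 : dotv (q y) (x - y) <= 2 * K * b * enorm (y - x).
    apply: le_trans (dotv_le _ _) _; rewrite (enormB x y).
    by rewrite ler_wpM2r ?enorm_ge0.
  have h3 : K * b ^+ 2 * enorm (y - x) ^+ 2 <= K * b ^+ 2 * enorm (y - x).
    apply: ler_wpM2l; first by rewrite mulr_ge0 ?sqr_ge0// ltW.
    by rewrite expr2 ler_piMl ?enorm_ge0// ltW.
  by have := enorm_ge0 (y - x); move: ye; rewrite !mulrDr mulr1; lra.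
- move=> x; apply/andP; split; first by rewrite mulr_ge0 ?(ltW K0)// divr_ge0// ltW.
  by rewrite /psi -mulrA ler_pM2l// ler_pdivrMr// ler_peMr.
- move=> x; rewrite /psi ltr_pM2l// ltr_pdivrMr// => h.
  have : (b * enorm x) ^+ 2 <= 1 ^+ 2.
    by rewrite exprMn enorm_sqr expr1n -/(s x); lra.
  by rewrite ler_sqr ?nnegrE ?mulr_ge0 ?enorm_ge0 ?(ltW b0).
Qed.

Lemma uscd_max2 (f1 f2 f3 : V -> R) (K1 K2 : set V) :
  uscd f1 -> uscd f2 -> uscd f3 -> compact K1 -> compact K2 -> K1 !=set0 -> K2 !=set0 ->
  exists x y, [/\ K1 x, K2 y & forall x' y', K1 x' -> K2 y' ->
    f1 x' + f2 y' + f3 (x' - y') <= f1 x + f2 y + f3 (x - y)].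
Proof.
move=> u1 u2 u3 c1 c2 [a1 k1] [a2 k2].
have [|||[x y] [/= Kx Ky] h] := @usc_max (V * V)%type R (K1 `*` K2)
  (fun xy => f1 xy.1 + f2 xy.2 + f3 (xy.1 - xy.2)).
- exact: compact_setX.
- by exists (a1, a2).
- move=> [x y] _ a /= lta.
  pose e := (a - (f1 x + f2 y + f3 (x - y))) / 3.
  have e0 : 0 < e by rewrite divr_gt0// subr_gt0.
  have [d1 d10 h1] := u1 x e e0.
  have [d2 d20 h2] := u2 y e e0.
  have [d3 d30 h3] := u3 (x - y) e e0.
  pose d := Num.min (Num.min d1 d2) (d3 / 2).
  have d0 : 0 < d by rewrite !lt_min d10 d20 divr_gt0.
  exists ([set x' | enorm (x' - x) < d], [set y' | enorm (y' - y) < d]).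
    by split; apply/nbhs_eball; exists d.
  move=> [x' y'] [/=]; rewrite !lt_min => /andP[/andP[x1 _] x3] /andP[/andP[_ y2] y3].
  have xy : enorm (x' - y' - (x - y)) < d3.
    have -> : x' - y' - (x - y) = (x' - x) + (y - y').
      by rewrite opprB (addrC y) addrACA (addrC (- y')).
    by apply: le_lt_trans (enormD _ _) _; rewrite (enormB y y'); lra.
  by have := h1 _ x1; have := h2 _ y2; have := h3 _ xy; rewrite /e; lra.
by exists x, y; split => // x' y' Kx' Ky'; exact: (h (x', y')).
Qed.

End comparison.

(** * The inequality at a maximum point of the doubled functional *)

Section comparison_principle.
Variables (R : realType) (N : nat).
Local Notation V := 'rV[R]_N.
Local Notation T := (borelV R N).
Variables (lambda : R) (nu : V -> levyMeasure R N).
Implicit Types (x y z p q : V) (u v W psi : V -> R) (H : V -> V -> R).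

Lemma incrZ (a : R) u x p z :
  incr (fun y => a * u y) x (a *: p) z = a * incr u x p z.
Proof. by rewrite /incr dotvZl; ring. Qed.

(** Here [W] is minus the supersolution. At the maximum [u] and [W] are touched with slopes (p + q0)
    / mu and - p, so both equations can be tested. [levy_diff] bounds the sum of the nonlocal terms,
    and [psi] enters only through its slope [q0] and opening [k0]. *)
Lemma doubling_ineq H u W psi x0 y0 q0 p (mu L k0 r s eta t C e4 e' M : R) g :
  uscd u -> uscd W -> (forall x, `|u x| <= M) -> (forall x, `|W x| <= M) -> 0 < M ->
  esub lambda nu H u -> esub lambda nu (Hneg H) W ->
  0 < mu < 1 -> 0 < L -> 0 <= k0 -> 0 < r < 1 -> 1 < s ->
  (forall z, psi (x0 + z) <= psi x0 + dotv q0 z + k0 * dotv z z) ->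
  (forall x y, mu * u x + W y - L * dotv (x - y) (x - y) - psi x <=
     mu * u x0 + W y0 - L * dotv (x0 - y0) (x0 - y0) - psi x0) ->
  adm (eball 0 r) (nu x0) (nu y0) g ->
  (\int[g]_z (dotv (z.1 - z.2) (z.1 - z.2))%:E <= (e4 * enorm (x0 - y0) + e')%:E)%E ->
  (forall (K : R) (f : T -> R), (0 < K)%R -> measurable_fun setT f -> (forall z, 0 <= f z <= K)%R ->
     \int[nu y0]_(z in annulus r s) (f z)%:E <=
     \int[nu x0]_(z in annulus r s) (f z)%:E + (K * eta)%:E)%E ->
  (forall (K : R) (f : T -> R), (0 < K)%R -> measurable_fun setT f -> (forall z, 0 <= f z <= K)%R ->
     \int[nu x0]_(z in annulus r s) (f z)%:E <=
     \int[nu y0]_(z in annulus r s) (f z)%:E + (K * eta)%:E)%E ->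
  (nu x0 (~` eball 0 s) <= t%:E)%E -> (nu y0 (~` eball 0 s) <= t%:E)%E ->
  (\int[nu x0]_z (w2 z)%:E <= C%:E)%E ->
  p = (2 * L) *: (x0 - y0) ->
  lambda * (mu * u x0 + W y0) + mu * H x0 (mu^-1 *: (p + q0)) - H y0 p <=
    L * (e4 * enorm (x0 - y0) + e') + 2 * (enorm q0 * s + k0 * s ^+ 2) * C
    + 2 * (2 * (2 * M + enorm p) * eta) + 2 * (2 * M) * t.
Proof.
move=> uu uW uM WM M0 eu eW /andP[mu0 mu1] L0 k00 r01 s1 psi_up hmax ag cg tv1 tv2 t1 t2 w2C pE0.
set P := p + q0.
have sq (a b : V) : dotv (a + b) (a + b) = dotv a a + 2 * dotv a b + dotv b b.
  by rewrite !dotvE (dotvC b a); ring.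
(* The two points are displaced independently: [z2 = 0] and [z1 = 0] give the two contacts, general
   pairs the bound on the integrands. *)
have base z1 z2 : mu * u (x0 + z1) + W (y0 + z2) <= mu * u x0 + W y0
    + dotv P z1 - dotv p z2 + L * dotv (z1 - z2) (z1 - z2) + k0 * dotv z1 z1.
  have := hmax (x0 + z1) (y0 + z2); have := psi_up z1.
  have -> : x0 + z1 - (y0 + z2) = (x0 - y0) + (z1 - z2) by rewrite opprD addrACA.
  have pE z : dotv p z = 2 * L * dotv (x0 - y0) z by rewrite pE0 dotvZl.
  have dB : dotv (x0 - y0) (z1 - z2) = dotv (x0 - y0) z1 - dotv (x0 - y0) z2.
    by rewrite dotvDr dotvNr.
  by rewrite sq dB /P (dotvDl p) !pE; lra.
have muN0 : mu != 0 by rewrite lt0r_neq0.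
have muP : mu *: (mu^-1 *: P) = P by rewrite scalerA divff// scale1r.
have tu : touched u x0 (mu^-1 *: P) ((L + k0) / mu).
  move=> z; rewrite -(ler_pM2l mu0).
  have -> : mu * (u x0 + dotv (mu^-1 *: P) z + (L + k0) / mu * dotv z z) =
      mu * u x0 + dotv P z + (L + k0) * dotv z z.
    by rewrite dotvZl; field.
  have := base z 0; rewrite addr0 subr0 dotv0r; lra.
have tW : touched W y0 (- p) L.
  move=> z; have := base 0 z; by rewrite addr0 sub0r !dotvE !opprK !dotv0r; lra.
have D0 : 0 <= (L + k0) / mu by rewrite divr_ge0 ?addr_ge0// ltW.
have M2 : 0 < 2 * M by rewrite mulr_gt0.
have mu_ := uscd_measurable uu.
have mW := uscd_measurable uW.
have KF : 0 <= Num.max ((L + k0) / mu) (2 * M) by rewrite le_max D0.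
have KG : 0 <= Num.max L (2 * M) by rewrite le_max (ltW L0).
have [iF0 aF] := integrable_le_w2 (measurable_incr x0 (mu^-1 *: P) mu_) KF
  (incr_le_w2 uM (fun z _ => tu z)) (eu _ _ _ D0 tu).
have [iG aG] := integrable_le_w2 (measurable_incr y0 (- p) mW) KG
  (incr_le_w2 WM (fun z _ => tW z)) (eW _ _ _ (ltW L0) tW).
pose F z := mu * incr u x0 (mu^-1 *: P) z.
pose G := incr W y0 (- p).
have FE z : F z = incr (fun y => mu * u y) x0 P z.
  by rewrite -muP incrZ.
have iF : (nu x0).-integrable setT (EFin \o (F : T -> R)).
  exact: (integrableZl measurableT mu iF0).
have {}aF : mu * (lambda * u x0 + H x0 (mu^-1 *: P)) <= \int[nu x0]_z F z.
  by rewrite RintegralZl// ler_pM2l.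
(* For 1 <= |z| < s the compensators are absent and [dotv q0 z] survives; as [w2] is 1 there,
   [kappa] covers it along with the quadratic term. *)
pose kappa := enorm q0 * s + k0 * s ^+ 2.
have s2 : 1 <= s ^+ 2 by rewrite exprn_ege1// ltW.
have s0 : 0 <= s by apply: ltW; exact: lt_trans s1.
have q0s : 0 <= enorm q0 * s by rewrite mulr_ge0 ?enorm_ge0.
have k0s : k0 <= k0 * s ^+ 2 by rewrite ler_peMr.
have kk : k0 <= kappa by rewrite /kappa; clear -k0s q0s; lra.
have kappa0 : 0 <= kappa by exact: le_trans kk.
have g00 : 0 < 2 * M + enorm p by rewrite ltr_pwDl// enorm_ge0.
have uM2 z : `|mu * u z| <= M.
  by rewrite normrM gtr0_norm//; apply: le_trans (uM z); rewrite ler_piMl// ltW.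
have bnd (f : V -> R) x p' z : (forall y, `|f y| <= M) -> 1 <= enorm z ->
    incr f x p' z <= 2 * M.
  move=> fM z1; rewrite incr_out//.
  move: (fM x) (fM (x + z)); rewrite !ler_norml; clear.
  by move=> /andP[? ?] /andP[? ?]; lra.
have Fw z1 z2 : enorm z1 < 1 -> enorm z2 < 1 ->
    F z1 + G z2 <= L * dotv (z1 - z2) (z1 - z2) + kappa * w2 z1.
  move=> z11 z21; rewrite FE /G !incr_in// (w2_in (ltW z11)) dotvNl.
  have h : k0 * dotv z1 z1 <= kappa * dotv z1 z1 by rewrite ler_wpM2r ?dotv_ge0.
  by have h' := base z1 z2; clear -h h'; lra.
have Fs z : enorm z < s -> F z + G z <= kappa * w2 z.
  move=> zs; have [z1|z1] := ltP (enorm z) 1.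
    by have := Fw z z z1 z1; rewrite subrr dotv0l mulr0 add0r.
  rewrite FE /G !incr_out// w2_out// mulr1.
  have h1 : dotv q0 z <= enorm q0 * s.
    by apply: le_trans (dotv_le _ _) _; rewrite ler_wpM2l ?enorm_ge0// ltW.
  have h2 : k0 * dotv z z <= k0 * s ^+ 2.
    by rewrite ler_wpM2l// -enorm_sqr lerXn2r ?nnegrE ?enorm_ge0 ?(ltW zs).
  have := base z z; rewrite subrr dotv0l mulr0 addr0 /P (dotvDl p) /kappa.
  by clear -h1 h2; lra.
have Gg z : `|G z| <= 2 * M + enorm p.
  have a1 : `|W (y0 + z) - W y0| <= 2 * M.
    apply: le_trans (ler_normB _ _) _; move: (WM (y0 + z)) (WM y0).
    by clear; lra.
  rewrite /G; have [z1|z1] := ltP (enorm z) 1; last first.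
    by rewrite incr_out//; apply: le_trans a1 _; rewrite lerDl enorm_ge0.
  rewrite incr_in//; apply: le_trans (ler_normB _ _) _; apply: lerD => //.
  apply: le_trans (norm_dotv_le _ _) _; rewrite enormN ler_piMr ?enorm_ge0//.
  exact: ltW.
have g20 : 0 < 2 * (2 * M + enorm p) by rewrite mulr_gt0.
have mF : measurable_fun setT (F : T -> R).
  by apply: measurable_funM => //; exact: measurable_incr.
have mG : measurable_fun setT (G : T -> R) by exact: measurable_incr.
have F0 : F 0 = 0 by rewrite /F incr0 mulr0.
have G0 : G 0 = 0 by exact: incr0.
have hF z : s <= enorm z -> F z <= 2 * M.
  by move=> sz; rewrite FE; apply: bnd => //; apply: le_trans sz; exact: ltW.
have hG z : s <= enorm z -> G z <= 2 * M.
  by move=> sz; apply: bnd => //; apply: le_trans sz; exact: ltW.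
have := levy_diff mF mG F0 G0 iF iG r01 s1 (ltW L0) kappa0 (ltW M2) g00 ag cg Fw Fs Gg
  hF hG (fun f mf f01 => tv1 _ f g20 mf f01) (fun f mf f01 => tv2 _ f g20 mf f01) t1 t2 w2C.
by move: aF aG; rewrite /Hneg opprK -/P /kappa /F /G; clear; lra.
Qed.

End comparison_principle.

(** * Choice of the parameters and proof of comparison *)

Section comparison_theorem.
Variables (R : realType) (N : nat).
Local Notation V := 'rV[R]_N.
Variables (lambda : R) (nu : V -> levyMeasure R N).
Implicit Types (x y z p q : V) (u W psi : V -> R) (H : V -> V -> R) (mu L M : R).

(** The functional is at most 0 outside a compact product of balls and positive at (x1, x1), so a
    maximum over that product is global. As mu u + W <= 2 M <= L d^2, positivity forces |x - y| < d
    whatever the penalization. *)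
Lemma doubling_max u W psi mu L M rho d x1 :
  uscd u -> uscd W -> uscd (fun x => - psi x) ->
  (forall x, `|u x| <= M) -> (forall x, `|W x| <= M) -> 0 < M ->
  0 < mu < 1 -> 0 < d -> 2 * M <= L * d ^+ 2 ->
  (forall x, 0 <= psi x) -> (forall x, psi x < 2 * M -> enorm x <= rho) ->
  0 < mu * u x1 + W x1 - psi x1 ->
  exists x0 y0, [/\ enorm (x0 - y0) < d,
    mu * u x1 + W x1 - psi x1 <= mu * u x0 + W y0 &
    forall x y, mu * u x + W y - L * dotv (x - y) (x - y) - psi x <=
      mu * u x0 + W y0 - L * dotv (x0 - y0) (x0 - y0) - psi x0].
Proof.
move=> uu uW upsi uM WM M0 /andP[mu0 mu1] d0 Ld psi0 psi_rho pos.
have L0 : 0 < L.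
  rewrite -(pmulr_lgt0 _ (exprn_gt0 2 d0)); apply: lt_le_trans Ld.
  by rewrite mulr_gt0.
pose Phi x y := mu * u x + W y - L * dotv (x - y) (x - y) - psi x.
have sum_le x y : mu * u x + W y <= 2 * M.
  have : mu * u x <= M.
    apply: le_trans (ler_norm _) _; rewrite normrM gtr0_norm//.
    by apply: le_trans (uM x); rewrite ler_piMl// ltW.
  by have := WM y; rewrite ler_norml => /andP[]; lra.
have in_K x y : 0 < Phi x y -> [/\ enorm x <= rho, enorm (x - y) < d &
    enorm y <= rho + d].
  rewrite /Phi => h; have s := sum_le x y; have p0 := psi0 x.
  have l0 : 0 <= L * dotv (x - y) (x - y) by rewrite mulr_ge0 ?dotv_ge0// ltW.
  have xr : enorm x <= rho by apply: psi_rho; lra.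
  have xy : enorm (x - y) < d.
    rewrite enorm_lt_sqr ?(ltW d0)// -(ltr_pM2l L0); lra.
  split => //; rewrite -[y](subKr x); apply: le_trans (enormD _ _) _.
  by rewrite enormN; lra.
have Phi1 : Phi x1 x1 = mu * u x1 + W x1 - psi x1.
  by rewrite /Phi subrr dotv0l mulr0 subr0.
have pos1 : 0 < Phi x1 x1 by rewrite Phi1.
have [k1 _ k2] := in_K _ _ pos1.
have uq : uscd (fun z : V => - L * dotv z z).
  apply: continuous_uscd => z; apply: (@continuousM _ V (cst (- L)) (fun y => dotv y y)).
    exact: cst_continuous.
  exact: dotv_continuous.
have [x0 [y0 [_ _ hm]]] := uscd_max2 (uscdD (uscdZ mu0 uu) upsi) uW uq
  (@bounded_eball_compact R N rho) (@bounded_eball_compact R N (rho + d))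
  (ex_intro _ x1 k1) (ex_intro _ x1 k2).
have hmax x y : Phi x y <= Phi x0 y0.
  have h1 : Phi x1 x1 <= Phi x0 y0 by have := hm x1 x1 k1 k2; rewrite /Phi; lra.
  have [h|] := leP (Phi x y) 0; first by apply: le_trans h _; apply: le_trans h1; exact: ltW.
  by move=> /in_K [a _ b]; have := hm x y a b; rewrite /Phi; lra.
have h1 := hmax x1 x1.
have [_ xy _] := in_K _ _ (lt_le_trans pos1 h1).
exists x0, y0; split => //.
rewrite -Phi1; apply: le_trans h1 _; rewrite /Phi.
have : 0 <= L * dotv (x0 - y0) (x0 - y0) by rewrite mulr_ge0 ?dotv_ge0// ltW.
by have := psi0 x0; lra.
Qed.

(** The quantities to be made small are the slope of the penalization, its value at the reference
    point and its nonlocal contribution. Since b^2 <= b, each is at most [b] times a constant free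
    of [b]. *)
Lemma small_factor (K s C X th : R) : 0 <= K -> 0 <= s -> 0 <= C -> 0 <= X ->
  0 < th -> th <= 1 ->
  exists2 b, 0 < b <= 1 & [/\ 2 * K * b <= th, K * b ^+ 2 * X <= th &
    2 * (2 * K * b * s + K * b ^+ 2 * s ^+ 2) * C <= th].
Proof.
move=> K0 s0 C0 X0 th0 th1.
pose A1 := 2 * K; pose A2 := K * X; pose A3 := 2 * (2 * K * s + K * s ^+ 2) * C.
have A10 : 0 <= A1 by rewrite mulr_ge0.
have A20 : 0 <= A2 by rewrite mulr_ge0.
have A30 : 0 <= A3.
  by rewrite mulr_ge0// mulr_ge0// addr_ge0// ?mulr_ge0// sqr_ge0.
have B1 : 1 <= 1 + A1 + A2 + A3 by clear -A10 A20 A30; lra.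
have B0 : 0 < 1 + A1 + A2 + A3 by apply: lt_le_trans B1.
pose b := th / (1 + A1 + A2 + A3).
have b0 : 0 < b by rewrite divr_gt0.
have bB : b * (1 + A1 + A2 + A3) = th by rewrite divfK// lt0r_neq0.
have b1 : b <= 1 by apply: le_trans th1; rewrite -bB ler_peMr// ltW.
have b2 : b ^+ 2 <= b by rewrite expr2 ler_piMl// ltW.
exists b; first by rewrite b0.
have p1 := mulr_ge0 (ltW b0) A10.
have p2 := mulr_ge0 (ltW b0) A20.
have p3 := mulr_ge0 (ltW b0) A30.
move: bB; rewrite !mulrDr mulr1 => bB.
have h1 : b * A1 <= th by clear -bB b0 p1 p2 p3; lra.
have h2 : b * A2 <= th by clear -bB b0 p1 p2 p3; lra.
have h3 : b * A3 <= th by clear -bB b0 p1 p2 p3; lra.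
split; first by rewrite /A1 mulrC in h1.
  by apply: le_trans h2; rewrite /A2 mulrAC mulrC ler_wpM2r.
apply: le_trans h3; rewrite /A3 [leRHS]mulrA; apply: ler_wpM2r => //.
have -> : b * (2 * (2 * K * s + K * s ^+ 2)) = 2 * (2 * K * b * s + K * s ^+ 2 * b).
  by ring.
by rewrite -mulrDr ler_pM2l// lerD2l [leRHS]mulrAC ler_wpM2r ?sqr_ge0// ler_wpM2l.
Qed.

(** With [X] standing for |p + q|^m, all terms proportional to [X] are absorbed by [c * X], and the
    remaining constants add up to less than lsig / 2 = 8 tau. *)
Lemma comparison_arith (lsig c e e1 e4 eta X pn M tau pen t : R) :
  16 * tau = lsig -> 0 < tau -> 0 < c -> 0 <= X -> 0 < M ->
  0 < e1 -> 0 < e4 -> 0 < eta -> 0 <= pn ->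
  e <= tau -> e1 <= c / 4 -> e1 <= tau -> e4 <= c / 4 -> e4 <= tau / 3 ->
  eta <= c / 16 -> eta * (4 * (2 * M + 2)) <= tau -> 2 * (2 * M) * t = tau ->
  pn <= 2 + X -> pen <= tau ->
  lsig / 2 + (c * X - e) - e1 * (1 + X) <= e4 * (pn / 2) + e4 + pen
    + 2 * (2 * (2 * M + pn) * eta) + 2 * (2 * M) * t -> False.
Proof.
move=> <- tau0 c0 X0 M0 e10 e40 eta0 pn0 h1 h2 h3 h4 h5 h6 h7 h8 h9 h10 h.
have t1 : e4 * pn <= e4 * (2 + X) by rewrite ler_pM2l.
have t2 : e4 * X <= c / 4 * X by rewrite ler_wpM2r.
have t3 : e1 * X <= c / 4 * X by rewrite ler_wpM2r.
have t4 : eta * X <= c / 16 * X by rewrite ler_wpM2r.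
have t5 : eta * pn <= eta * (2 + X) by rewrite ler_pM2l.
have cX : 0 <= c * X by rewrite mulr_ge0// ltW.
have t6 : 0 <= e4 * pn by rewrite mulr_ge0// ltW.
by rewrite h8 in h; move: h; lra.
Qed.

Lemma comparison H (m : R) u W M : (0 < N)%N -> 0 < lambda -> 1 <= m ->
  hypM1 nu -> hypM2 nu -> hypM3 nu -> hypM4 nu ->
  hypH0 H -> hypH1 m H -> hypH2 m H ->
  uscd u -> uscd W -> (forall x, `|u x| <= M) -> (forall x, `|W x| <= M) ->
  esub lambda nu H u -> esub lambda nu (Hneg H) W ->
  forall x, u x + W x <= 0.
Proof.
move=> N0 l0 m1 h1 h2 h3 h4 hH0 hH1 hH2 uu uW uM WM eu eW x1.
rewrite leNgt; apply/negP => sig0; set sig := u x1 + W x1 in sig0.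
have bu x := uM x; have bW x := WM x.
have M0 : 0 < M.
  have := uM x1; have := WM x1; rewrite !ler_norml => /andP[_ a] /andP[_ b].
  by rewrite /sig in sig0; lra.
have [C C0 hC] := hypM1P h1.
pose tau := lambda * sig / 16.
have tau0 : 0 < tau by rewrite divr_gt0 ?mulr_gt0.
(* The second bound makes the replacement of [u] by mu u cost at most [sig / 4] at [x1]. *)
pose e := Num.min tau (sig / (4 * (M + 1))).
have e0 : 0 < e by rewrite lt_min tau0 divr_gt0//; lra.
have etau : e <= tau by rewrite ge_min lexx.
have eM : e * M <= sig / 4.
  have : e * (4 * (M + 1)) <= sig.
    by rewrite -ler_pdivlMr ?ge_min ?lexx ?orbT//; lra.
  by lra.
have [mu [c [mu01 mue c0 hmu]]] := hypH2P N0 m1 hH0 hH1 hH2 e0.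
have /andP[mu0 mu1] := mu01.
have musig : 3 / 4 * sig <= mu * u x1 + W x1.
  have : (1 - mu) * u x1 <= e * M.
    apply: (@le_trans _ _ ((1 - mu) * M)); last by rewrite ler_wpM2r// ltW.
    by rewrite ler_wpM2l ?subr_ge0 ?(ltW mu1)// (le_trans (ler_norm _)).
  by rewrite /sig in eM *; lra.
pose e1 := Num.min (c / 4) tau.
have e10 : 0 < e1 by rewrite lt_min tau0 divr_gt0.
have e1c : e1 <= c / 4 by rewrite ge_min lexx.
have e1t : e1 <= tau by rewrite ge_min lexx orbT.
have [d1 d10 hd1] := hypH1P N0 m1 hH1 (hypH0_cont hH0) e10.
pose e4 := Num.min (c / 4) (tau / 3).
have e40 : 0 < e4 by rewrite lt_min; apply/andP; split; exact: divr_gt0.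
have e4c : e4 <= c / 4 by rewrite ge_min lexx.
have e4t : e4 <= tau / 3 by rewrite ge_min lexx orbT.
have [r r01 hr] := hypM4P h4 e40 (@ltr01 R).
pose t := tau / (4 * M).
have M4 : 0 < 4 * M by rewrite mulr_gt0.
have t0 : 0 < t by rewrite divr_gt0.
have tM : 2 * (2 * M) * t = tau.
  by rewrite /t; field; rewrite lt0r_neq0.
have [s s1 hs] := hypM2P h2 t0.
pose A := 4 * (2 * M + 2).
have A0 : 0 < A by rewrite /A; lra.
pose eta := Num.min (c / 16) (tau / A).
have eta0 : 0 < eta by rewrite lt_min; apply/andP; split; exact: divr_gt0.
have etac : eta <= c / 16 by rewrite ge_min lexx.
have etat : eta * A <= tau by rewrite -ler_pdivlMr// ge_min lexx orbT.
have rs : 0 < r < s by have /andP[-> ?] := r01; apply: lt_trans s1.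
have [d3 d30 hd3] := hypM3_scale h3 rs eta0.
pose d := Num.min d1 d3.
have d0 : 0 < d by rewrite lt_min d10.
(* This [L] forces |x0 - y0| < d before the penalization is chosen. *)
pose L := 2 * M / d ^+ 2.
have L0 : 0 < L by rewrite divr_gt0 ?mulr_gt0 ?exprn_gt0.
have Ld : 2 * M <= L * d ^+ 2 by rewrite divfK// lt0r_neq0// exprn_gt0.
(* [th] keeps the nonlocal contribution of the penalization below [tau], its value at [x1] below
   [sig / 4], and its slope below 1 and below [d1], so that [hypH1P] applies. *)
pose th := Num.min (Num.min tau (sig / 4)) (Num.min (d1 / 2) 1).
have th0 : 0 < th by rewrite !lt_min tau0 ltr01 /= andbT; apply/andP; split; exact: divr_gt0.
have th1 : th <= tau by rewrite !ge_min lexx.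
have th2 : th <= sig / 4 by rewrite !ge_min lexx !orbT.
have th3 : th < d1.
  have : th <= d1 / 2 by rewrite !ge_min lexx !orbT.
  by clear -d10; lra.
have th4 : th <= 1 by rewrite !ge_min lexx !orbT.
have s0 : 0 <= s by apply: ltW; exact: lt_trans s1.
have [b b01 [bq bx bK]] :=
  small_factor (ltW M4) s0 (ltW C0) (dotv_ge0 x1) th0 th4.
have /andP[b0 b1] := b01.
have [psi [q [[upsi hpsi psi_rho] [qb psi_up]]]] := penalization N M4 b01.
have psi1 : psi x1 <= sig / 4.
  by have /andP[_ h] := hpsi x1; apply: le_trans h _; exact: le_trans bx th2.
have psi0 x : 0 <= psi x by case/andP: (hpsi x).
have psi_rho' x : psi x < 2 * M -> enorm x <= b^-1.
  move=> h; rewrite -[b^-1]mul1r ler_pdivlMr// mulrC; apply: psi_rho.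
  by clear -h; lra.
have low1 : sig / 2 <= mu * u x1 + W x1 - psi x1 by clear -musig psi1; lra.
have pos : 0 < mu * u x1 + W x1 - psi x1 by apply: lt_le_trans low1; rewrite divr_gt0.
have [x0 [y0 [xyd low hmax]]] :=
  doubling_max uu uW upsi uM WM M0 mu01 d0 Ld psi0 psi_rho' pos.
have xd1 : enorm (x0 - y0) < d1 by apply: lt_le_trans xyd _; rewrite ge_min lexx.
have xd3 : enorm (x0 - y0) < d3 by apply: lt_le_trans xyd _; rewrite ge_min lexx orbT.
have yd3 : enorm (y0 - x0) < d3 by rewrite enormB.
(* Multiplied by [L], the slack [e4 / L] becomes [e4], and L |x0 - y0| is |p| / 2: the coupling term
   is linear in the slope. *)
have [g ag cg] := hr x0 y0 _ (divr_gt0 e40 L0).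
pose p := (2 * L) *: (x0 - y0).
have k00 : 0 <= 4 * M * b ^+ 2 by rewrite mulr_ge0 ?sqr_ge0// ltW.
have main := doubling_ineq uu uW uM WM M0 eu eW mu01 L0 k00 r01 s1 (psi_up x0) hmax
  ag cg (hd3 _ _ yd3) (hd3 _ _ xd3) (hs x0) (hs y0) (hC x0) (erefl p).
have q0b : enorm (q x0) <= th by apply: le_trans (qb x0) bq.
have qd1 : enorm (- q x0) < d1 by rewrite enormN; exact: le_lt_trans q0b th3.
have pP : enorm p <= enorm (p + q x0) + 1.
  rewrite -[p in enorm p](addrK (q x0)); apply: le_trans (enormD _ _) _.
  by rewrite enormN lerD2l; exact: le_trans q0b th4.
have Pm := le_powR1 m1 (enorm_ge0 (p + q x0)).
have H1 := hd1 x0 y0 (p + q x0) (- q x0) xd1 qd1.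
rewrite addrK in H1.
have H2 := hmu x0 (p + q x0).
have low2 : lambda * sig / 2 <= lambda * (mu * u x0 + W y0).
  by rewrite -mulrA ler_pM2l//; exact: le_trans low1 low.
have pL : L * (e4 * enorm (x0 - y0) + e4 / L) = e4 * (enorm p / 2) + e4.
  rewrite /p enormZ ger0_norm; last by rewrite mulr_ge0// ltW.
  by field; rewrite lt0r_neq0.
have pen : 2 * (enorm (q x0) * s + 4 * M * b ^+ 2 * s ^+ 2) * C <= tau.
  apply: le_trans th1; apply: le_trans bK; apply: ler_wpM2r; first exact: ltW.
  by rewrite ler_pM2l// lerD2r ler_wpM2r.
have ls : 16 * tau = lambda * sig by rewrite /tau mulrC divfK.
have pX : enorm p <= 2 + enorm (p + q x0) `^ m by clear -pP Pm; lra.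
have fin := (comparison_arith ls tau0 c0 (powR_ge0 _ _) M0 e10 e40 eta0 (enorm_ge0 p)
  etau e1c e1t e4c e4t etac etat tM pX pen).
apply: fin; rewrite -pL; apply: le_trans main.
by clear -low2 H1 H2; lra.
Qed.

End comparison_theorem.

(** * Test functions and viscosity solutions *)

Section taylor.
Variables (R : realType) (N : nat).
Local Notation V := 'rV[R]_N.
Implicit Types (x y z p : V) (f phi : V -> R) (r C : R).

Lemma derive_sum f x z : differentiable f x ->
  'D_z f x = \sum_(i < N) z 0 i * 'D_(delta_mx 0 i) f x.
Proof.
move=> df; rewrite deriveE// [in LHS](row_sum_delta z) linear_sum.
by apply: eq_bigr => i _; rewrite linearZ/= deriveE.
Qed.

Lemma derive_line f x z (t : R) : derivable f (x + t *: z) z ->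
  is_derive t 1 (fun s : R => f (x + s *: z)) ('D_z f (x + t *: z)).
Proof.
have E : (fun h : R => h^-1 *: (((fun s : R => f (x + s *: z)) \o shift t) (h *: 1) -
    f (x + t *: z))) =
    (fun h => h^-1 *: ((f \o shift (x + t *: z)) (h *: z) - f (x + t *: z))).
  apply/funext => h; rewrite /= /shift/=; congr (_ *: (f _ - _)).
  by rewrite scalerDl addrCA [h *: 1]mulr1.
move=> df; apply: DeriveDef.
  by rewrite /derivable E.
by rewrite /derive E.
Qed.

Lemma MVT_line f x z r : (forall y, enorm (y - x) < r -> differentiable f y) ->
  enorm z < r -> exists2 c : R, 0 < c < 1 &
  f (x + z) - f x = \sum_(i < N) z 0 i * 'D_(delta_mx 0 i) f (x + c *: z).
Proof.
move=> df zr.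
have in_r (t : R) : 0 <= t <= 1 -> enorm (x + t *: z - x) < r.
  move=> /andP[t0 t1]; rewrite addrAC subrr add0r enormZ ger0_norm//.
  by apply: le_lt_trans zr; rewrite ler_piMl// enorm_ge0.
have dl (t : R) : 0 <= t <= 1 ->
    is_derive t 1 (fun s : R => f (x + s *: z)) ('D_z f (x + t *: z)).
  by move=> /in_r /df h; apply: derive_line; exact: diff_derivable.
have [||c] := @MVT R (fun s => f (x + s *: z)) (fun s => 'D_z f (x + s *: z)) 0 1 ltr01.
- by move=> t; rewrite in_itv/= => /andP[/ltW t0 /ltW t1]; apply: dl; rewrite t0.
- apply: derivable_within_continuous => t; rewrite in_itv/= => t01.
  by case: (dl t t01).
rewrite in_itv/= => c01; rewrite scale1r scale0r addr0 subr0 mulr1 => ->.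
exists c => //; rewrite derive_sum//; apply/df/in_r.
by case/andP: c01 => /ltW -> /ltW ->.
Qed.

Lemma sum_coord_le z (a : 'I_N -> R) (b : R) : (forall i, `|a i| <= b) ->
  `|\sum_(i < N) z 0 i * a i| <= N%:R * b * enorm z.
Proof.
move=> ab; apply: le_trans (ler_norm_sum _ _ _) _.
apply: (@le_trans _ _ (\sum_(i < N) (b * enorm z))).
  apply: ler_sum => i _; rewrite normrM mulrC; apply: ler_pM => //.
  exact: coord_le_enorm.
by rewrite sumr_const card_ord -[leLHS]mulr_natl mulrA.
Qed.

(** The mean value theorem along segments is used twice, for [phi] and for its partial derivatives.
    Continuity bounds the second derivatives near [x], and the crude constant N^2 B is enough. *)
Lemma C2_taylor phi x : C2_on (eball x 1) phi -> exists r C, [/\ 0 < r < 1, 0 <= C &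
  forall z, enorm z < r ->
    `|phi (x + z) - phi x - dotv (grad phi x) z| <= C * dotv z z].
Proof.
move=> [[dphi _] C2].
pose e i : V := delta_mx 0 i.
pose g i := 'D_(e i) phi.
have xx : eball x 1 x by rewrite /eball /= subrr enorm0.
have bd (ij : 'I_N * 'I_N) : exists b, 0 < b /\ exists r, 0 < r /\
    forall y, enorm (y - x) < r -> `|'D_(e ij.2) (g ij.1) y| <= b.
  have [_ /(_ (e ij.2) x xx) c] := C2 (e ij.1).
  have /(@cvgrPdist_le _ _ _ (nbhs x) (nbhs_filter _)) /(_ 1 ltr01) /nbhs_eball[r r0 hr] := c.
  exists (`|'D_(e ij.2) (g ij.1) x| + 1); split; first by rewrite ltr_pwDr.
  exists r; split => // y /hr; rewrite distrC => h.
  rewrite -[X in `|X| <= _](subrK ('D_(e ij.2) (g ij.1) x)) addrC.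
  by apply: le_trans (ler_normD _ _) _; rewrite lerD2l.
have /choice [b hb] := bd.
have /choice [rr hr] : forall ij, exists r, 0 < r /\
    forall y, enorm (y - x) < r -> `|'D_(e ij.2) (g ij.1) y| <= b ij.
  by move=> ij; case: (hb ij).
pose r : R := Num.min (1 / 2) (\big[Num.min/1]_ij rr ij).
pose B : R := \sum_ij b ij.
have b0 ij : 0 < b ij by case: (hb ij).
have bB ij : b ij <= B.
  rewrite /B (bigD1 ij)//= lerDl; apply: sumr_ge0 => k _; exact: ltW.
have B0 : 0 <= B by apply: sumr_ge0 => k _; exact: ltW.
have r0 : 0 < r.
  rewrite lt_min divr_gt0//=; apply: (big_ind (fun t => 0 < t)) => // [a c a0 c0|ij _].
    by rewrite lt_min a0.
  by case: (hr ij).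
have r_le ij : r <= rr ij.
  by rewrite /r (bigD1 ij)//= !ge_min lexx orbT.
have r1 : r < 1.
  apply: (@le_lt_trans _ _ (1 / 2)); first by rewrite ge_min lexx.
  by rewrite ltr_pdivrMr// mul1r ltr1n.
have in1 y : enorm (y - x) < r -> eball x 1 y.
  by move=> /lt_trans; apply.
have glip i w : enorm w < r -> `|g i (x + w) - g i x| <= N%:R * B * enorm w.
  move=> wr; have [|c /andP[c0 c1] ->] := @MVT_line (g i) x w r _ wr.
    by move=> y /in1 yx; case: (C2 (e i)) => h _; exact: h.
  apply: sum_coord_le => j; apply: le_trans (bB (i, j)).
  have [_ h] := hr (i, j); apply: h => /=.
  rewrite addrAC subrr add0r enormZ gtr0_norm//.
  apply: (lt_le_trans _ (r_le (i, j))); apply: le_lt_trans wr.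
  by rewrite ler_piMl ?enorm_ge0// ltW.
exists r, (N%:R * (N%:R * B)); split; first by rewrite r0.
  by rewrite !mulr_ge0.
move=> z zr; have [|c /andP[c0 c1] ->] := @MVT_line phi x z r _ zr.
  by move=> y /in1; exact: dphi.
have -> : dotv (grad phi x) z = \sum_(i < N) z 0 i * g i x.
  by apply: eq_bigr => i _; rewrite mxE mulrC.
rewrite -sumrB.
under eq_bigr do rewrite -mulrBr.
have czz : enorm (c *: z) <= enorm z.
  by rewrite enormZ gtr0_norm// ler_piMl ?enorm_ge0// ltW.
apply: (@le_trans _ _ (N%:R * (N%:R * B * enorm z) * enorm z)); last first.
  by rewrite -enorm_sqr expr2 !mulrA.
apply: sum_coord_le => i.
apply: le_trans (glip i (c *: z) (le_lt_trans czz zr)) _.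
by rewrite ler_wpM2l// mulr_ge0.
Qed.

End taylor.

(** * From paraboloids to C^2 test functions *)

Section viscosity_solution.
Variables (R : realType) (N : nat).
Local Notation V := 'rV[R]_N.
Local Notation T := (borelV R N).
Variables (lambda : R) (nu : V -> levyMeasure R N).
Implicit Types (x y z p : V) (u phi : V -> R) (H : V -> V -> R) (r C M delta : R).

Lemma nonlocal_opE (A : set T) x p u :
  nonlocal_op nu A x p u = \int[nu x]_(z in A) incr u x p z.
Proof. by []. Qed.

(** Integrability is not assumed: when the positive or the negative part has infinite integral,
    [fine] sends both sides to 0. *)
Lemma nonlocal_opN (A : set T) x p u :
  nonlocal_op nu A x (- p) (fun y => - u y) = - nonlocal_op nu A x p u.
Proof.
rewrite !nonlocal_opE /Rintegral.
under eq_integral do rewrite incrN.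
rewrite integralE [in RHS]integralE.
pose f z := (incr u x p z)%:E.
rewrite (_ : (fun z => (- incr u x p z)%:E) = (\- f)%E)// funeposN funenegN.
have p0 : (0 <= \int[nu x]_(z in A) (f^\+ z))%E by exact: integral_ge0.
have n0 : (0 <= \int[nu x]_(z in A) (f^\- z))%E by exact: integral_ge0.
rewrite -/f; move: p0 n0.
case: (\int[nu x]_(z in A) (f^\+ z))%E => [a| |]//;
  case: (\int[nu x]_(z in A) (f^\- z))%E => [b| |]//= _ _; rewrite ?oppr0//.
by rewrite opprB.
Qed.

(** The Taylor bound and the local contact make [u] globally touched by a paraboloid of slope [p].
    This gives the inequality with [u] in the whole integral, and integrability; [phi] then replaces
    [u] on the ball, where its increments are larger. *)
Lemma esub_test H u phi x p r C M B delta :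
  uscd u -> (forall y, `|u y| <= M) -> esub lambda nu H u ->
  measurable_fun setT (phi : T -> R) -> (forall y, `|phi y| <= B) ->
  0 < r < 1 -> 0 <= C ->
  (forall z, enorm z < r -> `|phi (x + z) - phi x - dotv p z| <= C * dotv z z) ->
  0 < delta -> (forall z, enorm z < delta -> u (x + z) - u x <= phi (x + z) - phi x) ->
  lambda * u x - nonlocal_op nu (eball 0 delta) x p phi
    - nonlocal_op nu (~` eball 0 delta) x p u + H x p <= 0.
Proof.
move=> uu uM eu mphi phiB /andP[r0 r1] C0 tay d0 tou.
have M0 : 0 <= M := le_trans (normr_ge0 _) (uM x).
have B0 : 0 <= B := le_trans (normr_ge0 _) (phiB x).
pose s := Num.min r delta.
have s0 : 0 < s by rewrite lt_min r0.
(* [C] serves where |z| < s; for |z| >= s the other two terms dominate the oscillation [2 * M] and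
   the linear term. *)
pose D := C + 2 * M / s ^+ 2 + enorm p / s.
have Ms : 0 <= 2 * M / s ^+ 2 by apply: divr_ge0; [exact: mulr_ge0|exact: sqr_ge0].
have ps : 0 <= enorm p / s by rewrite divr_ge0 ?enorm_ge0// ltW.
have D0 : 0 <= D by rewrite !addr_ge0.
have tu : touched u x p D.
  move=> z; have z0 := dotv_ge0 z; have [|zs] := ltP (enorm z) s.
    rewrite lt_min => /andP[/tay + /tou]; rewrite ler_norml => /andP[_ a] b.
    have : C * dotv z z <= D * dotv z z.
      by rewrite ler_wpM2r// /D -addrA lerDl addr_ge0.
    by clear -a b; lra.
  have e0 := enorm_ge0 z.
  have a1 : 2 * M <= 2 * M / s ^+ 2 * dotv z z.
    rewrite mulrAC ler_pdivlMr ?exprn_gt0// ler_wpM2l ?mulr_ge0//.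
    by rewrite -enorm_sqr lerXn2r ?nnegrE// ltW.
  have a2 : - dotv p z <= enorm p / s * dotv z z.
    rewrite -dotvNr; apply: le_trans (dotv_le _ _) _; rewrite enormN.
    rewrite mulrAC ler_pdivlMr// -mulrA ler_wpM2l ?enorm_ge0//.
    by rewrite -enorm_sqr expr2 ler_wpM2l.
  have a3 : 0 <= C * dotv z z by rewrite mulr_ge0.
  have := uM x; have := uM (x + z); rewrite !ler_norml => /andP[_ b1] /andP[b2 _].
  by rewrite /D !mulrDl; clear -a1 a2 a3 b1 b2; lra.
have mu_ := uscd_measurable uu.
have K0 : 0 <= Num.max D (2 * M) by rewrite le_max D0.
have [iu au] := integrable_le_w2 (measurable_incr x p mu_) K0
  (incr_le_w2 uM (fun z _ => tu z)) (eu _ _ _ D0 tu).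
have mA := @measurable_eball0T R N delta.
have mAC := @measurable_eball0C R N delta.
have split_u : \int[nu x]_z incr u x p z = \int[nu x]_(z in eball 0 delta) incr u x p z
    + \int[nu x]_(z in ~` eball 0 delta) incr u x p z.
  have E : (setT : set T) = eball 0 delta `|` ~` eball 0 delta by rewrite setUv.
  rewrite [in LHS]E Rintegral_setU ?setUv//.
  by apply/disj_setPS => z [zs /(_ zs)].
(* A two-sided bound by [w2], making the increments of [phi] integrable over the ball. *)
pose K := C + (2 * B + enorm p) / r ^+ 2.
have Bp : 0 <= 2 * B + enorm p by apply: addr_ge0; [exact: mulr_ge0|exact: enorm_ge0].
have Br : 0 <= (2 * B + enorm p) / r ^+ 2 by apply: divr_ge0 => //; exact: sqr_ge0.
have phiK z : `|incr phi x p z| <= K * w2 z.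
  have [zr|zr] := ltP (enorm z) r.
    have z1 := lt_trans zr r1.
    rewrite incr_in// w2_in ?(ltW z1)//; apply: le_trans (tay z zr) _.
    by rewrite ler_wpM2r ?dotv_ge0// lerDl.
  have w2r : r ^+ 2 <= w2 z.
    rewrite le_min exprn_ile1 ?(ltW r0) ?(ltW r1)//=.
    by rewrite lerXn2r ?nnegrE ?enorm_ge0// ltW.
  apply: (@le_trans _ _ (2 * B + enorm p)).
    have a1 : `|phi (x + z) - phi x| <= 2 * B.
      apply: le_trans (ler_normB _ _) _; have := phiB (x + z); have := phiB x.
      by clear; lra.
    have [z1|z1] := ltP (enorm z) 1; last first.
      by rewrite incr_out//; apply: le_trans a1 _; rewrite lerDl enorm_ge0.
    rewrite incr_in//; apply: le_trans (ler_normB _ _) _; apply: lerD => //.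
    by apply: le_trans (norm_dotv_le _ _) _; rewrite ler_piMr ?enorm_ge0// ltW.
  apply: (@le_trans _ _ ((2 * B + enorm p) / r ^+ 2 * w2 z)).
    by rewrite mulrAC ler_pdivlMr ?exprn_gt0// ler_wpM2l.
  by rewrite ler_wpM2r ?w2_ge0// lerDr.
have iphi : (nu x).-integrable (eball 0 delta : set T) (EFin \o (incr phi x p : T -> R)).
  have iw : (nu x).-integrable (eball 0 delta : set T) (EFin \o (fun z : T => K * w2 z)).
    apply: (integrableS measurableT) => //.
    exact: (integrableZl measurableT K (integrable_w2 (nu x))).
  apply: (le_integrable mA _ _ iw).
    by apply: measurableEFinS; exact: measurable_incr.
  by move=> z _ /=; rewrite lee_fin; apply: le_trans (phiK z) (ler_norm _).
have le_phi : \int[nu x]_(z in eball 0 delta) incr u x p z <=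
    \int[nu x]_(z in eball 0 delta) incr phi x p z.
  apply: le_Rintegral => //; first exact: (integrableS measurableT).
  by move=> z; rewrite eball0E => /tou; rewrite /incr lerD2r.
by rewrite !nonlocal_opE; clear -le_phi split_u au; lra.
Qed.

Lemma bounded_funP u : bounded_fun u -> exists M, forall y, `|u y| <= M.
Proof. by move=> [A [_ hA]]; exists (A + 1) => y; apply: hA => //; rewrite ltrDl. Qed.

Lemma le_bounded_fun u M : (forall y, `|u y| <= M) -> bounded_fun u.
Proof.
move=> uM; exists M; split; first exact: num_real.
by move=> A MA y _; apply: le_trans (uM y) (ltW MA).
Qed.

Lemma eball_shift x r z : eball x r (x + z) <-> enorm z < r.
Proof. by rewrite /eball /= addrAC subrr add0r. Qed.

Lemma esub_visc_subsol H u M : uscd u -> (forall y, `|u y| <= M) ->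
  esub lambda nu H u -> visc_subsol lambda nu H u.
Proof.
move=> uu uM eu; split; first exact: uscd_usc.
  by split; [exact: uscd_measurable|exact: le_bounded_fun uM].
move=> x delta phi d0 C2 [mphi /bounded_funP[B phiB]] tou.
have [r [C [r01 C0 tay]]] := C2_taylor C2.
apply: (esub_test uu uM eu mphi phiB r01 C0 tay d0) => z zd.
by have := tou (x + z) ((eball_shift _ _ _).2 zd); lra.
Qed.

Lemma esuper_visc_supersol H v M : lscd v -> (forall y, `|v y| <= M) ->
  esuper lambda nu H v -> visc_supersol lambda nu H v.
Proof.
move=> lv vM ev; split; first exact: lscd_lsc.
  by split; [exact: lscd_measurable|exact: le_bounded_fun vM].
move=> x delta phi d0 C2 [mphi /bounded_funP[B phiB]] tou.
have [r [C [r01 C0 tay]]] := C2_taylor C2.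
have NvM y : `|- v y| <= M by rewrite normrN.
have NphiB y : `|- phi y| <= B by rewrite normrN.
have Ntay z : enorm z < r ->
    `|- phi (x + z) - - phi x - dotv (- grad phi x) z| <= C * dotv z z.
  by move=> /tay; rewrite dotvNl -!opprD normrN.
have Ntou z : enorm z < delta -> - v (x + z) - - v x <= - phi (x + z) - - phi x.
  by move=> zd; have := tou (x + z) ((eball_shift _ _ _).2 zd); lra.
have := esub_test lv NvM ev (measurable_funN mphi) NphiB r01 C0 Ntay d0 Ntou.
by rewrite !nonlocal_opN /Hneg !opprK /visc_op; lra.
Qed.

End viscosity_solution.

(** * Existence by Perron's method and comparison *)

Theorem theorem2p9 (R : realType) (N : nat) (hN : (0 < N)%N)
  (lambda : R) (hlambda : 0 < lambda)
  (nu : 'rV[R]_N -> levyMeasure R N)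
  (hM1 : hypM1 nu) (hM2 : hypM2 nu) (hM3 : hypM3 nu) (hM4 : hypM4 nu)
  (H : 'rV[R]_N -> 'rV[R]_N -> R) (m : R) (hm : 1 < m)
  (hH0 : hypH0 H) (hH1 : hypH1 m H) (hH2 : hypH2 m H) :
  exists u : 'rV[R]_N -> R, visc_sol lambda nu H u.
Proof.
have [_ [K0 hK0]] := hH0.
have m1 : 1 <= m := ltW hm.
(* With this [M] the constants - M and M are a subsolution and a supersolution. *)
pose M := `|K0| / lambda.
have M0 : 0 <= M by rewrite divr_ge0// ltW.
have HM x : `|H x 0| <= lambda * M.
  rewrite mulrC divfK ?lt0r_neq0//; apply: le_trans (ler_norm _).
  by apply: hK0; exists x.
have Hc := hypH0_cont hH0.
pose u := usce (perron_sup lambda nu H M).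
have [uu uM eu] := perron_env_class hM2 hM3 hM4 hlambda Hc M0 HM.
pose W := usce (fun x => - u x).
have NuM x : `|- u x| <= M by rewrite normrN.
have WM := usce_bound NuM.
have uW : uscd W := usce_uscd NuM.
have eW := perron_env_esuper hM2 hM3 hM4 hlambda Hc M0 HM.
(* Comparison gives [u + W <= 0] and the envelope gives the converse, so [u] equals its lower
   envelope and is continuous. *)
have Wu x : W x = - u x.
  apply/eqP; rewrite eq_le (le_usce NuM) andbT.
  have eW' : esub lambda nu (Hneg H) W.
    by move: eW; rewrite /esuper (_ : (fun x => - - W x) = W)//; apply/funext => y; rewrite opprK.
  have := comparison hN hlambda m1 hM1 hM2 hM3 hM4 hH0 hH1 hH2 uu uW uM WM eu eW' x.
  by rewrite -/u; lra.
have lu : lscd u.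
  by rewrite /lscd (_ : (fun x => - u x) = W)//; apply/funext => x; rewrite Wu.
have esu : esuper lambda nu H u.
  move: eW; rewrite (_ : (fun x => - W x) = u)//.
  by apply/funext => x; rewrite Wu opprK.
exists u; split.
- exact: uscd_lscd_continuous.
- by split; [exact: uscd_measurable|exact: le_bounded_fun uM].
- exact: esub_visc_subsol uM eu.
- exact: esuper_visc_supersol uM esu.
Qed.
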